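(* Let $n\ge1$ and $r_\circ=\tfrac18$. There exists a constant $C$, depending only on $n$, such that for all $u,f\in C^\infty(B_1)$ with $\Delta u=f$ in $B_1$, and for every $x\in B_{3/4}$, $$\mathcal{M}_2^{\#}D^2u(x)\;\le\; C\left(\|u\|_{L^2(B_1)}^2+\|f\|_{L^2(B_1)}^2+\mathcal{M}_2^{\#}f(x)\right).$$
   Context: $B_r(x)\subset\mathbb{R}^n$ is the ball of radius $r$ centered at $x$, and $B_r=B_r(0)$. For a set $E$ of finite positive measure, $\fint_E w=\frac1{|E|}\int_E w$ and $\overline{w}_E=\fint_E w$. For a fixed $r_\circ>0$, the 2-sharp maximal function of a function $w$ that is square integrable on $B_{r_\circ}(x)$ is $$\mathcal{M}_2^{\#}w(x)=\sup_{r\in(0,r_\circ)}\fint_{B_r(x)}\left|w-\overline{w}_{B_r(x)}\right|^2,$$ and for a Hessian matrix, $\mathcal{M}_2^{\#}D^2u(x)=\sup_{r\in(0,r_\circ)}\fint_{B_r(x)}\big|D^2u-\overline{D^2u}_{B_r(x)}\big|^2$, where averages of matrices are taken entrywise and $|\cdot|$ is the Euclidean (Frobenius) norm. $C^\infty(B_1)$ means smooth in the open ball $B_1$; the $L^2(B_1)$ norms may be $+\infty$, in which case the inequality is trivial. *)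

(* Defs.v *)
From HB Require Import structures.
From mathcomp Require Import all_boot all_order all_algebra.
From mathcomp Require Import all_classical all_reals all_analysis.
Import Order.TTheory GRing.Theory Num.Theory.
Import numFieldNormedType.Exports.

Set Implicit Arguments.
Unset Strict Implicit.
Unset Printing Implicit Defensive.

Local Open Scope classical_set_scope.
Local Open Scope ring_scope.

(** * Lebesgue measure on R^n *)

Definition measure_rV_display : measure_display.
Proof. exact. Qed.

(* The sigma-algebra on R^n is the product one, generated by the coordinates,
   as for n.-tuple; it is the Borel sigma-algebra. *)
Section measurable_rV.
Variables (R : realType) (n : nat).

Definition rV_coord (i : 'I_n) (x : 'rV[R]_n) : measurableTypeR R := x 0 i.

Let rV_set0 : g_sigma_preimage rV_coord set0.
Proof. exact: sigma_algebra0. Qed.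

Let rV_setC A : g_sigma_preimage rV_coord A -> g_sigma_preimage rV_coord (~` A).
Proof. exact: sigma_algebraC. Qed.

Let rV_bigcup (F : (set 'rV[R]_n)^nat) :
  (forall i, g_sigma_preimage rV_coord (F i)) ->
  g_sigma_preimage rV_coord (\bigcup_i (F i)).
Proof. exact: sigma_algebra_bigcup. Qed.

HB.instance Definition _ := @isMeasurable.Build measure_rV_display
  'rV[R]_n (g_sigma_preimage rV_coord) rV_set0 rV_setC rV_bigcup.

Lemma measurable_rV_coord (i : 'I_n) : measurable_fun setT (rV_coord i).
Proof.
move=> _ Y mY; rewrite setTI; apply: sub_sigma_algebra => /=.
rewrite -bigcup_seq/=; exists i => /=; first by rewrite mem_index_enum.
by exists Y => //; rewrite setTI.
Qed.

Lemma measurable_fun_rVP d (T : measurableType d) (f : T -> 'rV[R]_n) :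
  (forall i, measurable_fun setT (rV_coord i \o f)) -> measurable_fun setT f.
Proof.
move=> mf _ A mA; rewrite setTI; move: A mA.
suff : @measurable _ 'rV[R]_n `<=` [set A | measurable (f @^-1` A)] by [].
apply: smallest_sub.
  split => [|A mA|F mF] /=.
  - by rewrite preimage_set0.
  - by rewrite setTD preimage_setC; exact: measurableC.
  - by rewrite preimage_bigcup; exact: bigcupT_measurable.
rewrite -bigcup_seq => A [i _ [B mB <-]] /=.
by rewrite setTI; have := mf i measurableT B mB; rewrite setTI.
Qed.

End measurable_rV.

Section lebesgue_rV_step.
Variables (R : realType) (n : nat).
Variable mu : {sigma_finite_measure set 'rV[R]_n -> \bar R}.

Definition rV_cons (p : measurableTypeR R * 'rV[R]_n) : 'rV[R]_n.+1 :=
  row_mx (p.1 : R)%:M p.2.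

Definition rV_uncons (x : 'rV[R]_n.+1) : measurableTypeR R * 'rV[R]_n :=
  (lsubmx (x : 'rV[R]_(1 + n)) 0 0, rsubmx (x : 'rV[R]_(1 + n))).

Lemma rV_consK : cancel rV_cons rV_uncons.
Proof.
by case=> a v; rewrite /rV_cons /rV_uncons row_mxKl row_mxKr mxE eqxx mulr1n.
Qed.

Lemma rV_unconsK : cancel rV_uncons rV_cons.
Proof.
by move=> x; rewrite /rV_cons /rV_uncons /= -mx11_scalar hsubmxK.
Qed.

Lemma rV_cons0 p : rV_cons p 0 ord0 = p.1.
Proof.
rewrite (_ : ord0 = lshift n (0 : 'I_1)); last exact: val_inj.
by apply: etrans (row_mxEl _ _ _ _) _; rewrite mxE eqxx mulr1n.
Qed.

Lemma rV_consS p i : rV_cons p 0 (lift ord0 i) = p.2 0 i.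
Proof.
rewrite (_ : lift ord0 i = rshift 1 i); last exact: val_inj.
exact: row_mxEr.
Qed.

Lemma measurable_rV_cons : measurable_fun setT rV_cons.
Proof.
apply: measurable_fun_rVP => i; case: (unliftP ord0 i) => [j|] ->.
- rewrite (_ : _ \o _ = rV_coord j \o snd).
    by apply: measurableT_comp; [exact: measurable_rV_coord|].
  by apply/funext => p; exact: rV_consS.
- rewrite (_ : _ \o _ = fst); first exact: measurable_fst.
  by apply/funext => p; exact: rV_cons0.
Qed.

Lemma measurable_rV_uncons : measurable_fun setT rV_uncons.
Proof.
apply: measurable_fun_pair.
- rewrite (_ : (fun _ => _) = rV_coord ord0); first exact: measurable_rV_coord.
  by apply/funext => x; rewrite /rV_coord mxE; congr (x _ _); apply/val_inj.
- apply: measurable_fun_rVP => i.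
  rewrite (_ : _ \o _ = rV_coord (lift ord0 i)).
    exact: measurable_rV_coord.
  by apply/funext => x; rewrite /rV_coord /= mxE; congr (x _ _); apply/val_inj.
Qed.

Definition lebesgue_rV_step : set 'rV[R]_n.+1 -> \bar R :=
  pushforward (lebesgue_measure \x mu)%E rV_cons.

Let step0 : lebesgue_rV_step set0 = 0%E.
Proof. by rewrite /lebesgue_rV_step /pushforward preimage_set0 measure0. Qed.

Let step_ge0 A : (0 <= lebesgue_rV_step A)%E.
Proof. by rewrite /lebesgue_rV_step /pushforward measure_ge0. Qed.

Let step_sigma_additive : semi_sigma_additive lebesgue_rV_step.
Proof.
move=> F mF tF mUF; rewrite /lebesgue_rV_step /pushforward preimage_bigcup.
have mpre A : measurable A -> measurable (rV_cons @^-1` A).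
  by move=> mA; rewrite -[X in measurable X]setTI; exact: measurable_rV_cons.
apply: measure_semi_sigma_additive.
- by move=> k; exact: mpre.
- apply/trivIsetP => /= i j _ _ ij; rewrite -preimage_setI.
  by move/trivIsetP : tF => /(_ _ _ _ _ ij) ->//; rewrite preimage_set0.
- by rewrite -preimage_bigcup; exact: mpre.
Qed.

HB.instance Definition _ := isMeasure.Build _ _ _ lebesgue_rV_step
  step0 step_ge0 step_sigma_additive.

Let step_sigma_finite : sigma_finite setT lebesgue_rV_step.
Proof.
have /sigma_finiteP[F [TF ndF Foo]] := sigma_finiteT (@lebesgue_measure R).
have /sigma_finiteP[G [TG ndG Goo]] := sigma_finiteT mu.
exists (fun k => rV_uncons @^-1` (F k `*` G k)).
  apply/seteqP; split => // x _.
  have [k _ Fk] : (\bigcup_i F i) (rV_uncons x).1 by rewrite -TF.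
  have [l _ Gl] : (\bigcup_i G i) (rV_uncons x).2 by rewrite -TG.
  exists (maxn k l) => //; split.
    by move: Fk; exact/subsetPset/ndF/leq_maxl.
  by move: Gl; exact/subsetPset/ndG/leq_maxr.
move=> k; have [mF Fk] := Foo k; have [mG Gk] := Goo k; split.
  rewrite -[X in measurable X]setTI; apply: measurable_rV_uncons => //.
  exact: measurableX.
rewrite /lebesgue_rV_step /pushforward -comp_preimage.
rewrite (_ : _ \o _ = id) ?preimage_id; last first.
  by apply/funext => p /=; rewrite rV_consK.
by rewrite product_measure1E// lte_mul_pinfty// ge0_fin_numE.
Qed.

HB.instance Definition _ := Measure_isSigmaFinite.Build _ _ _ lebesgue_rV_step
  step_sigma_finite.

End lebesgue_rV_step.

(* n-dimensional Lebesgue measure: the Dirac mass on the one-point space R^0,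
   then the product with one-dimensional Lebesgue measure along
   R * R^n = R^(n+1). *)
Fixpoint lebesgue_rV (R : realType) (n : nat) :
    {sigma_finite_measure set 'rV[R]_n -> \bar R} :=
  match n with
  | 0 => dirac (0 : 'rV[R]_0)
  | m.+1 => lebesgue_rV_step (lebesgue_rV R m)
  end.

Lemma measurable_rV_box (R : realType) (n : nat)
    (A : 'I_n -> set (measurableTypeR R)) :
  (forall i, measurable (A i)) ->
  measurable [set x : 'rV[R]_n | forall i, A i (x 0 i)].
Proof.
move=> mA; rewrite (_ : mkset _ = \bigcap_(i in setT) (rV_coord i @^-1` A i)).
  apply: fin_bigcap_measurable; first exact: finite_finset.
  move=> i _; rewrite -[X in measurable X]setTI.
  exact: (@measurable_rV_coord R n i).
by apply/seteqP; split => [x xA i _|x xA i]; [exact: xA|exact: (xA i)].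
Qed.

(* Together with sigma-finiteness, this determines the measure. *)
Lemma lebesgue_rV_box (R : realType) (n : nat)
    (A : 'I_n -> set (measurableTypeR R)) :
  (forall i, measurable (A i)) ->
  lebesgue_rV R n [set x | forall i, A i (x 0 i)] =
  (\prod_(i < n) lebesgue_measure (A i))%E.
Proof.
elim: n A => [|n ih] A mA.
  rewrite big_ord0 /= diracE mem_set//; by case.
rewrite big_ord_recl -(ih (A \o lift ord0)) => [|i]; last exact: mA.
rewrite -product_measure1E //=; last first.
  by apply: (measurable_rV_box (A := A \o lift ord0)) => i; exact: mA.
rewrite /lebesgue_rV_step /pushforward.
congr (product_measure1 _ _ _); apply/seteqP; split => p /=.
  by move=> pA; split => [|i]; rewrite -?rV_cons0 -?rV_consS; exact: pA.
move=> [pA0 pA] i; case: (unliftP ord0 i) => [j|] ->.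
  by rewrite rV_consS; exact: pA.
by rewrite rV_cons0.
Qed.

(** * Balls, partial derivatives, smooth functions *)

Section calculus.
Variables (R : realType) (n : nat).
Implicit Types (u : 'rV[R]_n -> R) (U : set 'rV[R]_n).

(* The library norm on matrices is the sup norm. *)
Definition frobenius_norm p q (A : 'M[R]_(p, q)) : R :=
  Num.sqrt (\sum_(i < p) \sum_(j < q) A i j ^+ 2).

Definition eball (x : 'rV[R]_n) (r : R) : set 'rV[R]_n :=
  [set y | frobenius_norm (y - x) < r].

Definition partial (i : 'I_n) u : 'rV[R]_n -> R := 'D_(delta_mx 0 i) u.

Fixpoint iter_partial (s : seq 'I_n) u : 'rV[R]_n -> R :=
  if s is i :: s' then partial i (iter_partial s' u) else u.

(* C^infty on an open set U: all iterated partial derivatives exist and are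
   continuous on U; values outside U are irrelevant. *)
Definition smooth_on U u : Prop :=
  forall (s : seq 'I_n) (x : 'rV[R]_n), U x ->
    {for x, continuous (iter_partial s u)} /\
    forall i : 'I_n, derivable (iter_partial s u) x (delta_mx 0 i).

Definition laplacian u (x : 'rV[R]_n) : R :=
  \sum_(i < n) partial i (partial i u) x.

Definition hessian u (x : 'rV[R]_n) : 'M[R]_n :=
  \matrix_(i, j) partial j (partial i u) x.

End calculus.

(** * Averages, L^2 norms, sharp maximal functions *)

Section maximal_function.
Variables (R : realType) (n : nat).
Implicit Types E : set 'rV[R]_n.

Definition eaverage E (g : 'rV[R]_n -> \bar R) : \bar R :=
  ((lebesgue_rV R n E)^-1 * \int[lebesgue_rV R n]_(y in E) g y)%E.

Definition average E (w : 'rV[R]_n -> R) : R := fine (eaverage E (EFin \o w)).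

Definition average_mx p q E (W : 'rV[R]_n -> 'M[R]_(p, q)) : 'M[R]_(p, q) :=
  \matrix_(i, j) average E (fun y => W y i j).

Definition L2norm E (w : 'rV[R]_n -> R) : \bar R :=
  'N[lebesgue_rV R n]_(2%:E)[EFin \o (w \_ E)].

Definition sharp_maximal (r0 : R) (w : 'rV[R]_n -> R) (x : 'rV[R]_n) : \bar R :=
  ereal_sup [set eaverage (eball x r)
    (fun y => (`|w y - average (eball x r) w| ^+ 2)%:E) | r in `]0, r0[].

Definition sharp_maximal_mx p q (r0 : R) (W : 'rV[R]_n -> 'M[R]_(p, q))
    (x : 'rV[R]_n) : \bar R :=
  ereal_sup [set eaverage (eball x r)
    (fun y => (frobenius_norm (W y - average_mx (eball x r) W) ^+ 2)%:E)
    | r in `]0, r0[].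

End maximal_function.

(* Main.v *)
Require Import Defs.
From mathcomp Require Import all_boot all_order all_algebra.
From mathcomp Require Import all_classical all_reals all_analysis.
From mathcomp Require Import measurable_realfun ring lra.
Import Order.TTheory GRing.Theory Num.Theory.
Import numFieldNormedType.Exports.
Set Implicit Arguments.
Unset Strict Implicit.
Unset Printing Implicit Defensive.
Local Open Scope classical_set_scope.
Local Open Scope ring_scope.

(* Campanato iteration without harmonic replacement.  Put q(z) = (1 - |z|^2)_+
   and, for Delta v = g on B_2, m(t, y) = int q(z)^3 v(y + t z) dz.  Integrating
   by parts in z, d/dt m(t, y) = (t / 8) int q(z)^4 g(y + t z) dz, so m(1, .) is
   L^2-close to m(0, .) = (int q^3) v up to ||g||.  As a convolution with the
   C^2 kernel q^3, m(1, .) is a quadratic polynomial on B_r up to O(r^3) ||v||;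
   correcting its Laplacian, v is within ||g|| + r^(n/2+3) ||v|| of a harmonic
   quadratic polynomial in L^2(B_r).  Applied to u rescaled at x at the scales
   theta^k / 16, minus a quadratic polynomial whose Laplacian is the average of
   f, this keeps the L^2 norms bounded along the iteration, g being controlled
   by the sharp maximal function of f.  A Caccioppoli estimate then bounds the
   oscillation of D^2 u at each scale; radii at least 1/24 need no iteration. *)

(** The classical route compares u with the harmonic solution of a Dirichlet problem and then needs
    interior estimates for it. Here the comparison function is an explicit average of v, so its
    Taylor expansion is a computation on the kernel. The exponent 3 is the least for which s_+^k has
    a Lipschitz second derivative, hence an O(r^3) error. Squared and integrated over B_r this is
    r^(n+6), while passing to scale theta costs theta^-(n+4); the surplus theta^2 pays for the
    constant, and a small theta makes the step a contraction. No decay of the oscillation of f is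
    assumed, so the Hessians of the successive polynomials may drift. They are not followed: each
    scale only remembers that some constant matrix H was subtracted, which the oscillation of D^2 u
    does not see. The first scale is 1/16: B_2 becomes a ball of radius 1/8, inside B_1 when |x| <
    3/4, and B_(3/2) one of radius 3/32, which the supremum over radii below 1/8 sees. Caccioppoli
    ends on B_(2/3), hence the threshold 1/24. *)

Lemma continuous_at_sum (T : topologicalType) (R : realType) (I : Type) (r : seq I)
    (f : I -> T -> R) (x : T) :
  (forall i, {for x, continuous (f i)}) ->
  {for x, continuous (fun y => \sum_(i <- r) f i y)}.
Proof.
move=> cf; elim: r => [|i r ih].
  rewrite (_ : (fun y => _) = cst 0); first exact: cst_continuous.
  by apply/funext => y; rewrite big_nil.
rewrite (_ : (fun y => _) = (f i \+ (fun y => \sum_(i <- r) f i y))).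
  exact: continuousD.
by apply/funext => y; rewrite big_cons.
Qed.

(** * Euclidean inner product, norm and balls *)

Section euclidean.
Variables (R : realType) (n : nat).
Implicit Types x y z : 'rV[R]_n.

Definition dot x y : R := \sum_(i < n) x 0 i * y 0 i.
Definition enorm x : R := frobenius_norm x.

Lemma enorm_ge0 x : 0 <= enorm x.
Proof. exact: sqrtr_ge0. Qed.

Lemma dotxx_ge0 x : 0 <= dot x x.
Proof. by apply: sumr_ge0 => i _; rewrite -expr2 sqr_ge0. Qed.

Lemma sqr_enorm x : enorm x ^+ 2 = dot x x.
Proof.
rewrite /enorm /frobenius_norm big_ord1 sqr_sqrtr.
  by apply: eq_bigr => i _; rewrite expr2.
by apply: sumr_ge0 => i _; rewrite sqr_ge0.
Qed.

Lemma dotC x y : dot x y = dot y x.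
Proof. by apply: eq_bigr => i _; rewrite mulrC. Qed.

Lemma dotDl x y z : dot (x + y) z = dot x z + dot y z.
Proof. by rewrite -big_split; apply: eq_bigr => i _; rewrite mxE mulrDl. Qed.

Lemma dotZl (a : R) x y : dot (a *: x) y = a * dot x y.
Proof. by rewrite mulr_sumr; apply: eq_bigr => i _; rewrite mxE mulrA. Qed.

Lemma dotDr x y z : dot z (x + y) = dot z x + dot z y.
Proof. by rewrite dotC dotDl !(dotC z). Qed.

Lemma dotZr (a : R) x y : dot x (a *: y) = a * dot x y.
Proof. by rewrite dotC dotZl dotC. Qed.

(** Cauchy-Schwarz, from expanding the squared norm of |x|^2 y - (x.y) x and dividing by |x|^2. *)
Lemma dot_le x y : `|dot x y| <= enorm x * enorm y.
Proof.
have [x0|x0] := eqVneq (enorm x) 0.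
  rewrite x0 mul0r normr_le0; apply/eqP.
  have : dot x x = 0 by rewrite -sqr_enorm x0 expr0n.
  move/eqP; rewrite psumr_eq0 => [/allP xx|i _]; last by rewrite -expr2 sqr_ge0.
  apply: big1 => i _; have := xx i (mem_index_enum _).
  by rewrite mulf_eq0 orbb => /eqP ->; rewrite mul0r.
have xp : 0 < enorm x by rewrite lt_def x0 enorm_ge0.
rewrite -ler_sqr ?nnegrE ?mulr_ge0 ?enorm_ge0// real_normK ?num_real//.
have := dotxx_ge0 ((enorm x ^+ 2) *: y + (- dot x y) *: x).
rewrite !(dotDl, dotDr, dotZl, dotZr) (dotC y x) -!sqr_enorm.
have xp2 : 0 < enorm x ^+ 2 by rewrite exprn_gt0.
by move=> h; rewrite -(ler_pM2l xp2); nra.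
Qed.

Lemma enormD x y : enorm (x + y) <= enorm x + enorm y.
Proof.
rewrite -ler_sqr ?nnegrE ?addr_ge0 ?enorm_ge0//.
rewrite sqr_enorm !(dotDl, dotDr) (dotC y x) -!sqr_enorm.
have := dot_le x y; rewrite ler_norml => /andP[_].
by rewrite sqrrD; lra.
Qed.

Lemma enormZ (a : R) x : enorm (a *: x) = `|a| * enorm x.
Proof.
apply/eqP; rewrite -(@eqrXn2 _ 2) ?mulr_ge0 ?enorm_ge0//.
by rewrite sqr_enorm dotZl dotZr exprMn sqr_enorm real_normK ?num_real// expr2 mulrA.
Qed.

Lemma enormN x : enorm (- x) = enorm x.
Proof. by rewrite -scaleN1r enormZ normrN1 mul1r. Qed.

Lemma coord_le_enorm x i : `|x 0 i| <= enorm x.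
Proof.
rewrite -ler_sqr ?nnegrE ?enorm_ge0// sqr_enorm real_normK ?num_real//.
rewrite /dot (bigD1 i)//= -expr2 lerDl; apply: sumr_ge0 => j _.
by rewrite -expr2 sqr_ge0.
Qed.

Lemma continuous_enorm : continuous enorm.
Proof.
move=> x; rewrite /enorm /frobenius_norm.
apply: (@continuous_comp _ _ _ (fun x : 'rV[R]_n => \sum_(i < 1) \sum_(j < n) x i j ^+ 2) Num.sqrt);
  last exact: sqrt_continuous.
apply: continuous_at_sum => i; apply: continuous_at_sum => j.
apply: (@continuous_comp _ _ _ (fun x : 'rV[R]_n => x i j) (fun t => t ^+ 2));
  [exact: coord_continuous|exact: exprn_continuous].
Qed.

Definition cball x (r : R) : set 'rV[R]_n := [set y | enorm (y - x) <= r].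

Lemma eballE x (r : R) : eball x r = [set y | enorm (y - x) < r].
Proof. by []. Qed.

Lemma open_eball x (r : R) : open (eball x r).
Proof.
rewrite (_ : eball x r = (fun y => enorm (y - x)) @^-1` [set s | s < r]) //.
apply: open_comp; last exact: open_lt.
move=> y _; apply: continuous_comp; last exact: continuous_enorm.
by apply: continuousD; [exact: cvg_id|exact: cst_continuous].
Qed.

(** Boundedness refers to the sup norm on matrices, which the Euclidean norm dominates
    coordinatewise. *)
Lemma compact_cball x (r : R) : compact (cball x r).
Proof.
apply: bounded_closed_compact.
  exists (r + enorm x); split; first exact: num_real.
  move=> s rs y yr; rewrite /= [`|y|]mx_normrE.
  apply/bigmax_leP; split => [|[i j] _ /=].
    apply: le_trans (ltW rs); rewrite addr_ge0 ?enorm_ge0//.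
    exact: le_trans (enorm_ge0 _) yr.
  rewrite ord1; apply: le_trans (coord_le_enorm y j) _.
  have := enormD (y - x) x; rewrite subrK => /le_trans; apply.
  by apply: le_trans (ltW rs); rewrite lerD2r.
rewrite (_ : cball x r = (fun y => enorm (y - x)) @^-1` [set s | s <= r]) //.
apply: closed_comp; last exact: closed_le.
move=> y _; apply: continuous_comp; last exact: continuous_enorm.
by apply: continuousD; [exact: cvg_id|exact: cst_continuous].
Qed.

End euclidean.

(** * Borel sets and continuous functions on R^n *)

Section measurable_rV.
Variables (R : realType) (n : nat).

Let qbox (p : 'rV[rat]_n * nat) : set 'rV[R]_n :=
  [set x | forall i, `|x 0 i - ratr (p.1 0 i)| < p.2.+1%:R^-1].

(** The sigma-algebra is generated by coordinates, so an open set is exhibited as a countable union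
    of boxes with rational centre and half-side 1/(k+1). *)
Lemma measurable_rV_open (A : set 'rV[R]_n) : open A -> measurable A.
Proof.
move=> oA.
have -> : A = \bigcup_(p in [set p | qbox p `<=` A]) qbox p.
  apply/seteqP; split => [x Ax|x [p /= pA xp]]; last exact: pA.
  have /nbhs_ballP[e /= e0 eA] : nbhs x A by exact: open_nbhs_nbhs.
  have [k ke] : exists k : nat, k.+1%:R^-1 < e / 2.
    exists (Num.trunc (e / 2)^-1).
    rewrite invf_plt ?posrE ?divr_gt0//.
    exact: truncnS_gt.
  have /choice[q xq] : forall i, exists q : rat, `|x 0 i - ratr q| < k.+1%:R^-1.
    move=> i; have k0 : 0 < k.+1%:R^-1 :> R by rewrite invr_gt0.
    have [q] := @rat_in_itvoo R (x 0 i - k.+1%:R^-1) (x 0 i + k.+1%:R^-1) ltac:(by rewrite ltrD2l gt0_cp).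
    rewrite in_itv/= => /andP[q1 q2]; exists q.
    by rewrite distrC ltr_distl q1.
  exists (\row_i q i, k) => [y /= yq|i /=]; last by rewrite mxE.
  apply: eA; split => // i j; rewrite ord1.
  have := yq j; have := xq j; rewrite mxE /ball/=.
  move: ke; set d := _^-1; rewrite !ltr_norml => ke /andP[? ?] /andP[? ?].
  by apply/andP; split; lra.
rewrite bigcup_mkcond; apply: countable_bigcupT_measurable => // p.
case: ifP => // _; pose I i : set (measurableTypeR R) :=
  `](ratr (p.1 0 i) - p.2.+1%:R^-1), (ratr (p.1 0 i) + p.2.+1%:R^-1)[%classic.
rewrite (_ : qbox p = [set x | forall i, I i (x 0 i)]).
  by apply: measurable_rV_box => i; exact: measurable_itv.
by apply/seteqP; split => x /= xp i; have := xp i;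
  rewrite /I /= in_itv/= -ltr_distl.
Qed.

Lemma measurable_rV_continuous (U : set 'rV[R]_n) (f : 'rV[R]_n -> R) :
  open U -> {in U, continuous f} -> measurable_fun U f.
Proof.
move=> oU cf; apply: (measurability _ (RGenOInfty.measurableE R)).
move=> _ [_ [a ->] <-]; apply: measurable_rV_open.
by move/(continuous_inP _ oU) : cf; apply; exact: interval_open.
Qed.
End measurable_rV.

(** * Lebesgue measure under z -> x + s z, and volumes of balls *)

Section affine_change_of_variables.
Variable R : realType.

(** By uniqueness of Lebesgue measure: s times the pushforward along t -> a + s t gives every
    half-open interval its length. *)
Lemma lebesgue_measure_affine (a s : R) (A : set (measurableTypeR R)) : 0 < s ->
  measurable A ->
  lebesgue_measure A =
  (s%:E * lebesgue_measure ((fun t : R => (a + s * t)%R : measurableTypeR R) @^-1` A))%E.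
Proof.
move=> s0 mA.
pose phi := (fun t : measurableTypeR R => (a + s * t)%R : measurableTypeR R).
have mphi : measurable_fun setT phi.
  apply: continuous_measurable_fun => t; apply: continuousD; first exact: cst_continuous.
  by apply: continuousM; [exact: cst_continuous|exact: cvg_id].
pose nu := measure_function_pushforward__canonical__measure_function_Measure
  (@lebesgue_measure R) mphi.
rewrite (@lebesgue_measure_unique R (mscale (NngNum (ltW s0)) nu))//.
move=> _ [[b c] _ <-].
transitivity (s%:E * lebesgue_measure (phi @^-1` `]b, c]))%E; last by [].
rewrite (_ : phi @^-1` _ = `](b - a) / s, (c - a) / s]%classic).
  rewrite !lebesgue_measure_itv/= !lte_fin ltr_pM2r ?invr_gt0// ltrD2r.
  case: ifP => _; last by rewrite mule0.
  by rewrite -!EFinB -EFinM; congr EFin; field; rewrite gt_eqF.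
apply/seteqP; split => t /=; rewrite !in_itv/= /phi => /andP[h1 h2];
  apply/andP; split; move: h1 h2;
  by rewrite ?ltr_pdivrMr ?ler_pdivlMr// => h1 h2; lra.
Qed.

Definition affine n (x : 'rV[R]_n) (s : R) (z : 'rV[R]_n) : 'rV[R]_n := x + s *: z.

Lemma affineE n (x : 'rV[R]_n) s z i : affine x s z 0 i = x 0 i + s * z 0 i.
Proof. by rewrite !mxE. Qed.

Lemma measurable_affine n (x : 'rV[R]_n) s : measurable_fun setT (affine x s).
Proof.
apply: measurable_fun_rVP => i.
rewrite (_ : _ \o _ = (fun z => (x 0 i + s * rV_coord i z)%R)).
  apply: measurable_funD => //; apply: measurable_funM => //.
  exact: measurable_rV_coord.
by apply/funext => z; rewrite /rV_coord/= affineE.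
Qed.

(** Induction on the dimension. The slice at a of the preimage is the affine preimage of the slice
    at x_0 + s a; the induction hypothesis gives s^n on slices and the one-dimensional change of
    variables the last factor s. *)
Lemma lebesgue_rV_affine n (x : 'rV[R]_n) (s : R) (A : set 'rV[R]_n) :
  0 < s -> measurable A ->
  lebesgue_rV R n A = ((s ^+ n)%:E * lebesgue_rV R n (affine x s @^-1` A))%E.
Proof.
move=> s0; elim: n x A => [|n ih] x A mA.
  rewrite expr0 mul1e /= !diracE /=; congr (nat_of_bool _)%:R%:E.
  by apply/idP/idP; rewrite !inE /= (_ : affine _ _ _ = 0)//; apply/rowP; case.
have mpre (B : set 'rV[R]_n.+1) : measurable B -> measurable (@rV_cons R n @^-1` B).
  by move=> mB; rewrite -[X in measurable X]setTI; exact: measurable_rV_cons.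
have maff m (y : 'rV[R]_m) B : measurable B -> measurable (affine y s @^-1` B).
  by move=> mB; rewrite -[X in measurable X]setTI; exact: measurable_affine.
rewrite /= /lebesgue_rV_step /pushforward /product_measure1.
pose h a := lebesgue_rV R n (xsection (@rV_cons R n @^-1` A) a).
pose x' : 'rV[R]_n := \row_i x 0 (lift ord0 i).
rewrite [LHS](_ : _ = \int[lebesgue_measure]_a h a)%E//.
rewrite [X in (_ * X)%E](_ : _ =
    \int[lebesgue_measure]_a ((s ^- n)%:E * h (x 0 ord0 + s * a)%R))%E; last first.
  apply: eq_integral => a _ /=.
  rewrite /h [in RHS](ih x')//; last by apply: measurable_xsection; exact: mpre.
  rewrite muleA -EFinM mulVf ?mul1e ?gt_eqF ?exprn_gt0//.
  congr (lebesgue_rV R n _); apply/seteqP.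
  have E (v : 'rV[R]_n) : affine x s (rV_cons (a, v)) = rV_cons (x 0 ord0 + s * a, affine x' s v).
    apply/rowP => i; case: (unliftP ord0 i) => [j|] ->.
      by rewrite affineE !rV_consS/= affineE mxE.
    by rewrite affineE !rV_cons0.
  by split => v; rewrite /xsection /= !inE /= E.
have mh : measurable_fun setT h by apply: measurable_fun_xsection; exact: mpre.
pose phi := (fun t : measurableTypeR R => (x 0 ord0 + s * t)%R : measurableTypeR R).
have mphi : measurable_fun setT phi.
  apply: continuous_measurable_fun => t; apply: continuousD; first exact: cst_continuous.
  by apply: continuousM; [exact: cst_continuous|exact: cvg_id].
rewrite ge0_integralZl//; last 2 first.
- exact: (measurableT_comp mh mphi).
- by rewrite lee_fin invr_ge0 exprn_ge0// ltW.
rewrite muleA -EFinM exprS mulfK ?gt_eqF ?exprn_gt0//.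
pose nu := measure_function_pushforward__canonical__measure_function_Measure
  (@lebesgue_measure R) mphi.
transitivity (\int[mscale (NngNum (ltW s0)) nu]_a h a)%E.
  apply: eq_measure_integral => B mB _.
  exact: lebesgue_measure_affine.
rewrite ge0_integral_mscale//=.
by rewrite ge0_integral_pushforward.
Qed.

Lemma measurable_preimage_affine n (x : 'rV[R]_n) s (A : set 'rV[R]_n) :
  measurable A -> measurable (affine x s @^-1` A).
Proof. by move=> mA; rewrite -[X in measurable X]setTI; exact: measurable_affine. Qed.


Lemma ge0_integral_affine n (x : 'rV[R]_n) (s : R) (D : set 'rV[R]_n)
    (f : 'rV[R]_n -> \bar R) :
  0 < s -> measurable D -> measurable_fun D f -> (forall y, D y -> (0 <= f y)%E) ->
  (\int[lebesgue_rV R n]_(y in D) f y =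
   (s ^+ n)%:E * \int[lebesgue_rV R n]_(z in affine x s @^-1` D) f (affine x s z))%E.
Proof.
move=> s0 mD mf f0.
pose nu := measure_function_pushforward__canonical__measure_function_Measure
  (lebesgue_rV R n) (measurable_affine x s).
have sn0 : 0 <= s ^+ n by rewrite exprn_ge0// ltW.
transitivity (\int[mscale (NngNum sn0) nu]_(y in D) f y)%E.
  by apply: eq_measure_integral => B mB _; exact: lebesgue_rV_affine.
rewrite ge0_integral_mscale//= ge0_integral_pushforward//.
  exact: measurable_affine.
by move=> y /[!inE]; exact: f0.
Qed.

Lemma affine_eball n (x y : 'rV[R]_n) (s r : R) : 0 < s ->
  affine x s @^-1` (eball (affine x s y) (s * r)) = eball y r.
Proof.
move=> s0; apply/seteqP; split => z; rewrite /= !eballE /=;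
  rewrite (_ : affine x s z - affine x s y = s *: (z - y)) ?enormZ ?gtr0_norm ?ltr_pM2l//;
  by rewrite /affine scalerBr opprD addrACA subrr add0r.
Qed.

Lemma measurable_eball n (x : 'rV[R]_n) (r : R) : measurable (eball x r).
Proof. by apply: measurable_rV_open; exact: open_eball. Qed.

Lemma lebesgue_eball_lty n (x : 'rV[R]_n) (r : R) :
  (lebesgue_rV R n (eball x r) < +oo)%E.
Proof.
pose I (i : 'I_n) : set (measurableTypeR R) := `](x 0 i - r), (x 0 i + r)[%classic.
apply: (@le_lt_trans _ _ (lebesgue_rV R n [set y | forall i, I i (y 0 i)])).
  apply: le_measure; rewrite ?inE; first exact: measurable_eball.
    by apply: measurable_rV_box => i; exact: measurable_itv.
  move=> y yr i; rewrite /I /= in_itv/= -ltr_distl.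
  apply: le_lt_trans yr; have := coord_le_enorm (y - x) i.
  by rewrite !mxE.
rewrite lebesgue_rV_box; last by move=> i; exact: measurable_itv.
suff /andP[] : (0 <= \prod_(i < n) lebesgue_measure (I i) < +oo)%E by [].
elim/big_ind : _ => [|a b /andP[a0 ha] /andP[b0 hb]|i _]; first by rewrite lee_fin ler01 ltry.
  by rewrite mule_ge0//= lte_mul_pinfty// ge0_fin_numE.
rewrite measure_ge0/= /I lebesgue_measure_itv/=.
by case: ifP => // _; rewrite -EFinB ltry.
Qed.

Lemma lebesgue_eball_gt0 n (x : 'rV[R]_n) (r : R) : 0 < r ->
  (0 < lebesgue_rV R n (eball x r))%E.
Proof.
(* The cube of half-side d lies in the ball because n d^2 = r^2 n / (n+1)^2 < r^2; n+1 rather than n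
   keeps d meaningful and the inequality strict. *)
move=> r0; set d := r / n.+1%:R.
have d0 : 0 < d by rewrite divr_gt0.
pose I (i : 'I_n) : set (measurableTypeR R) := `](x 0 i - d), (x 0 i + d)[%classic.
apply: (@lt_le_trans _ _ (lebesgue_rV R n [set y | forall i, I i (y 0 i)])).
  rewrite lebesgue_rV_box; last by move=> i; exact: measurable_itv.
  elim/big_ind : _ => [|a b|i _]; [by rewrite lte_fin|exact: mule_gt0|].
  rewrite /I lebesgue_measure_itv/= ifT -?EFinB ?lte_fin; last by lra.
  by rewrite opprB addrACA addrC addrA addrNK; lra.
apply: le_measure; rewrite ?inE; last 2 first.
- exact: measurable_eball.
- move=> y yI; rewrite eballE /=.
  rewrite -ltr_sqr ?nnegrE ?enorm_ge0 ?ltW// sqr_enorm.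
  apply: (@le_lt_trans _ _ (\sum_(i < n) d ^+ 2)).
    apply: ler_sum => i _; rewrite -expr2 -real_normK ?num_real//.
    rewrite ler_sqr ?nnegrE ?(ltW d0)// !mxE; apply: ltW.
    by have := yI i; rewrite /I /= in_itv/= -ltr_distl.
  rewrite sumr_const card_ord -mulr_natr /d expr_div_n -mulrA gtr_pMr ?exprn_gt0//.
  rewrite mulrC ltr_pdivrMr ?exprn_gt0// mul1r -natrX ltr_nat expnS expn1.
  by rewrite mulnS leq_addr.
by apply: measurable_rV_box => i; exact: measurable_itv.
Qed.

Lemma fine_eball_gt0 n (x : 'rV[R]_n) (r : R) : 0 < r ->
  0 < fine (lebesgue_rV R n (eball x r)).
Proof. by move=> r0; rewrite fine_gt0// lebesgue_eball_gt0// lebesgue_eball_lty. Qed.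

Lemma EFin_eball n (x : 'rV[R]_n) (r : R) :
  (fine (lebesgue_rV R n (eball x r)))%:E = lebesgue_rV R n (eball x r).
Proof. by rewrite fineK// ge0_fin_numE// lebesgue_eball_lty. Qed.

End affine_change_of_variables.

(** * Functions of class C^k through coordinate partial derivatives *)

Section calculus.
Variables (R : realType) (n : nat).
Implicit Types (u v w : 'rV[R]_n -> R) (U V : set 'rV[R]_n) (x y z a b : 'rV[R]_n).

Local Notation e i := (delta_mx 0 i : 'rV[R]_n).

Lemma enorm_delta i : enorm (e i) = 1.
Proof.
apply/eqP; rewrite -(@eqrXn2 _ 2) ?enorm_ge0 ?ler01// sqr_enorm expr1n; apply/eqP.
rewrite /dot (bigD1 i)//= big1 ?addr0 => [|j ji]; first by rewrite !mxE !eqxx mulr1.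
by rewrite !mxE eqxx (negbTE ji) mulr0.
Qed.

Lemma nbhs_eball a (A : set 'rV[R]_n) :
  nbhs a A -> exists2 d : R, 0 < d & eball a d `<=` A.
Proof.
move=> /nbhs_ballP[d /= d0 dA]; exists d => // y yd; apply: dA; split => // i j.
rewrite ord1 /ball/= distrC; apply: le_lt_trans yd.
by have := coord_le_enorm (y - a) j; rewrite !mxE.
Qed.

Lemma continuous_eball v a (ep : R) : {for a, continuous v} -> 0 < ep ->
  exists2 d : R, 0 < d & forall y, eball a d y -> `|v y - v a| < ep.
Proof.
move=> cv ep0; move/cvgrPdist_lt : cv => /(_ _ ep0) /nbhs_eball[d d0 dv].
by exists d => // y /dv; rewrite /= distrC.
Qed.

Lemma open_eball_sub U a : open U -> U a -> exists2 d : R, 0 < d & eball a d `<=` U.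
Proof. by move=> oU Ua; apply: nbhs_eball; exact: open_nbhs_nbhs. Qed.

(** The two difference quotients coincide, so directional derivatives inherit the one-variable chain
    rule and mean value theorem. *)
Lemma is_derive_line v y z (t l : R) :
  is_derive (y + t *: z) z v l <-> is_derive t 1 (fun s : R => v (y + s *: z)) l.
Proof.
have E : (fun h : R => h^-1 *: (v (h *: z + (y + t *: z)) - v (y + t *: z))) =
    (fun h : R => h^-1 *: ((fun s : R => v (y + s *: z)) (h *: (1 : R) + t) -
      (fun s : R => v (y + s *: z)) t)).
  apply/funext => h /=; congr (_ *: (v _ - _)).
  by rewrite [h *: 1]mulr1 scalerDl addrCA.
by split => -[dv dvl]; apply: DeriveDef; move: dv dvl; rewrite /derivable /derive ?E -?E.
Qed.

Lemma mean_value_coord v b i (t : R) :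
  (forall s : R, `|s| <= `|t| -> derivable v (b + s *: e i) (e i)) ->
  exists2 s : R, `|s| <= `|t| & v (b + t *: e i) - v b = t * partial i v (b + s *: e i).
Proof.
move=> dv; pose g s := v (b + s *: e i).
have dg s : `|s| <= `|t| -> is_derive s (1 : R) g (partial i v (b + s *: e i)).
  by move=> st; apply/is_derive_line/derivableP/dv.
have cg (r1 r2 : R) : (forall s, s \in `[r1, r2] -> `|s| <= `|t|) ->
    {within `[r1, r2], continuous g}.
  by move=> h; apply: derivable_within_continuous => s /h /dg[].
have g0 : g 0 = v b by rewrite /g scale0r addr0.
rewrite -[v (b + _)]/(g t) -g0.
have [t0|t0] := leP 0 t.
  have st s : s \in `[0, t] -> `|s| <= `|t|.
    by rewrite in_itv/= => /andP[s0 st]; rewrite !ger0_norm.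
  have [|s s0t ->] := @MVT_segment R g (fun s => partial i v (b + s *: e i)) 0 t t0 _ (cg _ _ st).
    by move=> s s0t; apply/dg/st; exact: subset_itv_oo_cc s0t.
  by exists s; [exact: st|rewrite subr0 mulrC].
have st s : s \in `[t, 0] -> `|s| <= `|t|.
  by rewrite in_itv/= => /andP[ts s0]; rewrite !ler0_norm ?(ltW t0)// lerN2.
have [|s s0t] := @MVT_segment R g (fun s => partial i v (b + s *: e i)) t 0 (ltW t0) _ (cg _ _ st).
  by move=> s s0t; apply/dg/st; exact: subset_itv_oo_cc s0t.
move=> /eqP; rewrite sub0r -(eqr_opp) opprB mulrN opprK => /eqP ->.
by exists s; [exact: st|rewrite mulrC].
Qed.

(** Finite order is needed because the bumps and the functions built from them are not smooth. Only
    coordinate derivatives are demanded; the other directional derivatives are recovered in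
    [Ck1_is_derive]. *)
Fixpoint Ck (k : nat) U v : Prop :=
  (forall x, U x -> {for x, continuous v}) /\
  if k is k'.+1 then
    forall i, (forall x, U x -> derivable v x (e i)) /\ Ck k' U (partial i v)
  else True.

Lemma Ck_continuous k U v x : Ck k U v -> U x -> {for x, continuous v}.
Proof. by case: k => [|k] [+ _]; exact. Qed.

Lemma Ck_derivable k U v x i : Ck k.+1 U v -> U x -> derivable v x (e i).
Proof. by move=> [_ /(_ i)[+ _]]; exact. Qed.

Lemma Ck_partial k U v i : Ck k.+1 U v -> Ck k U (partial i v).
Proof. by move=> [_ /(_ i)[]]. Qed.

Lemma CkS k U v : Ck k.+1 U v -> Ck k U v.
Proof.
elim: k v => [|k ih] v [cv dv]; split => // i.
by split; [exact: (dv i).1|exact/ih/(dv i).2].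
Qed.

Lemma Ck_le k l U v : (k <= l)%N -> Ck l U v -> Ck k U v.
Proof. by move=> /subnK <-; elim: (l - k)%N => //= m ih /CkS. Qed.

Lemma smooth_on_Ck k U v : smooth_on U v -> Ck k U v.
Proof.
move=> sv; suff : forall s, Ck k U (iter_partial s v) by move=> /(_ [::]).
elim: k => [|k ih] s; (split => [x /sv-/(_ s)[]//|]; move=> // i).
by split=> [x /sv-/(_ s)[]//|]; exact: (ih (i :: s)).
Qed.

Lemma CkW k U V v : U `<=` V -> Ck k V v -> Ck k U v.
Proof.
move=> UV; elim: k v => [|k ih] v [cv dv]; (split => [x /UV|]; [exact: cv|move=> // i]).
by split=> [x /UV|]; [exact: (dv i).1|exact/ih/(dv i).2].
Qed.

Lemma Ck_setU k U V v : Ck k U v -> Ck k V v -> Ck k (U `|` V) v.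
Proof.
elim: k v => [|k ih] v [cv dv] [cv' dv']; (split => [x [|]|]; [exact: cv|exact: cv'|move=> // i]).
by split=> [x [|]|]; [exact: (dv i).1|exact: (dv' i).1|apply: ih; [exact: (dv i).2|exact: (dv' i).2]].
Qed.

Lemma open_near U x v w : open U -> U x -> (forall y, U y -> v y = w y) ->
  \forall y \near x, v y = w y.
Proof.
move=> oU Ux vw; have /filterS : nbhs x U by exact: open_nbhs_nbhs.
by apply => y /vw.
Qed.

Lemma eq_partial U x v w i : open U -> U x -> (forall y, U y -> v y = w y) ->
  partial i v x = partial i w x.
Proof. by move=> oU Ux vw; apply: near_eq_derive; exact: open_near vw. Qed.

Lemma eq_Ck k U v w : open U -> (forall x, U x -> v x = w x) -> Ck k U v -> Ck k U w.
Proof.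
move=> oU; elim: k v w => [|k ih] v w vw [cv dv]; (split => [x Ux|]; last move=> // i).
- have cw : v @ x --> w x by rewrite -vw//; exact: cv.
  by apply: cvg_trans cw; exact: (near_eq_cvg (open_near oU Ux vw)).
- have cw : v @ x --> w x by rewrite -vw//; exact: cv.
  by apply: cvg_trans cw; exact: (near_eq_cvg (open_near oU Ux vw)).
- split=> [x Ux|]; last by apply: ih (dv i).2 => x Ux; exact: eq_partial vw.
  by apply: near_eq_derivable ((dv i).1 x Ux); exact: open_near vw.
Qed.

Lemma partial_cst i (c : R) : partial i (cst c : 'rV[R]_n -> R) = cst 0.
Proof. by apply/funext => x; exact: derive_cst. Qed.

Lemma Ck_cst k U (c : R) : Ck k U (cst c).
Proof.
elim: k c => [|k ih] c; (split => [x _|]; [exact: cst_continuous|move=> // i]).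
by rewrite partial_cst; split => // x _; exact: derivable_cst.
Qed.

Lemma partialD i v w x : derivable v x (e i) -> derivable w x (e i) ->
  partial i (fun y => v y + w y) x = partial i v x + partial i w x.
Proof. exact: deriveD. Qed.

Lemma partialM i v w x : derivable v x (e i) -> derivable w x (e i) ->
  partial i (fun y => v y * w y) x = v x * partial i w x + w x * partial i v x.
Proof. exact: deriveM. Qed.

Lemma CkD k U v w : open U -> Ck k U v -> Ck k U w -> Ck k U (fun y => v y + w y).
Proof.
move=> oU; elim: k v w => [|k ih] v w [cv dv] [cw dw];
  (split => [x Ux|]; [by apply: continuousD; auto|move=> // i]).
have [dvi Cvi] := dv i; have [dwi Cwi] := dw i.
split=> [x Ux|]; first by apply: derivableD; auto.
apply: eq_Ck (ih _ _ Cvi Cwi) => // x Ux.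
by rewrite partialD; auto.
Qed.

Lemma CkM k U v w : open U -> Ck k U v -> Ck k U w -> Ck k U (fun y => v y * w y).
Proof.
move=> oU; elim: k v w => [|k ih] v w Cv Cw;
  (split => [x Ux|]; [by apply: continuousM; [exact: Ck_continuous Cv Ux|exact: Ck_continuous Cw Ux]|move=> // i]).
split=> [x Ux|]; first by apply: derivableM; [exact: Ck_derivable Cv Ux|exact: Ck_derivable Cw Ux].
apply: (@eq_Ck k U (fun x => v x * partial i w x + w x * partial i v x)) => // [x Ux|].
  by rewrite partialM//; [exact: Ck_derivable Cv Ux|exact: Ck_derivable Cw Ux].
by apply: CkD => //; apply: ih; [exact: CkS|exact: Ck_partial|exact: CkS|exact: Ck_partial].
Qed.

Lemma CkZ k U v (c : R) : open U -> Ck k U v -> Ck k U (fun y => c * v y).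
Proof. by move=> oU Cv; apply: (@CkM k U (cst c)) => //; exact: Ck_cst. Qed.

Lemma partialZ i v x (c : R) : derivable v x (e i) ->
  partial i (fun y => c * v y) x = c * partial i v x.
Proof. by move=> dv; apply: (@deriveMl _ _ v). Qed.

Lemma CkB k U v w : open U -> Ck k U v -> Ck k U w -> Ck k U (fun y => v y - w y).
Proof.
move=> oU Cv Cw; apply: (@eq_Ck k U (fun y => v y + (-1) * w y)) => // [x _|].
  by rewrite mulN1r.
by apply: CkD => //; exact: CkZ.
Qed.

Lemma partialB i v w x : derivable v x (e i) -> derivable w x (e i) ->
  partial i (fun y => v y - w y) x = partial i v x - partial i w x.
Proof. exact: deriveB. Qed.

Lemma Ck_sum k U (I : Type) (r : seq I) (F : I -> 'rV[R]_n -> R) : open U ->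
  (forall j, Ck k U (F j)) -> Ck k U (fun y => \sum_(j <- r) F j y).
Proof.
move=> oU CF; elim: r => [|j r ih].
  by apply: eq_Ck (Ck_cst k U 0) => // x _; rewrite big_nil.
by apply: eq_Ck (CkD oU (CF j) ih) => // x _; rewrite big_cons.
Qed.

Lemma partial_sum k U x i (I : Type) (r : seq I) (F : I -> 'rV[R]_n -> R) : open U -> U x ->
  (forall j, Ck k.+1 U (F j)) ->
  partial i (fun y => \sum_(j <- r) F j y) x = \sum_(j <- r) partial i (F j) x.
Proof.
move=> oU Ux CF; elim: r => [|j r ih].
  rewrite big_nil (_ : (fun y => _) = cst 0) ?partial_cst//.
  by apply/funext => y; rewrite big_nil.
rewrite big_cons -ih -partialD; [|exact: Ck_derivable (CF j) Ux|].
  by congr partial; apply/funext => y; rewrite big_cons.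
exact: Ck_derivable (Ck_sum r oU CF) Ux.
Qed.

Lemma is_derive_coord i j x : is_derive x (e i) (fun y => y 0 j) ((i == j)%:R).
Proof.
have E : (fun h : R => h^-1 *: ((h *: e i + x) 0 j - x 0 j)) @ 0^' --> ((i == j)%:R : R).
  apply: (@cvg_trans _ ((fun _ : R => (i == j)%:R : R) @ 0^')); last exact: cvg_cst.
  apply: near_eq_cvg; near=> h; rewrite !mxE eqxx addrK [j == i]eq_sym.
  rewrite /GRing.scale/= mulrA mulVf ?mul1r//; near: h; exact: nbhs_dnbhs_neq.
by apply: DeriveDef; [apply/cvg_ex; exists (i == j)%:R|apply/cvg_lim].
Unshelve. all: by end_near. Qed.

Lemma partial_coord i j : partial i (fun y : 'rV[R]_n => y 0 j) = cst ((i == j)%:R).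
Proof. by apply/funext => x; have [_] := is_derive_coord i j x. Qed.

Lemma Ck_coord k U j : Ck k U (fun y => y 0 j).
Proof.
case: k => [|k]; (split => [x _|]; [exact: coord_continuous|move=> // i]).
rewrite partial_coord; split=> [x _|]; last exact: Ck_cst.
by have [] := is_derive_coord i j x.
Qed.

(** Restricting to the line through z in direction e_i reduces this to the one-variable chain rule
    for r -> s r. *)
Lemma is_derive_affine v y (s : R) z i : derivable v (affine y s z) (e i) ->
  is_derive z (e i) (v \o affine y s) (s * partial i v (affine y s z)).
Proof.
move=> /derivableP dv.
suff : is_derive (z + 0 *: e i) (e i) (v \o affine y s) (s * partial i v (affine y s z)).
  by rewrite scale0r addr0.
apply/is_derive_line.
pose g r := v (affine y s z + r *: e i).
have dg : is_derive (s * 0 : R) 1 g (partial i v (affine y s z)).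
  by apply/is_derive_line; rewrite mulr0 scale0r addr0.
rewrite (_ : (fun r => _) = g \o (fun r => s * r)); last first.
  apply/funext => r; rewrite /g /affine /= scalerDr addrA scalerA //.
have ds : is_derive (0 : R) (1 : R) (fun r : R => s * r) s.
  have := @is_deriveZ R R R id s 0 (1 : R) (1 : R) (is_derive_id 0 (1 : R)).
  by rewrite [s *: 1]mulr1.
by rewrite mulrC; apply: is_derive1_comp.
Qed.

Lemma Ck_affine k U V v y (s : R) : open V -> V `<=` affine y s @^-1` U ->
  Ck k U v -> Ck k V (v \o affine y s).
Proof.
move=> oV VU; elim: k v => [|k ih] v Cv.
  split=> // x /VU Ux; apply: continuous_comp; last exact: Ck_continuous Cv Ux.
  by apply: continuousD; [exact: cst_continuous|exact: scaler_continuous].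
have ca x : {for x, continuous (affine y s)}.
  by apply: continuousD; [exact: cst_continuous|exact: scaler_continuous].
split=> [x /VU Ux|i]; first by apply: continuous_comp; [exact: ca|exact: Ck_continuous Cv Ux].
split=> [x /VU Ux|].
  by have [] := is_derive_affine (Ck_derivable (i:=i) Cv Ux).
apply: (@eq_Ck k V (fun z => s * (partial i v \o affine y s) z)) => // [x /VU Ux|].
  by have [_ /esym] := is_derive_affine (Ck_derivable (i:=i) Cv Ux).
by apply: CkZ => //; apply: ih; exact: Ck_partial.
Qed.

(** Moves from a to a + h z one coordinate at a time, applies the mean value theorem on each
    segment, and compares the partial derivative found there with its value at a by continuity. *)
Lemma Ck1_is_derive U v a z : open U -> Ck 1 U v -> U a ->
  is_derive a z v (\sum_(i < n) z 0 i * partial i v a).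
Proof.
move=> oU Cv Ua; set L := \sum_(i < n) _.
suff H : (fun h : R => h^-1 *: (v (h *: z + a) - v a)) @ 0^' --> L.
  by apply: DeriveDef; [apply/cvg_ex; exists L|apply/cvg_lim].
apply/cvgrPdist_lt => ep ep0.
have [d0 d00 d0U] := open_eball_sub oU Ua.
(* This tolerance makes n errors of size |z| times it add up to less than ep; the added 1 avoids a
   zero denominator when z = 0. *)
have /choice[d1 Hd1] (i : 'I_n) : exists d : R, 0 < d /\
    forall y, eball a d y -> `|partial i v y - partial i v a| < ep / (enorm z * n.+1%:R + 1).
  have cp : {for a, continuous (partial i v)} by apply: Ck_continuous (Ck_partial i Cv) Ua.
  have ep1 : 0 < ep / (enorm z * n.+1%:R + 1).
    by rewrite divr_gt0// ltr_wpDl// mulr_ge0 ?enorm_ge0.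
  by have [d d0' Hd] := continuous_eball cp ep1; exists d.
have [d [dd0 dd1 dpos]] : exists d : R, [/\ d <= d0, forall i, d <= d1 i & 0 < d].
  exists (\big[Order.min/d0]_(i < n) d1 i); split.
  - exact: bigmin_le_id.
  - by move=> i; exact: bigmin_le.
  - by apply/bigmin_gtP; split => // i _; case: (Hd1 i).
have e10 : 0 < enorm z + 1 by rewrite ltr_wpDl// enorm_ge0.
near=> h.
have hne0 : h != 0 by near: h; exact: nbhs_dnbhs_neq.
have hd : `|h| * (enorm z + 1) < d.
  rewrite -ltr_pdivlMr//; near: h; apply: dnbhs0_lt.
  exact: divr_gt0.
(* [zj j] keeps the first j coordinates of z, so the increment telescopes over j and all
   intermediate points stay within |h| |z| of a. *)
pose zj (j : nat) : 'rV[R]_n := \row_i (if (i < j)%N then z 0 i else 0).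
have zj0 : zj 0%N = 0 by apply/rowP => i; rewrite !mxE.
have zjn : zj n = z by apply/rowP => i; rewrite !mxE ltn_ord.
have zjS (j : 'I_n) : zj j.+1 = zj j + z 0 j *: e j.
  apply/rowP => i; rewrite !mxE eqxx ltnS leq_eqVlt (inj_eq val_inj) eq_sym.
  have [->|ij] /= := eqVneq j i; first by rewrite ltnn add0r mulr1.
  by case: ifP => _; rewrite mulr0 addr0.
have nzj (j : 'I_n) (t : R) : `|t| <= `|z 0 j| -> enorm (zj j + t *: e j) <= enorm z.
  move=> tz; rewrite -ler_sqr ?nnegrE ?enorm_ge0// !sqr_enorm.
  apply: ler_sum => i _; rewrite -!expr2 !mxE eqxx eq_sym.
  have [<-|ij] /= := eqVneq j i.
    by rewrite ltnn add0r mulr1 -(real_normK (num_real t)) -(real_normK (num_real (z 0 j))) ler_sqr ?nnegrE.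
  by rewrite mulr0 addr0; case: ifP => _ //; rewrite expr0n sqr_ge0.
have Hj (j : 'I_n) : `|h * z 0 j * partial j v a - (v (h *: zj j.+1 + a) - v (h *: zj j + a))|
    <= `|h| * (enorm z * (ep / (enorm z * n.+1%:R + 1))).
  have Bd (s : R) : `|s| <= `|h * z 0 j| -> enorm (h *: zj j + a + s *: e j - a) < d.
    move=> sz; have -> : h *: zj j + a + s *: e j - a = h *: (zj j + (h^-1 * s) *: e j).
      by rewrite scalerDr scalerA mulrA divff// mul1r addrAC addrK.
    rewrite enormZ; apply: le_lt_trans hd; rewrite ler_wpM2l//.
    apply: (@le_trans _ _ (enorm z)); last by rewrite lerDl.
    apply: nzj; rewrite normrM normfV ler_pdivrMl ?normr_gt0//.
    by rewrite -normrM.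
  rewrite zjS scalerDr scalerA addrAC.
  have [s|s sz ->] := @mean_value_coord v (h *: zj j + a) j (h * z 0 j).
    move=> /Bd sd; apply: (Ck_derivable Cv); apply: d0U.
    by rewrite eballE /=; exact: lt_le_trans dd0.
  rewrite -mulrBr normrM distrC normrM -mulrA ler_wpM2l//.
  rewrite ler_pM//; first exact: coord_le_enorm.
  apply/ltW/(Hd1 j).2; rewrite eballE /=; apply: lt_le_trans (dd1 j).
  exact: Bd.
have T : v (h *: z + a) - v a = \sum_(j < n) (v (h *: zj j.+1 + a) - v (h *: zj j + a)).
  rewrite -(big_mkord xpredT (fun j => v (h *: zj j.+1 + a) - v (h *: zj j + a))).
  by rewrite telescope_sumr// zj0 zjn scaler0 add0r.
rewrite -(mulKf hne0 L) -mulrBr normrM normfV ltr_pdivrMl ?normr_gt0//.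
rewrite T /L mulr_sumr -sumrB.
apply: le_lt_trans (ler_norm_sum _ _ _) _.
apply: (@le_lt_trans _ _ (\sum_(j < n) `|h| * (enorm z * (ep / (enorm z * n.+1%:R + 1))))).
  by apply: ler_sum => j _; rewrite mulrA; exact: Hj.
rewrite sumr_const card_ord -[ltLHS]mulr_natr -mulrA ltr_pM2l ?normr_gt0//.
have q0 : 0 < enorm z * n.+1%:R + 1 by rewrite ltr_wpDl// mulr_ge0 ?enorm_ge0.
rewrite -mulrA mulrCA mulrAC -mulrA gtr_pMr//.
rewrite ltr_pdivrMr// mul1r.
by rewrite ltr_pwDr// ler_wpM2l ?enorm_ge0// ler_nat.
Unshelve. all: by end_near. Qed.

Lemma dist_le_half (p q q' ep : R) :
  `|p - q| < ep / 2 -> `|p - q'| < ep / 2 -> `|q - q'| <= ep.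
Proof.
by rewrite !ltr_norml => /andP[? ?] /andP[? ?]; rewrite ler_norml; apply/andP; split; lra.
Qed.

(** The mixed second difference over a square of side d/3 is symmetric in i and j. Two mean value
    theorems turn it into (d/3)^2 times either mixed derivative at a point near a; continuity does
    the rest. *)
Lemma partialC U v a i j : open U -> Ck 2 U v -> U a ->
  partial i (partial j v) a = partial j (partial i v) a.
Proof.
move=> oU Cv Ua; apply/eqP; rewrite -subr_eq0 -normr_le0; apply/ler_addgt0Pl => ep ep0.
rewrite addr0.
have ep20 : 0 < ep / 2 by rewrite divr_gt0.
have [d0 d00 d0U] := open_eball_sub oU Ua.
have [d1 d10 Hd1] := continuous_eball (Ck_continuous (Ck_partial i (Ck_partial j Cv)) Ua) ep20.
have [d2 d20 Hd2] := continuous_eball (Ck_continuous (Ck_partial j (Ck_partial i Cv)) Ua) ep20.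
pose d := Order.min d0 (Order.min d1 d2).
have dpos : 0 < d by rewrite !lt_min d00 d10.
(* Side d/3, since two moves of that length stay strictly within distance d of a. *)
have hpos : 0 < d / 3 by rewrite divr_gt0.
have near_a (s t : R) k l : `|s| <= d / 3 -> `|t| <= d / 3 -> eball a d (a + s *: e k + t *: e l).
  move=> sd td; rewrite eballE /= addrAC -addrA addrACA addrN add0r.
  apply: le_lt_trans (enormD _ _) _; rewrite !enormZ !enorm_delta !mulr1.
  by lra.
have key k l : exists2 y, eball a d y &
    v (a + (d / 3) *: e k + (d / 3) *: e l) - v (a + (d / 3) *: e k)
     - v (a + (d / 3) *: e l) + v a = (d / 3) ^+ 2 * partial l (partial k v) y.
  have aU (s t : R) : `|s| <= `|d / 3| -> `|t| <= `|d / 3| -> U (a + s *: e k + t *: e l).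
    rewrite !(gtr0_norm hpos) => sd td; apply: d0U.
    by have := near_a s t k l sd td; rewrite !eballE/= !lt_min => /andP[].
  have n0 : `|0 : R| <= `|d / 3| by rewrite normr0.
  pose w b := v (b + (d / 3) *: e l) - v b.
  have dw (s : R) : `|s| <= `|d / 3| -> is_derive (a + s *: e k) (e k) w
      (partial k v (a + s *: e k + (d / 3) *: e l) - partial k v (a + s *: e k)).
    move=> sd; apply: is_deriveB.
      have E : (fun y => v (y + (d / 3) *: e l)) = v \o affine ((d / 3) *: e l) 1.
        by apply/funext => y /=; rewrite /affine scale1r addrC.
      rewrite E -[partial k v _]mul1r.
      have E2 : a + s *: e k + (d / 3) *: e l = affine ((d / 3) *: e l) 1 (a + s *: e k).
        by rewrite /affine scale1r addrC.
      rewrite E2; apply: is_derive_affine; rewrite -E2.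
      exact: (Ck_derivable Cv) (aU _ _ sd (lexx _)).
    apply/derivableP/(Ck_derivable Cv).
    by have := aU _ _ sd n0; rewrite scale0r addr0.
  have [s sd|s sd Hs] := @mean_value_coord w a k (d / 3); first by have [] := dw s sd.
  have [t td|t td Ht] := @mean_value_coord (partial k v) (a + s *: e k) l (d / 3).
    exact: (Ck_derivable (Ck_partial k Cv)) (aU _ _ sd td).
  exists (a + s *: e k + t *: e l); first by apply: near_a; rewrite -(gtr0_norm hpos).
  rewrite expr2 -mulrA -Ht.
  have [_ /esym ww] := dw s sd.
  transitivity (w (a + (d / 3) *: e k) - w a); first by rewrite /w opprB addrA addrAC.
  by rewrite Hs; congr (_ * _).
have [y1 y1d H1] := key i j.
have [y2 y2d H2] := key j i.
have E : partial j (partial i v) y1 = partial i (partial j v) y2.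
  have h2 : (d / 3) ^+ 2 != 0 by rewrite gt_eqF// exprn_gt0.
  apply: (mulfI h2); apply: etrans (esym H1) _; apply: etrans _ H2.
  have -> : a + (d / 3) *: e i + (d / 3) *: e j = a + (d / 3) *: e j + (d / 3) *: e i.
    by rewrite addrAC.
  by ring.
have [] : eball a d1 y2 /\ eball a d2 y1.
  move: y1d y2d; rewrite !eballE/= !lt_min.
  by move=> /and3P[_ _ h2] /and3P[_ h1 _]; split; [exact: h1|exact: h2].
move=> /Hd1 h1 /Hd2 h2; rewrite -E in h1.
move: h1 h2.
exact: dist_le_half.
Qed.

End calculus.

(** * Differentiation under the integral and integration by parts against a bump *)

Lemma is_derive_under_integral d (Y : measurableType d) (R : realType)
    (mu : {measure set Y -> \bar R}) (B : set Y) (f df : R -> Y -> R) (G : Y -> R)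
    (a u v : R) :
  measurable B -> a \in `]u, v[ ->
  (forall x, x \in `]u, v[ -> mu.-integrable B (EFin \o f x)) ->
  (forall x y, x \in `]u, v[ -> B y -> is_derive x 1 (f ^~ y) (df x y)) ->
  (forall y, 0 <= G y) -> mu.-integrable B (EFin \o G) ->
  (forall x y, x \in `]u, v[ -> B y -> `|df x y| <= G y) ->
  is_derive a 1 (fun x => \int[mu]_(y in B) f x y) (\int[mu]_(y in B) df a y).
Proof.
move=> mB auv intf dfP G0 intG dfG.
have E x y : x \in `]u, v[ -> B y -> partial1of2 f x y = df x y.
  by move=> xuv By; have [_] := dfP _ _ xuv By; rewrite partial1of2E.
have d1 x y : x \in `]u, v[ -> B y -> derivable (f ^~ y) x 1.
  by move=> xuv By; have [] := dfP _ _ xuv By.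
have G1 x y : x \in `]u, v[ -> B y -> `|partial1of2 f x y| <= G y.
  by move=> xuv By; rewrite E// dfG.
apply: DeriveDef; first exact: (@derivable_under_integral _ _ _ _ _ _ mB a u v auv intf d1 G).
rewrite -derive1E (@differentiation_under_integral _ _ _ _ _ _ mB a u v auv intf d1 G)//.
by apply: eq_Rintegral => y /set_mem By; rewrite E.
Qed.

Section integration.
Variables (R : realType) (n : nat).
Implicit Types (f v w : 'rV[R]_n -> R) (U V : set 'rV[R]_n) (x y z a b : 'rV[R]_n).

Local Notation e i := (delta_mx 0 i : 'rV[R]_n).
Local Notation mu := (lebesgue_rV R n).

Lemma Ck_bounded U f a (r : R) : Ck 0 U f -> cball a r `<=` U ->
  exists2 M : R, 0 <= M & forall y, cball a r y -> `|f y| <= M.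
Proof.
move=> Cf rU.
have cf : {within cball a r, continuous f}.
  by apply: continuous_in_subspaceT => y /[!inE] /rU; exact: Ck_continuous Cf.
have [M [_ HM]] := compact_bounded (continuous_compact cf (@compact_cball _ _ a r)).
exists (`|M| + 1); first by rewrite addr_ge0.
move=> y ry; apply: HM; last by exists y.
by rewrite (le_lt_trans (ler_norm _))// ltrDl.
Qed.

Lemma eball0E (r : R) y : eball 0 r y = (enorm y < r) :> Prop.
Proof. by rewrite eballE /= subr0. Qed.

Lemma cball0E (r : R) y : cball 0 r y = (enorm y <= r) :> Prop.
Proof. by rewrite /cball /= subr0. Qed.

Lemma eball_cball a (r s : R) : r <= s -> eball a r `<=` cball a s.
Proof. by move=> rs y; rewrite eballE /= => /ltW /le_trans; exact. Qed.

Lemma Ck_measurable U f (D : set 'rV[R]_n) :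
  Ck 0 U f -> open D -> D `<=` U -> measurable_fun D f.
Proof.
move=> Cf oD DU; apply: measurable_rV_continuous => // y /[!inE] /DU.
exact: Ck_continuous Cf.
Qed.

Lemma Ck_integrable U f a (r : R) : Ck 0 U f -> cball a r `<=` U ->
  mu.-integrable (eball a r) (EFin \o f).
Proof.
move=> Cf rU; have [M M0 HM] := Ck_bounded Cf rU.
apply: measurable_bounded_integrable.
- exact: measurable_eball.
- exact: lebesgue_eball_lty.
- by apply: Ck_measurable Cf (@open_eball _ _ _ _) _ => y /(eball_cball (lexx r)) /rU.
- exists M; split; first exact: num_real.
  move=> s Ms y /(eball_cball (lexx r)) /HM /le_trans; apply; exact: ltW.
Qed.

Lemma Rintegral_support (D : set 'rV[R]_n) f : (forall y, ~ D y -> f y = 0) ->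
  \int[mu]_y f y = \int[mu]_(y in D) f y.
Proof.
move=> f0; rewrite [RHS]Rintegral_mkcond; apply: eq_Rintegral => y _.
by rewrite patchE; case: ifPn => // /negP; rewrite inE => /f0.
Qed.

Lemma integrable_support (D : set 'rV[R]_n) f : measurable D -> (forall y, ~ D y -> f y = 0) ->
  mu.-integrable D (EFin \o f) -> mu.-integrable setT (EFin \o f).
Proof.
move=> mD f0 /(integrable_mkcond _ mD); congr (integrable _ _ _).
apply/funext => y; rewrite patchE; case: ifPn => // /negP; rewrite inE => /f0 /= ->.
by [].
Qed.

Lemma integral_translate a (D : set 'rV[R]_n) f : measurable D -> measurable_fun D f ->
  \int[mu]_(y in D) f y = \int[mu]_(z in affine a 1 @^-1` D) f (affine a 1 z).
Proof.
move=> mD mf; congr fine.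
rewrite integralE [RHS]integralE; congr (_ - _)%E.
- rewrite (ge0_integral_affine a ltr01)//; first by rewrite expr1n mul1e; apply: eq_integral => z _; rewrite !unlock.
  by apply: measurable_funepos; exact/measurable_EFinP.
- rewrite (ge0_integral_affine a ltr01)//; first by rewrite expr1n mul1e; apply: eq_integral => z _; rewrite !unlock.
  by apply: measurable_funeneg; exact/measurable_EFinP.
Qed.

(** Functions supported in the closed ball vanish on this open set, so their derivatives vanish
    there too. *)
Lemma setTD_cball_open a (r : R) : open (~` cball a r).
Proof. apply: closed_openC; apply: compact_closed; [exact: norm_hausdorff|exact: compact_cball]. Qed.

(** By translation invariance, h -> int f(y + h e_i) dy is constant; its derivative at 0 is the
    integral of the partial derivative. *)
Lemma integral_partial0 f i (r : R) : 0 <= r -> Ck 1 setT f -> (forall y, ~ cball 0 r y -> f y = 0) ->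
  \int[mu]_y partial i f y = 0.
Proof.
move=> r0 Cf f0.
have mB := @measurable_eball R n 0 (r + 2).
have [L L0 HL] := Ck_bounded (Ck_partial i Cf) (@subsetT _ (cball 0 (r + 3))).
(* For |h| < 1 all translates are supported in the ball of radius r + 2, which therefore carries the
   dominating function. *)
have out (h : R) y : h \in `](-1), 1[ -> ~ eball 0 (r + 2) y -> ~ cball 0 r (y + h *: e i).
  rewrite in_itv/= => /andP[h1 h2] yr; rewrite cball0E => yh; apply: yr; rewrite eball0E.
  have := enormD (y + h *: e i) (- (h *: e i)); rewrite addrK enormN enormZ enorm_delta mulr1.
  have : `|h| < 1 by rewrite ltr_norml h1.
  by lra.
have df0 y : ~ cball 0 r y -> partial i f y = 0.
  move=> yr; rewrite (@eq_partial _ _ (~` cball 0 r) y f (cst 0) i)//.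
  - by rewrite partial_cst.
  - exact: setTD_cball_open.
have cf (h : R) : Ck 0 setT (fun y => f (y + h *: e i)).
  apply: (@eq_Ck _ _ 0 setT (f \o affine (h *: e i) 1)) => [||].
  - exact: openT.
  - by move=> y _; rewrite /= /affine scale1r addrC.
  - by apply: Ck_affine (CkS Cf) => //; exact: openT.
have intf (h : R) : h \in `](-1), 1[ -> mu.-integrable setT (EFin \o (fun y => f (y + h *: e i))).
  move=> h1; apply: (@integrable_support (eball 0 (r + 2))) => //.
    by move=> y yr; apply: f0; exact: out h1 yr.
  exact: Ck_integrable (cf h) (@subsetT _ _).
pose F (h : R) := \int[mu]_y f (y + h *: e i).
have dF : is_derive (0 : R) 1 F (\int[mu]_y partial i f (y + 0 *: e i)).
  apply: (@is_derive_under_integral _ _ _ _ _ _ (fun h y => partial i f (y + h *: e i))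
     (fun y => (cst L \_ (eball 0 (r + 2))) y) 0 (-1) 1) => //.
  - by rewrite in_itv/= ltrN10 ltr01.
  - move=> h y _ _; apply/is_derive_line/derivableP.
    exact: (Ck_derivable Cf).
  - by move=> y; rewrite patchE; case: ifP.
  - rewrite (_ : EFin \o _ = (EFin \o cst L) \_ (eball 0 (r + 2))); last first.
      by apply/funext => y; rewrite /= !patchE; case: ifP.
    apply/(integrable_mkcond _ mB)/Ck_integrable; last exact: (@subsetT _ _).
    exact: Ck_cst.
  - move=> h y h1 _; rewrite patchE; case: ifPn => [|/negP]; rewrite inE => yr.
      apply: HL; rewrite cball0E; apply: le_trans (enormD _ _) _.
      move: yr h1; rewrite eball0E in_itv/= enormZ enorm_delta mulr1 -ltr_norml.
      lra.
    by rewrite df0 ?normr0//; exact: out h1 yr.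
have FE : F = cst (\int[mu]_y f y).
  apply/funext => h; rewrite /F (@integral_translate (h *: e i) setT f)//.
    by apply: eq_Rintegral => y _; rewrite /affine scale1r addrC.
  by apply: Ck_measurable (CkS Cf) _ _ => //; exact: openT.
have [_] := dF; rewrite FE derive_cst => /esym E.
by rewrite -[RHS]E; apply: eq_Rintegral => y _; rewrite scale0r addr0.
Qed.

(** A truncated paraboloid: its gradient is -2k y times the next lower power, so integrations by
    parts remain within the family. The power 0 is the constant 1, also outside the unit ball. *)
Definition bump k y : R := Num.max (1 - dot y y) 0 ^+ k.

(** Away from 0 the function is locally zero or a power. At 0 the difference quotient is max(h,
    0)^(k+1), which tends to 0; an exponent of at least 2 is what makes this work. *)
Lemma is_derive_max0_exp k (s : R) :
  is_derive s 1 (fun t : R => Num.max t 0 ^+ k.+2) (k.+2%:R * Num.max s 0 ^+ k.+1).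
Proof.
have [s0|s0|->] := ltgtP s 0.
- rewrite expr0n mulr0.
  have E : \forall t \near s, cst (0 : R) t = Num.max t 0 ^+ k.+2.
    by near=> t; rewrite max_r ?expr0n//; apply: ltW; near: t; exact: lt_nbhsl.
  exact: near_eq_is_derive E (is_derive_cst _ _ _).
- have E : \forall t \near s, (id ^+ k.+2 : R -> R) t = Num.max t 0 ^+ k.+2.
    by near=> t; rewrite max_l ?fctE//; apply: ltW; near: t; exact: lt_nbhsr.
  apply: (near_eq_is_derive E).
  have := @is_deriveX R R id k.+2 s 1 1 (is_derive_id s (1 : R)).
  by rewrite [_ *: 1]mulr1.
- rewrite expr0n/= mulr0.
  have E : (fun h : R => h^-1 *: (Num.max (h *: (1 : R) + 0) 0 ^+ k.+2 - Num.max (0 : R) 0 ^+ k.+2)) @ 0^'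
      --> (0 : R).
    apply: (@cvg_trans _ ((fun h : R => Num.max h 0 ^+ k.+1) @ 0^')).
      apply: near_eq_cvg; near=> h.
      rewrite [h *: 1]mulr1 addr0 maxxx expr0n subr0 /GRing.scale/=.
      have h0 : h != 0 by near: h; exact: nbhs_dnbhs_neq.
      have [h1|h1] := leP h 0; first by rewrite !expr0n mulr0.
      by rewrite [in RHS]exprS mulKf.
    suff : (fun h : R => Num.max h 0 ^+ k.+1) @ 0^' --> Num.max (0 : R) 0 ^+ k.+1.
      by rewrite maxxx expr0n.
    apply: (cvg_within_filter (F := nbhs 0)).
    apply: (@continuous_comp _ _ _ (fun h : R => Num.max h 0) (fun t => t ^+ k.+1)).
      by apply: continuous_max; [exact: cvg_id|exact: cst_continuous].
    exact: exprn_continuous.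
  by apply: DeriveDef; [apply/cvg_ex; exists 0|apply/cvg_lim].
Unshelve. all: by end_near. Qed.

Lemma continuous_bump k : continuous (bump k).
Proof.
move=> y; apply: (@continuous_comp _ _ _ (fun y => Num.max (1 - dot y y) 0) (fun t => t ^+ k)).
  apply: continuous_max; last exact: cst_continuous.
  apply: continuousB; first exact: cst_continuous.
  apply: continuous_at_sum => i.
  by apply: continuousM; exact: coord_continuous.
exact: exprn_continuous.
Qed.

Lemma is_derive_bump k y i :
  is_derive y (e i) (bump k.+2) (- (2 * k.+2%:R) * (y 0 i * bump k.+1 y)).
Proof.
suff : is_derive (y + 0 *: e i) (e i) (bump k.+2) (- (2 * k.+2%:R) * (y 0 i * bump k.+1 y)).
  by rewrite scale0r addr0.
apply/is_derive_line.
pose p (t : R) := 1 - dot y y - 2 * y 0 i * t - t ^+ 2.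
have pE (t : R) : 1 - dot (y + t *: e i) (y + t *: e i) = p t.
  rewrite !(dotDl, dotDr, dotZl, dotZr) -[dot (e i) (e i)]sqr_enorm enorm_delta.
  have ye : dot y (e i) = y 0 i.
    rewrite /dot (bigD1 i)//= big1 ?addr0 => [|j ji]; first by rewrite !mxE !eqxx mulr1.
    by rewrite !mxE eqxx (negbTE ji) mulr0.
  by rewrite (dotC _ y) ye /p; ring.
have dp : is_derive (0 : R) (1 : R) p (- (2 * y 0 i)).
  have -> : p = (cst (1 - dot y y) - (2 * y 0 i) *: id) - (id : R -> R) ^+ 2.
    by apply/funext => t /=; rewrite /p !fctE.
  by apply: is_derive_eq; rewrite sub0r expr1 mulr0 scale0r subr0 [_ *: 1]mulr1.
have dm := is_derive_max0_exp k (p 0).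
rewrite (_ : (fun s => _) = (fun t : R => Num.max t 0 ^+ k.+2) \o p); last first.
  by apply/funext => t /=; rewrite /bump pE.
have := @is_derive1_comp _ (fun t : R => Num.max t 0 ^+ k.+2) p 0 _ _ dm dp.
congr (is_derive _ _ _ _).
by rewrite /bump -(pE 0) scale0r addr0; ring.
Qed.

Lemma partial_bump k i :
  partial i (bump k.+2) = (fun y => - (2 * k.+2%:R) * (y 0 i * bump k.+1 y)).
Proof. by apply/funext => y; have [_] := is_derive_bump k y i. Qed.

Lemma Ck0_bump k U : Ck 0 U (bump k).
Proof. by split => // y _; exact: continuous_bump. Qed.

Lemma Ck1_bump k U : Ck 1 U (bump k.+2).
Proof.
split=> [y _|i]; first exact: continuous_bump.
split=> [y _|]; first by have [] := is_derive_bump k y i.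
apply: (@CkW _ _ _ _ setT) => //; rewrite partial_bump.
apply: CkZ; first exact: openT.
by apply: CkM; [exact: openT|exact: Ck_coord|exact: Ck0_bump].
Qed.

Lemma bump_ge0 k y : 0 <= bump k y.
Proof. by rewrite exprn_ge0// le_max lexx orbT. Qed.

Lemma bump_le1 k y : bump k y <= 1.
Proof. by rewrite exprn_ile1// ?le_max ?lexx ?orbT// ge_max ler01 andbT gerBl dotxx_ge0. Qed.

Lemma bump_out k y : ~ eball 0 1 y -> bump k.+1 y = 0.
Proof.
rewrite eballE /= subr0 => /negP; rewrite -leNgt => y1.
rewrite /bump max_r ?expr0n//.
by rewrite subr_le0 -sqr_enorm expr_ge1// enorm_ge0.
Qed.

(** The product of w with the bump, zero outside the closed ball, is C^1 on U and on the complement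
    of that ball, hence everywhere. Its partial derivative integrates to 0, so there is no boundary
    term. *)
Lemma integral_bump_partial k i U w : open U -> cball 0 1 `<=` U -> Ck 1 U w ->
  \int[mu]_(y in eball 0 1) (bump k.+2 y * partial i w y) =
  (2 * k.+2%:R) * \int[mu]_(y in eball 0 1) (y 0 i * (bump k.+1 y * w y)).
Proof.
move=> oU BU Cw.
pose F y := bump k.+2 y * w y.
have CF1 : Ck 1 U F by apply: CkM; [exact: oU|exact: Ck1_bump|exact: Cw].
have oV : open (~` cball (0 : 'rV[R]_n) 1) by exact: setTD_cball_open.
have F0 y : (~` cball 0 1) y -> cst 0 y = F y.
  by move=> y1; rewrite /F bump_out ?mul0r//= => /(eball_cball (lexx 1)).
have CF2 : Ck 1 (~` cball 0 1) F by apply: eq_Ck F0 (Ck_cst _ _ _).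
have CF : Ck 1 setT F.
  rewrite (_ : setT = U `|` ~` cball 0 1); first exact: Ck_setU.
  apply/seteqP; split => // y _; have [/BU|] := pselect (cball 0 1 y); [by left|by right].
have dFE y : U y -> partial i F y =
    bump k.+2 y * partial i w y - (2 * k.+2%:R) * (y 0 i * (bump k.+1 y * w y)).
  move=> Uy; rewrite partialM; [|exact: (Ck_derivable (Ck1_bump k U)) Uy|exact: (Ck_derivable Cw)].
  by rewrite partial_bump; ring.
have dF0 y : ~ eball 0 1 y -> partial i F y = 0.
  move=> y1; have [Uy|nUy] := pselect (U y).
    by rewrite dFE// !bump_out// !mul0r !mulr0 subrr.
  rewrite -(@eq_partial _ _ _ y (cst 0) F i oV _ F0) ?partial_cst//.
  by move=> /BU.
have := integral_partial0 i ler01 CF (fun y h => esym (F0 y h)).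
rewrite (Rintegral_support dF0) => E.
have C1 : Ck 0 U (fun y => bump k.+2 y * partial i w y).
  by apply: CkM => //; [exact: Ck0_bump|exact: Ck_partial].
have C2 : Ck 0 U (fun y => y 0 i * (bump k.+1 y * w y)).
  by apply: CkM => //; [exact: Ck_coord|apply: CkM => //; [exact: Ck0_bump|exact: CkS]].
apply/eqP; rewrite -subr_eq0 -RintegralZl; [|exact: measurable_eball|exact: Ck_integrable C2 BU].
rewrite -RintegralB; [|exact: measurable_eball|exact: Ck_integrable C1 BU|].
  apply/eqP; apply: etrans E; apply: eq_Rintegral => y /set_mem y1.
  by rewrite dFE//; apply: BU; exact: eball_cball y1.
exact: Ck_integrable (CkZ _ oU C2) BU.
Qed.

End integration.

Local Opaque Ck partial.

Ltac solve_Ck oU := repeat first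
  [ exact: oU
  | match goal with
    | |- Ck ?k ?U (fun y => bump ?m y) => change (Ck k U (bump m)); apply: Ck0_bump
    | |- Ck ?k ?U (bump ?m) => apply: Ck0_bump
    | |- Ck ?k ?U (fun y => fun_of_matrix y _ _) => apply: Ck_coord
    | |- Ck ?k ?U (fun y => _ * _) => apply: CkM
    | |- Ck ?k ?U (fun y => _ + - _) => apply: CkB
    | |- Ck ?k ?U (fun y => _ + _) => apply: CkD
    | |- Ck ?k ?U (fun y => \sum_(j <- _) _) => apply: Ck_sum
    | |- Ck ?k ?U (fun y => ?f y) => change (Ck k U f)
    | H : Ck ?k ?U ?f |- Ck ?k ?U ?f => exact: H
    | H : forall i, Ck ?k ?U _ |- Ck ?k ?U _ => solve [simple apply H]
    | H : forall i j, Ck ?k ?U _ |- Ck ?k ?U _ => solve [simple apply H]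
    | |- Ck ?k ?U (fun y => ?c) => apply: Ck_cst
    end
  | move=> ? ].

(** * Caccioppoli estimate for the Hessian *)

Section energy.
Variables (R : realType) (n : nat).
Implicit Types (f v w g : 'rV[R]_n -> R) (U V : set 'rV[R]_n) (x y z a b : 'rV[R]_n).

Local Notation mu := (lebesgue_rV R n).
Local Notation B1 := (eball (0 : 'rV[R]_n) 1).
Local Notation "<< F >>" := (\int[mu]_(y in B1) F y).

Lemma Rintegral_sum_Ck U a (r : R) (I : Type) (s : seq I) (F : I -> 'rV[R]_n -> R) :
  open U -> cball a r `<=` U -> (forall j, Ck 0 U (F j)) ->
  \int[mu]_(y in eball a r) (\sum_(j <- s) F j y) = \sum_(j <- s) \int[mu]_(y in eball a r) F j y.
Proof.
move=> oU rU CF; elim: s => [|j s ih].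
  rewrite big_nil; under eq_Rintegral do rewrite big_nil.
  by rewrite Rintegral_cst ?mul0r//; exact: measurable_eball.
rewrite big_cons -ih -RintegralD; [|exact: measurable_eball|exact: Ck_integrable rU|].
  by apply: eq_Rintegral => y _; rewrite big_cons.
exact: Ck_integrable (Ck_sum _ oU CF) rU.
Qed.

Lemma le_Rintegral_Ck U a (r : R) f g :
  cball a r `<=` U -> Ck 0 U f -> Ck 0 U g -> (forall y, eball a r y -> f y <= g y) ->
  \int[mu]_(y in eball a r) f y <= \int[mu]_(y in eball a r) g y.
Proof.
move=> rU Cf Cg; apply: le_Rintegral; [exact: measurable_eball|exact: Ck_integrable rU..].
Qed.

Lemma RintegralD_Ck U a (r : R) f g : cball a r `<=` U -> Ck 0 U f -> Ck 0 U g ->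
  \int[mu]_(y in eball a r) (f y + g y) =
  \int[mu]_(y in eball a r) f y + \int[mu]_(y in eball a r) g y.
Proof.
by move=> rU Cf Cg; apply: RintegralD; [exact: measurable_eball|exact: Ck_integrable rU..].
Qed.

Lemma RintegralB_Ck U a (r : R) f g : cball a r `<=` U -> Ck 0 U f -> Ck 0 U g ->
  \int[mu]_(y in eball a r) (f y - g y) =
  \int[mu]_(y in eball a r) f y - \int[mu]_(y in eball a r) g y.
Proof.
by move=> rU Cf Cg; apply: RintegralB; [exact: measurable_eball|exact: Ck_integrable rU..].
Qed.

Lemma RintegralZ_Ck U a (r : R) f (c : R) : cball a r `<=` U -> Ck 0 U f ->
  \int[mu]_(y in eball a r) (c * f y) = c * \int[mu]_(y in eball a r) f y.
Proof. by move=> rU Cf; apply: RintegralZl; [exact: measurable_eball|exact: Ck_integrable rU]. Qed.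

Lemma dotxx_lt1 y : B1 y -> dot y y <= 1.
Proof.
by rewrite eball0E -sqr_enorm => y1; rewrite expr_le1// ?enorm_ge0// ltW.
Qed.

Lemma bump_exp y : exists q : R, [/\ 0 <= q, q <= 1 & forall k, bump k y = q ^+ k].
Proof.
exists (Num.max (1 - dot y y) 0); split => //.
  by rewrite le_max lexx orbT.
by have := bump_le1 1 y; rewrite /bump expr1.
Qed.

(** Young's inequality as an exact square. Read t = y_i, a = v and b, c its first and second
    derivatives in direction i; half of the good term q^4 b^2 is spent on the cross term. *)
Lemma absorb_gradient (q t a b c : R) :
  8 * (t * (q ^+ 3 * (a * b))) - q ^+ 4 * (a * c + b * b) <=
  32 * (t * t * (q ^+ 2 * (a * a))) - q ^+ 4 * (a * c) - q ^+ 4 / 2 * (b * b).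
Proof.
rewrite -subr_ge0 [X in 0 <= X](_ : _ = (q ^+ 2 * b - 8 * (t * (q * a))) ^+ 2 / 2).
  by rewrite divr_ge0// sqr_ge0.
by field.
Qed.

(** The same with a = d_i v, differentiated in direction j. *)
Lemma absorb_hessian (q t a b c : R) :
  12 * (t * (q ^+ 5 * (a * b))) - q ^+ 6 * (a * c + b * b) <=
  72 * (q ^+ 4 * (a * a) * (t * t)) - 2^-1 * (q ^+ 6 * (b * b)) - q ^+ 6 * (a * c).
Proof.
rewrite -subr_ge0 [X in 0 <= X](_ : _ = (q ^+ 3 * b - 12 * (t * (q ^+ 2 * a))) ^+ 2 / 2).
  by rewrite divr_ge0// sqr_ge0.
by field.
Qed.

(** Here b = d_i v, c = d_i d_i v, d = g and c' = d_i g. The term b c' is left alone: it will cancel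
    against the one coming from [absorb_hessian]. *)
Lemma absorb_source (q t b c c' d : R) :
  - (12 * (t * (q ^+ 5 * (b * d))) - q ^+ 6 * (b * c' + d * c)) <=
  6 * (q ^+ 4 * (b * b)) + 6 * (q ^+ 6 * (d * d)) * (t * t) + q ^+ 6 * (d * c) + q ^+ 6 * (b * c').
Proof.
rewrite -subr_ge0 [X in 0 <= X](_ : _ = 6 * (q ^+ 2 * b + t * (q ^+ 3 * d)) ^+ 2).
  by rewrite mulr_ge0// sqr_ge0.
by ring.
Qed.

(** The equation is tested with q^4 v. The factor 65 is 2 (32 + 1/2): 32 from absorbing the cross
    term, 1/2 from v g <= (v^2 + g^2)/2. *)
Lemma gradient_energy_le U v g : open U -> cball 0 1 `<=` U -> Ck 2 U v -> Ck 0 U g ->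
  (forall y, U y -> laplacian v y = g y) ->
  << fun y => bump 4 y * \sum_(i < n) (partial i v y * partial i v y) >> <=
  65 * << fun y => v y * v y >> + << fun y => g y * g y >>.
Proof.
move=> oU BU Cv Cg Lv.
have Cv0 : Ck 0 U v by exact: CkS (CkS Cv).
have Cv1 i : Ck 0 U (partial i v) by exact: CkS (Ck_partial i Cv).
have Cv2 i : Ck 0 U (partial i (partial i v)) by exact: Ck_partial i (Ck_partial i Cv).
(* Minus the divergence of q^4 v grad v, so its integral vanishes. *)
pose J y := \sum_(i < n) (8 * (y 0 i * (bump 3 y * (v y * partial i v y)))
   - bump 4 y * (v y * partial i (partial i v) y + partial i v y * partial i v y)).
have J0 : << J >> = 0.
  rewrite (Rintegral_sum_Ck _ oU BU); last by solve_Ck oU.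
  apply: big1 => i _; rewrite (RintegralB_Ck BU); [|by solve_Ck oU..].
  rewrite (RintegralZ_Ck _ BU); last by solve_Ck oU.
  have := @integral_bump_partial R n 2 i U (fun y => v y * partial i v y) oU BU.
  rewrite -natrM => <-; last by apply: CkM => //; [exact: CkS|exact: Ck_partial].
  apply/eqP; rewrite subr_eq0; apply/eqP; apply: eq_Rintegral => y /set_mem /(eball_cball (lexx 1)) /BU Uy.
  by rewrite partialM; [|exact: (Ck_derivable Cv) Uy|exact: (Ck_derivable (Ck_partial i Cv)) Uy].
have JK : << J >> <= << fun y => 2^-1 * (65 * (v y * v y) + g y * g y
   - bump 4 y * \sum_(i < n) (partial i v y * partial i v y)) >>.
  apply: (le_Rintegral_Ck BU) => [||y y1].
  - by rewrite /J; solve_Ck oU.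
  - by solve_Ck oU.
  have Uy : U y by apply: BU; exact: eball_cball y1.
  have [q [q0 q1 qq]] := bump_exp y.
  rewrite /J !qq.
  have H1 : \sum_(i < n) (8 * (y 0 i * (q ^+ 3 * (v y * partial i v y)))
      - q ^+ 4 * (v y * partial i (partial i v) y + partial i v y * partial i v y)) <=
     32 * (dot y y * (q ^+ 2 * (v y * v y))) - q ^+ 4 * (v y * g y)
      - q ^+ 4 / 2 * \sum_(i < n) (partial i v y * partial i v y).
    rewrite -(Lv y Uy) /laplacian /dot !mulr_suml !mulr_sumr -!sumrB.
    by apply: ler_sum => i _; exact: absorb_gradient.
  apply: le_trans H1 _.
  have d1 := dotxx_lt1 y1; have d0 := dotxx_ge0 y.
  have S0 : 0 <= \sum_(i < n) (partial i v y * partial i v y).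
    by apply: sumr_ge0 => i _; rewrite -expr2 sqr_ge0.
  have q4 : q ^+ 4 <= 1 by rewrite exprn_ile1.
  have q40 : 0 <= q ^+ 4 by rewrite exprn_ge0.
  have q2 : q ^+ 2 <= 1 by rewrite exprn_ile1.
  have h1 : dot y y * (q ^+ 2 * (v y * v y)) <= v y * v y.
    rewrite mulrA ler_piMl -?expr2 ?sqr_ge0//.
    by rewrite mulr_ile1// exprn_ge0.
  have h2 : - (q ^+ 4 * (v y * g y)) <= (v y * v y + g y * g y) / 2.
    rewrite -mulrN; apply: (@le_trans _ _ (q ^+ 4 * ((v y * v y + g y * g y) / 2))).
      rewrite ler_wpM2l//; have : 0 <= (v y + g y) ^+ 2 by rewrite sqr_ge0.
      by lra.
    rewrite ler_piMl// divr_ge0// addr_ge0// -expr2 sqr_ge0//.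
  move: h1 h2; set A := dot y y * _; set D := q ^+ 4 * (v y * _); set S := \sum_(i < n) _.
  by lra.
move: JK; rewrite J0 (RintegralZ_Ck _ BU); last by solve_Ck oU.
rewrite (RintegralB_Ck BU); [|by solve_Ck oU..].
rewrite (RintegralD_Ck BU); [|by solve_Ck oU..].
rewrite (RintegralZ_Ck _ BU); last by solve_Ck oU.
by rewrite pmulr_rge0 ?invr_gt0// subr_ge0.
Qed.

(** Testing the equation of d_i v with q^6 d_i v leaves d_i v d_i g, and no bound on grad g is
    available. Subtracting the divergence identity of g grad v cancels that term and leaves only g
    itself. The constants are 156 = 2 (72 + 6) and 14 = 2 (6 + 1). *)
Lemma hessian_energy_le U v g : open U -> cball 0 1 `<=` U -> Ck 4 U v -> Ck 1 U g ->
  (forall y, U y -> laplacian v y = g y) ->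
  << fun y => bump 6 y * \sum_(i < n) \sum_(j < n) (partial j (partial i v) y * partial j (partial i v) y) >> <=
  156 * << fun y => bump 4 y * \sum_(i < n) (partial i v y * partial i v y) >>
   + 14 * << fun y => g y * g y >>.
Proof.
move=> oU BU Cv Cg Lv.
have Cg0 : Ck 0 U g by exact: CkS.
have Cg1 i : Ck 0 U (partial i g) by exact: Ck_partial.
have Cv0 : Ck 0 U v by exact: Ck_le Cv.
have Cv1 i : Ck 0 U (partial i v) by exact: Ck_le (Ck_partial i Cv).
have Cv2 i j : Ck 0 U (partial j (partial i v)).
  by exact: Ck_le (Ck_partial j (Ck_partial i Cv)).
have Cv3 i j : Ck 0 U (partial j (partial j (partial i v))).
  by exact: Ck_le (Ck_partial j (Ck_partial j (Ck_partial i Cv))).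
have Lvi i y : U y -> \sum_(j < n) partial j (partial j (partial i v)) y = partial i g y.
  move=> Uy; rewrite -(eq_partial i oU Uy Lv).
  rewrite (@partial_sum _ _ 0 U y i _ _ (fun j => partial j (partial j v)) oU Uy); last first.
    by move=> j; exact: Ck_le (Ck_partial j (Ck_partial j Cv)).
  apply: eq_bigr => j _.
  rewrite (@eq_partial _ _ U y (partial j (partial i v)) (partial i (partial j v)) j oU Uy).
    by apply: (partialC _ _ oU _ Uy); exact: Ck_le (Ck_partial j Cv).
  by move=> x Ux; apply: (partialC _ _ oU _ Ux); exact: Ck_le Cv.
pose J1 y := \sum_(i < n) \sum_(j < n)
   (12 * (y 0 j * (bump 5 y * (partial i v y * partial j (partial i v) y)))
   - bump 6 y * (partial i v y * partial j (partial j (partial i v)) y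
       + partial j (partial i v) y * partial j (partial i v) y)).
(* Minus the divergence of q^6 g grad v, while [J1] is minus the sum over i of those of q^6 d_i v
   grad d_i v; J1 - J2 is free of derivatives of g. *)
pose J2 y := \sum_(i < n) (12 * (y 0 i * (bump 5 y * (partial i v y * g y)))
   - bump 6 y * (partial i v y * partial i g y + g y * partial i (partial i v) y)).
have CJ1 : Ck 0 U J1 by rewrite /J1; solve_Ck oU.
have CJ2 : Ck 0 U J2 by rewrite /J2; solve_Ck oU.
have J10 : << J1 >> = 0.
  rewrite (Rintegral_sum_Ck _ oU BU); last by solve_Ck oU.
  apply: big1 => i _; rewrite (Rintegral_sum_Ck _ oU BU); last by solve_Ck oU.
  apply: big1 => j _; rewrite (RintegralB_Ck BU); [|by solve_Ck oU..].
  rewrite (RintegralZ_Ck _ BU); last by solve_Ck oU.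
  have := @integral_bump_partial R n 4 j U (fun y => partial i v y * partial j (partial i v) y) oU BU.
  rewrite -natrM => <-; last first.
    by apply: CkM; [exact: oU|exact: Ck_le (Ck_partial i Cv)|exact: Ck_le (Ck_partial j (Ck_partial i Cv))].
  apply/eqP; rewrite subr_eq0; apply/eqP; apply: eq_Rintegral => y /set_mem /(eball_cball (lexx 1)) /BU Uy.
  by rewrite partialM; [|exact: (Ck_derivable (Ck_partial i Cv)) Uy|
    exact: (Ck_derivable (Ck_partial j (Ck_partial i Cv))) Uy].
have J20 : << J2 >> = 0.
  rewrite (Rintegral_sum_Ck _ oU BU); last by solve_Ck oU.
  apply: big1 => i _; rewrite (RintegralB_Ck BU); [|by solve_Ck oU..].
  rewrite (RintegralZ_Ck _ BU); last by solve_Ck oU.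
  have := @integral_bump_partial R n 4 i U (fun y => partial i v y * g y) oU BU.
  rewrite -natrM => <-; last first.
    by apply: CkM; [exact: oU|exact: Ck_le (Ck_partial i Cv)|exact: Cg].
  apply/eqP; rewrite subr_eq0; apply/eqP; apply: eq_Rintegral => y /set_mem /(eball_cball (lexx 1)) /BU Uy.
  by rewrite partialM; [|exact: (Ck_derivable (Ck_partial i Cv)) Uy|exact: (Ck_derivable Cg) Uy].
pose S1 y := \sum_(i < n) (partial i v y * partial i v y).
pose S2 y := \sum_(i < n) \sum_(j < n) (partial j (partial i v) y * partial j (partial i v) y).
have CS1 : Ck 0 U S1 by rewrite /S1; solve_Ck oU.
have CS2 : Ck 0 U S2 by rewrite /S2; solve_Ck oU.
have JK : << fun y => J1 y - J2 y >> <=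
    << fun y => 78 * (bump 4 y * S1 y) + 7 * (g y * g y) - 2^-1 * (bump 6 y * S2 y) >>.
  apply: (le_Rintegral_Ck BU) => [||y y1]; [by solve_Ck oU..|].
  have Uy : U y by apply: BU; exact: eball_cball y1.
  have [q [q0 q1 qq]] := bump_exp y.
  rewrite /J1 /J2 !qq.
  have d1 := dotxx_lt1 y1; have d0 := dotxx_ge0 y.
  have q6 : q ^+ 6 <= 1 by rewrite exprn_ile1.
  have q60 : 0 <= q ^+ 6 by rewrite exprn_ge0.
  have q40 : 0 <= q ^+ 4 by rewrite exprn_ge0.
  have H1 : \sum_(i < n) \sum_(j < n)
     (12 * (y 0 j * (q ^+ 5 * (partial i v y * partial j (partial i v) y)))
     - q ^+ 6 * (partial i v y * partial j (partial j (partial i v)) y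
       + partial j (partial i v) y * partial j (partial i v) y)) <=
     72 * (q ^+ 4 * S1 y) - 2^-1 * (q ^+ 6 * S2 y)
     - \sum_(i < n) q ^+ 6 * (partial i v y * partial i g y).
    apply: (@le_trans _ _ (\sum_(i < n) (72 * (q ^+ 4 * (partial i v y * partial i v y) * dot y y)
       - 2^-1 * (q ^+ 6 * \sum_(j < n) (partial j (partial i v) y * partial j (partial i v) y))
       - q ^+ 6 * (partial i v y * partial i g y)))).
      apply: ler_sum => i _; rewrite -(Lvi i y Uy) /dot !mulr_sumr -!sumrB.
      by apply: ler_sum => j _; exact: absorb_hessian.
    rewrite !sumrB -!mulr_sumr -/(S2 y) lerB// lerB// ler_pM2l//.
    rewrite -mulr_suml -mulr_sumr -/(S1 y) ler_piMr// mulr_ge0//.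
    by apply: sumr_ge0 => i _; rewrite -expr2 sqr_ge0.
  have H2 : - (\sum_(i < n) (12 * (y 0 i * (q ^+ 5 * (partial i v y * g y)))
     - q ^+ 6 * (partial i v y * partial i g y + g y * partial i (partial i v) y))) <=
     6 * (q ^+ 4 * S1 y) + 7 * (g y * g y) + \sum_(i < n) q ^+ 6 * (partial i v y * partial i g y).
    apply: (@le_trans _ _ (6 * (q ^+ 4 * S1 y) + 6 * (q ^+ 6 * (g y * g y)) * dot y y
       + q ^+ 6 * (g y * laplacian v y) + \sum_(i < n) q ^+ 6 * (partial i v y * partial i g y))).
      rewrite /laplacian /dot /S1 !mulr_sumr -!big_split -sumrN /=.
      by apply: ler_sum => i _; exact: absorb_source.
    rewrite lerD2r -addrA lerD2l (Lv y Uy).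
    have gg : 0 <= g y * g y by rewrite -expr2 sqr_ge0.
    have h1 : q ^+ 6 * (g y * g y) <= g y * g y by rewrite ler_piMl.
    have h2 : 6 * (q ^+ 6 * (g y * g y)) * dot y y <= 6 * (g y * g y).
      apply: (@le_trans _ _ (6 * (q ^+ 6 * (g y * g y)))); last by rewrite ler_pM2l.
      by rewrite ler_piMr// mulr_ge0// mulr_ge0.
    by lra.
  by lra.
move: JK; rewrite (RintegralB_Ck BU)// J10 J20 subrr.
rewrite (RintegralB_Ck BU); [|by solve_Ck oU..].
rewrite (RintegralD_Ck BU); [|by solve_Ck oU..].
rewrite !(RintegralZ_Ck _ BU); [|by solve_Ck oU..].
by lra.
Qed.

Lemma Rintegral_subset_Ck U a b (r s : R) f : cball b s `<=` U -> Ck 0 U f ->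
  eball a r `<=` eball b s -> (forall y, eball b s y -> 0 <= f y) ->
  \int[mu]_(y in eball a r) f y <= \int[mu]_(y in eball b s) f y.
Proof.
move=> sU Cf rs f0; have intf := Ck_integrable Cf sU.
have [mf _] := integrableP _ _ _ intf.
apply: fine_le.
- apply: integrable_fin_num; first exact: measurable_eball.
  by apply: integrableS intf => //; exact: measurable_eball.
- by apply: integrable_fin_num; first exact: measurable_eball.
- by apply: ge0_subset_integral => //; exact: measurable_eball.
Qed.

Lemma caccioppoli U v g : open U -> cball 0 1 `<=` U -> Ck 4 U v -> Ck 1 U g ->
  (forall y, U y -> laplacian v y = g y) ->
  \int[mu]_(y in eball 0 (2 / 3)) \sum_(i < n) \sum_(j < n)
     (partial j (partial i v) y * partial j (partial i v) y) <=
  35 * (156 * (65 * << fun y => v y * v y >> + << fun y => g y * g y >>)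
        + 14 * << fun y => g y * g y >>).
Proof.
move=> oU BU Cv Cg Lv.
set S := fun y => \sum_(i < n) \sum_(j < n) _.
have Cv2 i j : Ck 0 U (partial j (partial i v)).
  by exact: Ck_le (Ck_partial j (Ck_partial i Cv)).
have CS : Ck 0 U S by rewrite /S; solve_Ck oU.
have S0 y : 0 <= S y by apply: sumr_ge0 => i _; apply: sumr_ge0 => j _; rewrite -expr2 sqr_ge0.
have B3 : eball (0 : 'rV[R]_n) (2 / 3) `<=` B1 by move=> y; rewrite !eball0E; lra.
have B3' : cball (0 : 'rV[R]_n) (2 / 3) `<=` U by move=> y; rewrite cball0E => y1; apply: BU; rewrite cball0E; lra.
(* On the ball of radius 2/3 one has 1 - |y|^2 >= 5/9, and 35 (5/9)^6 >= 1. *)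
apply: (@le_trans _ _ (35 * << fun y => bump 6 y * S y >>)).
  rewrite -(RintegralZ_Ck _ BU); last by solve_Ck oU.
  apply: (@le_trans _ _ (\int[mu]_(y in eball 0 (2 / 3)) (35 * (bump 6 y * S y)))).
    apply: (le_Rintegral_Ck B3') => [//||y].
      by solve_Ck oU.
    rewrite eball0E => y1; rewrite mulrA; apply: ler_peMl; first exact: S0.
    have y2 : 5 / 9 <= 1 - dot y y.
      have := enorm_ge0 y; rewrite -sqr_enorm; nra.
    rewrite /bump max_l; last by lra.
    apply: (@le_trans _ _ (35 * (5 / 9) ^+ 6)); first by lra.
    by rewrite ler_pM2l// lerXn2r// nnegrE; lra.
  apply: (Rintegral_subset_Ck BU _ B3); first by solve_Ck oU.
  by move=> y _; rewrite mulr_ge0// mulr_ge0// bump_ge0.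
rewrite ler_pM2l//; apply: le_trans (hessian_energy_le oU BU Cv Cg Lv) _.
rewrite lerD2r ler_pM2l//.
by apply: gradient_energy_le; [exact: oU|exact: BU|exact: Ck_le Cv|exact: Ck_le Cg|].
Qed.

End energy.

(** * The averages m(t, y) and their dependence on t *)

Section dilated_averages.
Variables (R : realType) (n : nat).
Implicit Types (f v w g h : 'rV[R]_n -> R) (U V : set 'rV[R]_n) (x y z a b : 'rV[R]_n).

Local Notation e i := (delta_mx 0 i : 'rV[R]_n).
Local Notation mu := (lebesgue_rV R n).
Local Notation B1 := (eball (0 : 'rV[R]_n) 1).
Local Notation U2 := (eball (0 : 'rV[R]_n) 2).
Local Notation "<< F >>" := (\int[mu]_(y in B1) F y).
Local Notation volB1 := (fine (mu (eball (0 : 'rV[R]_n) 1))).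

(** The power k is 3 for v, 4 for the source that appears on differentiating in t, and 0 for the
    plain integral over a translated and dilated ball, used to dominate squares. *)
Definition dilavg k h y (t : R) : R := \int[mu]_(z in B1) (bump k z * h (affine y t z)).

Lemma affine_ball y z (t r : R) : enorm y < r -> `|t| < 6 / 5 -> enorm z <= 1 ->
  enorm (affine y t z) < r + 6 / 5.
Proof.
move=> yr t1 z1; apply: le_lt_trans (enormD _ _) _; rewrite enormZ.
have := enorm_ge0 z; have := normr_ge0 t; nra.
Qed.

(** The radius 6/5 gives an open neighbourhood of the closed unit ball in z, and the bound 6/5 on t
    lets one differentiate at both ends of [0, 1]; everything stays in B_2 since 1/2 + (6/5)^2 < 2.
    For |z| <= 1 the points even stay within 17/10. *)
Lemma Ck_dil k h y (t : R) : enorm y < 1 / 2 -> `|t| < 6 / 5 -> Ck k U2 h ->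
  Ck k (eball 0 (6 / 5)) (h \o affine y t).
Proof.
move=> y1 t1; apply: Ck_affine; first exact: open_eball.
move=> z; rewrite !eball0E /= eball0E => z1.
apply: le_lt_trans (enormD _ _) _; rewrite enormZ.
have := enorm_ge0 z; have := normr_ge0 t; nra.
Qed.

Lemma B1_dil : cball (0 : 'rV[R]_n) 1 `<=` eball 0 (6 / 5).
Proof. by move=> z; rewrite cball0E eball0E; lra. Qed.

Lemma in_dil_ball y z (t : R) : enorm y < 1 / 2 -> `|t| < 6 / 5 -> enorm z <= 1 ->
  cball 0 (17 / 10) (affine y t z).
Proof.
by move=> y1 t1 z1; rewrite cball0E; have := affine_ball y1 t1 z1; lra.
Qed.

Lemma sub_U2 (r : R) : r < 2 -> cball (0 : 'rV[R]_n) r `<=` U2.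
Proof. by move=> r2 z; rewrite cball0E eball0E => /le_lt_trans; exact. Qed.

Lemma cball17_sub : cball (0 : 'rV[R]_n) (17 / 10) `<=` U2.
Proof. by apply: sub_U2; lra. Qed.

Lemma norm_lt65 (s : R) : 0 <= s <= 1 -> `|s| < 6 / 5.
Proof. by move=> /andP[s0 s1]; rewrite ger0_norm//; lra. Qed.

(** A crude sup bound, which supplies integrability and domination and never enters the final
    constants. *)
Lemma le_dilavg k h y (t M : R) : Ck 0 U2 h -> enorm y < 1 / 2 -> `|t| < 6 / 5 ->
  0 <= M -> (forall z, cball 0 (17 / 10) z -> `|h z| <= M) -> `|dilavg k h y t| <= M * volB1.
Proof.
move=> Ch y1 t1 M0 hM.
have Cf : Ck 0 (eball 0 (6 / 5)) (fun z => bump k z * h (affine y t z)).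
  by apply: CkM; [exact: open_eball|exact: Ck0_bump|exact: Ck_dil].
apply: le_trans (le_normr_Rintegral (@measurable_eball _ _ _ _) (Ck_integrable Cf B1_dil)) _.
rewrite -Rintegral_cst; last exact: measurable_eball.
apply: (@le_Rintegral _ _ _ _ _ _ (cst M)); first exact: measurable_eball.
- have := integrable_norm (Ck_integrable Cf B1_dil).
  by congr integrable; apply/funext => z.
- exact: Ck_integrable (Ck_cst _ _ _) B1_dil.
- move=> z; rewrite eball0E => z1; rewrite normrM.
  rewrite (ger0_norm (bump_ge0 _ _)) -[leRHS]mul1r ler_pM ?bump_ge0 ?bump_le1//.
  by apply: hM; apply: in_dil_ball => //; exact: ltW.
Qed.

(* Integration by parts in z: the gradient of q^4 is -8 q^3 z, q = bump 1. *)
Lemma is_derive_dilavg v g y (t : R) : Ck 4 U2 v -> Ck 1 U2 g ->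
  (forall x, U2 x -> laplacian v x = g x) -> enorm y < 1 / 2 -> `|t| < 6 / 5 ->
  is_derive t 1 (dilavg 3 v y) (t / 8 * dilavg 4 g y t).
Proof.
move=> Cv Cg Lv y1 t1.
have Cv1 i : Ck 0 U2 (partial i v) by exact: Ck_le (Ck_partial i Cv).
have Cv2 i : Ck 1 U2 (partial i v) by exact: Ck_le (Ck_partial i Cv).
have oV : open (eball (0 : 'rV[R]_n) (6 / 5)) by exact: open_eball.
have /choice[M HM] i : exists M : R, 0 <= M /\ forall z, cball 0 (17 / 10) z -> `|partial i v z| <= M.
  have [M M0 HM] := Ck_bounded (Cv1 i) cball17_sub.
  by exists M.
have aU z (s : R) : `|s| < 6 / 5 -> enorm z <= 1 -> U2 (affine y s z).
  by move=> s1 z1; apply: cball17_sub; exact: in_dil_ball.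
have dE : t / 8 * dilavg 4 g y t =
    \int[mu]_(z in B1) (bump 3 z * \sum_(i < n) z 0 i * partial i v (affine y t z)).
  have Cw i : Ck 1 (eball 0 (6 / 5)) (partial i v \o affine y t) by exact: Ck_dil.
  have Cg0 : Ck 0 (eball 0 (6 / 5)) (g \o affine y t) by apply: Ck_dil => //; exact: Ck_le Cg.
  have Cw0 i : Ck 0 (eball 0 (6 / 5)) (partial i v \o affine y t) by exact: CkS.
  have Cpw i : Ck 0 (eball 0 (6 / 5)) (partial i (partial i v \o affine y t)) by exact: Ck_partial.
  (* The bump identity for the rescaled derivative; differentiating d_i v (y + t z) in z yields the
     factor t in front of the Laplacian. *)
  have H i : 8 * \int[mu]_(z in B1) (z 0 i * (bump 3 z * (partial i v \o affine y t) z)) =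
      \int[mu]_(z in B1) (bump 4 z * partial i (partial i v \o affine y t) z).
    have := @integral_bump_partial R n 2 i _ _ oV B1_dil (Cw i).
    by rewrite -natrM => ->.
  transitivity (\sum_(i < n) \int[mu]_(z in B1) (z 0 i * (bump 3 z * (partial i v \o affine y t) z))).
    have n8 : (8 : R) != 0 by [].
    apply: (mulfI n8); rewrite mulr_sumr.
    transitivity (\sum_(i < n) \int[mu]_(z in B1) (bump 4 z * partial i (partial i v \o affine y t) z)).
      rewrite -(Rintegral_sum_Ck _ oV B1_dil); last by solve_Ck oV.
      rewrite mulrA mulrCA divff// mulr1 /dilavg.
      rewrite -(RintegralZ_Ck _ B1_dil); last by apply: CkM; [exact: oV|exact: Ck0_bump|exact: Cg0].
      apply: eq_Rintegral => z /set_mem; rewrite eball0E => z1.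
      rewrite -Lv; last by apply: aU => //; exact: ltW.
      rewrite /laplacian mulrCA !mulr_sumr; apply: eq_bigr => i _; congr (_ * _).
      have dv : derivable (partial i v) (affine y t z) (e i).
        by apply: (Ck_derivable (Cv2 i)); apply: aU => //; exact: ltW.
      by have [_ /esym] := is_derive_affine dv.
    by apply: eq_bigr => i _; rewrite H.
  rewrite -(Rintegral_sum_Ck _ oV B1_dil); last by solve_Ck oV.
  by apply: eq_Rintegral => z _; rewrite mulr_sumr; apply: eq_bigr => i _; rewrite mulrCA.
rewrite dE.
apply: (@is_derive_under_integral _ _ _ _ B1 (fun s z => bump 3 z * v (affine y s z))
  (fun s z => bump 3 z * \sum_(i < n) z 0 i * partial i v (affine y s z))
  (fun=> \sum_(i < n) M i) t (- (6 / 5)) (6 / 5)).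
- exact: measurable_eball.
- by rewrite in_itv/= -ltr_norml.
- move=> s; rewrite in_itv/= -ltr_norml => s1; apply: Ck_integrable B1_dil.
  by apply: CkM; [exact: oV|exact: Ck0_bump|apply: Ck_dil => //; exact: Ck_le Cv].
- move=> s z; rewrite in_itv/= -ltr_norml eball0E => s1 z1.
  have : is_derive (affine y s z) z v (\sum_(i < n) z 0 i * partial i v (affine y s z)).
    apply: Ck1_is_derive; [exact: (@open_eball _ _ 0 2)|exact: Ck_le Cv|].
    by apply: aU => //; exact: ltW.
  move=> /is_derive_line d.
  exact: (@is_deriveZ _ _ _ (fun r => v (affine y r z)) (bump 3 z)).
- by move=> z; apply: sumr_ge0 => i _; case: (HM i).
- exact: Ck_integrable (Ck_cst _ _ _) B1_dil.
- move=> s z; rewrite in_itv/= -ltr_norml eball0E => s1 z1.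
  rewrite normrM (ger0_norm (bump_ge0 _ _)) -[leRHS]mul1r ler_pM ?bump_ge0 ?bump_le1//.
  apply: le_trans (ler_norm_sum _ _ _) _; apply: ler_sum => i _.
  rewrite normrM -[leRHS]mul1r ler_pM//.
    by apply: le_trans (coord_le_enorm _ _) _; exact: ltW.
  by apply: (HM i).2; apply: in_dil_ball => //; exact: ltW.
Qed.

Section tonelli.
Variables (k : nat) (h : 'rV[R]_n -> R) (t r : R).
Hypotheses (Ch : Ck 0 U2 h) (h0 : forall y, cball 0 (17 / 10) y -> 0 <= h y).
Hypotheses (t1 : `|t| < 6 / 5) (r1 : r <= 1 / 2).
Local Notation D := (eball (0 : 'rV[R]_n) r).

(** Extended by zero outside the product of the two balls, so that Tonelli on the whole product
    space applies. *)
Let phi := (fun p : 'rV[R]_n * 'rV[R]_n => (bump k p.2 * h (affine p.1 t p.2))%:E) \_ (D `*` B1).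

Let measurable_phi : measurable_fun setT phi.
Proof.
have mDB : measurable (D `*` B1) by apply: measurableX; exact: measurable_eball.
apply/(measurable_restrictT _ mDB).
apply/measurable_EFinP; apply: measurable_funM.
  apply: measurable_funTS; apply: measurableT_comp; last exact: measurable_snd.
  by apply: (Ck_measurable (Ck0_bump k setT)) => //; exact: openT.
apply: (@measurable_comp _ _ _ _ _ _ U2); first exact: measurable_eball.
- move=> _ [[y z] [/= yr z1] <-]; apply: cball17_sub.
  move: yr z1; rewrite !eball0E => yr z1; apply: in_dil_ball => //; last exact: ltW.
  exact: lt_le_trans r1.
- by apply: (Ck_measurable Ch) => //; exact: open_eball.
- apply: measurable_funTS; apply: measurable_fun_rVP => i.
  rewrite (_ : _ \o _ = (fun p => rV_coord i p.1 + t * rV_coord i p.2)).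
    apply: measurable_funD.
      by apply: measurableT_comp; [exact: measurable_rV_coord|exact: measurable_fst].
    apply: measurable_funM => //.
    by apply: measurableT_comp; [exact: measurable_rV_coord|exact: measurable_snd].
  by apply/funext => p; rewrite /rV_coord /= affineE.
Qed.

Let phi_ge0 p : (0 <= phi p)%E.
Proof.
rewrite /phi patchE; case: ifPn => // /set_mem [/=]; rewrite !eball0E => yr z1.
rewrite lee_fin mulr_ge0 ?bump_ge0//; apply: h0; apply: in_dil_ball => //; last exact: ltW.
exact: lt_le_trans r1.
Qed.

Let phi_l y : D y -> (\int[mu]_z phi (y, z) = (dilavg k h y t)%:E)%E.
Proof.
move=> yr.
have Cf : Ck 0 (eball 0 (6 / 5)) (fun z => bump k z * h (affine y t z)).
  apply: CkM; [exact: open_eball|exact: Ck0_bump|apply: Ck_dil => //].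
  by move: yr; rewrite eball0E => /lt_le_trans; exact.
rewrite /dilavg fineK; last first.
  by apply: integrable_fin_num; [exact: measurable_eball|exact: Ck_integrable Cf B1_dil].
rewrite [RHS]integral_mkcond; apply: eq_integral => z _.
rewrite /phi !patchE; congr (if _ then _ else _).
by apply/idP/idP; rewrite !inE; [case|move=> z1; split].
Qed.

Lemma measurable_dilavg_ge0 : measurable_fun D (fun y => dilavg k h y t).
Proof.
apply/measurable_EFinP.
have mF := @measurable_fun_fubini_tonelli_F _ _ _ _ _ mu phi measurable_phi phi_ge0.
apply: (@eq_measurable_fun _ _ _ _ _ (fubini_F mu phi)).
  by move=> y /set_mem /phi_l.
exact: measurable_funTS.
Qed.

Lemma le_tonelli_dilavg (C : R) : 0 <= C ->
  (forall z, B1 z -> (\int[mu]_(y in D) (bump k z * h (affine y t z))%:E <= C%:E)%E) ->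
  (\int[mu]_(y in D) (dilavg k h y t)%:E <= (volB1 * C)%:E)%E.
Proof.
move=> C0 hC.
have -> : (\int[mu]_(y in D) (dilavg k h y t)%:E = \int[mu]_x fubini_F mu phi x)%E.
  rewrite [LHS]integral_mkcond; apply: eq_integral => y _.
  rewrite patchE; case: ifPn => [/set_mem yr|yr]; first by rewrite /fubini_F phi_l.
  symmetry; apply: integral0_eq => z _; rewrite /phi patchE ifF//.
  by apply/negbTE; apply: contra yr; rewrite !inE => -[].
rewrite (@fubini_tonelli _ _ _ _ _ mu mu phi measurable_phi phi_ge0).
rewrite mulrC EFinM EFin_eball -(@integral_cst _ _ _ mu); last exact: measurable_eball.
rewrite [leRHS]integral_mkcond; apply: ge0_le_integral => //.
- by move=> z _; apply: integral_ge0 => y _; exact: phi_ge0.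
- exact: (@measurable_fun_fubini_tonelli_G _ _ _ _ _ mu phi measurable_phi phi_ge0).
- apply/(measurable_restrictT _ (@measurable_eball _ _ _ _)).
  exact: measurable_cst.
move=> z _; rewrite /fubini_G patchE; case: ifPn => z1.
  apply: le_trans (hC z (set_mem z1)); rewrite [leRHS]integral_mkcond le_eqVlt.
  apply/orP; left; apply/eqP; apply: eq_integral => y _.
  rewrite /phi !patchE; congr (if _ then _ else _).
  by apply/idP/idP; rewrite !inE; [case|move=> yr; split => //; exact/set_mem].
rewrite integral0_eq// => y _; rewrite /phi patchE ifF//.
by apply/negbTE; apply: contra z1; rewrite !inE => -[].
Qed.

End tonelli.

(** Tonelli gives measurability for nonnegative integrands, so a bound M of |h| is added first and
    its contribution M int q^k subtracted afterwards. *)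
Lemma measurable_dilavg k h (t r : R) : Ck 0 U2 h -> `|t| < 6 / 5 -> r <= 1 / 2 ->
  measurable_fun (eball 0 r) (fun y => dilavg k h y t).
Proof.
move=> Ch t1 r1.
have [M M0 HM] := Ck_bounded Ch cball17_sub.
pose h' z := h z + M.
have oU : open U2 by exact: open_eball.
have Ch' : Ck 0 U2 h' by apply: CkD => //; exact: (Ck_cst 0 U2 M).
apply: (@eq_measurable_fun _ _ _ _ _ (fun y => dilavg k h' y t - M * << bump k >>)).
  move=> y /set_mem; rewrite eball0E => yr.
  have oV : open (eball (0 : 'rV[R]_n) (6 / 5)) by exact: open_eball.
  have y1 : enorm y < 1 / 2 by exact: lt_le_trans r1.
  have Cb : Ck 0 (eball 0 (6 / 5)) (@bump R n k) by exact: Ck0_bump.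
  have Cf : Ck 0 (eball 0 (6 / 5)) (fun z => bump k z * h (affine y t z)).
    by apply: CkM; [exact: oV|exact: Cb|exact: Ck_dil].
  rewrite /dilavg /h' -(RintegralZ_Ck _ B1_dil Cb).
  have -> : << fun z => bump k z * (h (affine y t z) + M) >> =
      << fun z => bump k z * h (affine y t z) + M * bump k z >>.
    by apply: eq_Rintegral => z _; rewrite mulrDr [M * _]mulrC.
  rewrite (RintegralD_Ck B1_dil Cf); first by rewrite addrK.
  by apply: CkZ; [exact: oV|exact: Cb].
apply: measurable_funB => //; apply: measurable_dilavg_ge0 => // y /HM.
by rewrite ler_norml => /andP[+ _]; rewrite /h'; lra.
Qed.

(** Cauchy-Schwarz against the constant 1: the integral of (f - c)^2 is nonnegative at c equal to
    the mean of f. *)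
Lemma sqr_Rintegral_eball_le U a (r : R) f : 0 < r -> cball a r `<=` U -> open U -> Ck 0 U f ->
  (\int[mu]_(y in eball a r) f y) ^+ 2 <=
  fine (mu (eball a r)) * \int[mu]_(y in eball a r) (f y * f y).
Proof.
move=> r0 rU oU Cf; set A := \int[mu]_(y in _) f y; set V := fine _.
have V0 : 0 < V by exact: fine_eball_gt0.
have key (c : R) : 0 <= \int[mu]_(y in eball a r) (f y * f y) - 2 * c * A + c ^+ 2 * V.
  rewrite -Rintegral_cst; last exact: measurable_eball.
  rewrite -(RintegralZ_Ck _ rU Cf) -(RintegralB_Ck rU); [|by solve_Ck oU..].
  rewrite -(RintegralD_Ck rU); [|by solve_Ck oU..].
  apply: Rintegral_ge0 => y _.
  by rewrite [X in 0 <= X](_ : _ = (f y - c) ^+ 2) ?sqr_ge0//; ring.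
have := mulr_ge0 (ltW V0) (key (A / V)).
rewrite [X in 0 <= X -> _](_ : _ = V * \int[mu]_(y in eball a r) (f y * f y) - A ^+ 2).
  by rewrite subr_ge0.
by field; rewrite gt_eqF.
Qed.

(** Cauchy-Schwarz in z bounds the square by |B_1| times the plain average of g^2. After exchanging
    the integrals, each fixed z contributes g^2 over a translate of B_r by t z, contained in B_(3/2)
    because 1/2 + 1 = 3/2. *)
Lemma dilavg_L2_le g (t r : R) : Ck 0 U2 g -> 0 <= t <= 1 -> r <= 1 / 2 ->
  \int[mu]_(y in eball 0 r) (dilavg 4 g y t ^+ 2) <=
  volB1 ^+ 2 * \int[mu]_(y in eball 0 (3 / 2)) (g y * g y).
Proof.
move=> Cg /andP[t0 tle1] r1.
have t1 : `|t| < 6 / 5 by rewrite ger0_norm//; lra.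
have oU : open U2 by exact: open_eball.
have oV : open (eball (0 : 'rV[R]_n) (6 / 5)) by exact: open_eball.
pose gg z := g z * g z.
have Cgg : Ck 0 U2 gg by apply: CkM.
have gg0 y : 0 <= gg y by rewrite /gg -expr2 sqr_ge0.
have V0 : 0 < volB1 by exact: fine_eball_gt0.
have U32 : cball (0 : 'rV[R]_n) (3 / 2) `<=` U2 by apply: sub_U2; lra.
have mG k h : Ck 0 U2 h -> measurable_fun (eball 0 r) (fun y => dilavg k h y t).
  by move=> Ch; exact: measurable_dilavg.
have y12 y : eball 0 r y -> enorm y < 1 / 2 by rewrite eball0E => /lt_le_trans; exact.
have bint k h : Ck 0 U2 h -> mu.-integrable (eball 0 r) (EFin \o (fun y => dilavg k h y t)).
  move=> Ch; have [M M0 HM] := Ck_bounded Ch cball17_sub.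
  apply: measurable_bounded_integrable; [exact: measurable_eball|exact: lebesgue_eball_lty|exact: mG|].
  exists (M * volB1); split; first exact: num_real.
  move=> s Ms y yr; apply: le_trans (ltW Ms); apply: le_dilavg => //; exact: y12.
apply: (@le_trans _ _ (\int[mu]_(y in eball 0 r) (volB1 * dilavg 0 gg y t))).
  apply: le_Rintegral; first exact: measurable_eball.
  - have [M M0 HM] := Ck_bounded Cg cball17_sub.
    apply: measurable_bounded_integrable; [exact: measurable_eball|exact: lebesgue_eball_lty| |].
      by apply: measurable_funX; exact: mG.
    exists ((M * volB1) ^+ 2); split; first exact: num_real.
    move=> s Ms y yr; apply: le_trans (ltW Ms).
    rewrite /= normrX lerXn2r ?nnegrE ?mulr_ge0 ?(ltW V0)//.
    by apply: le_dilavg => //; exact: y12.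
  - by have := integrableZl (@measurable_eball _ _ _ _) volB1 (bint 0%N gg Cgg).
  - move=> y /y12 y1.
    have Cgt : Ck 0 (eball 0 (6 / 5)) (g \o affine y t) by exact: Ck_dil.
    have Cb : Ck 0 (eball 0 (6 / 5)) (fun z => bump 4 z * (g \o affine y t) z).
      by apply: CkM => //; exact: Ck0_bump.
    apply: le_trans (sqr_Rintegral_eball_le ltr01 B1_dil oV Cb) _.
    rewrite ler_pM2l//; apply: (le_Rintegral_Ck B1_dil).
    + by apply: CkM.
    + by apply: CkM => //; [exact: Ck0_bump|exact: Ck_dil].
    + move=> z _; rewrite /gg /= mulrACA ler_wpM2r//; first exact: gg0.
      by rewrite [leRHS]expr0 mulr_ile1 ?bump_ge0 ?bump_le1.
rewrite RintegralZl; [|exact: measurable_eball|exact: bint].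
rewrite expr2 -mulrA ler_pM2l// -lee_fin.
rewrite fineK; last by apply: integrable_fin_num; [exact: measurable_eball|exact: bint].
apply: le_tonelli_dilavg => //.
  by apply: Rintegral_ge0 => y _; exact: gg0.
move=> z; rewrite eball0E => z1 /=.
rewrite [X in (_ <= X)%E]fineK; last first.
  apply: integrable_fin_num; [exact: measurable_eball|].
  exact: Ck_integrable Cgg U32.
(* [D'] is the ball of radius r centred at t z. *)
pose D' := affine (- (t *: z)) 1 @^-1` eball (0 : 'rV[R]_n) r.
have DE : affine (t *: z) 1 @^-1` D' = eball 0 r.
  by rewrite /D'; apply/seteqP; split => y; rewrite /= /affine !scale1r addKr.
have mD' : measurable D' by apply: measurable_preimage_affine; exact: measurable_eball.
have D'sub : D' `<=` eball 0 (3 / 2).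
  move=> y; rewrite /D' /= !eball0E /affine scale1r => yr.
  have := enormD (t *: z) (- (t *: z) + y); rewrite addNKr enormZ ger0_norm//.
  have : t * enorm z <= 1 by rewrite mulr_ile1 ?enorm_ge0 ?(ltW z1).
  by lra.
have mgg : measurable_fun (eball 0 (3 / 2)) (EFin \o gg).
  by apply/measurable_EFinP; apply: Ck_measurable Cgg _ _; [exact: open_eball|move=> y /(eball_cball (lexx _)) /U32].
have mggD : measurable_fun D' (EFin \o gg).
  by apply: measurable_funS mgg => //; exact: measurable_eball.
apply: (@le_trans _ _ (\int[mu]_(y in D') (EFin \o gg) y)%E); last first.
  apply: ge0_subset_integral => //; first exact: measurable_eball.
  by move=> y _; rewrite lee_fin.
rewrite (@ge0_integral_affine _ _ (t *: z) 1 D' (EFin \o gg) ltr01 mD' mggD); last first.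
  by move=> y _; rewrite lee_fin.
rewrite expr1n mul1e DE le_eqVlt; apply/orP; left; apply/eqP.
apply: eq_integral => y _; rewrite /bump expr0 mul1r /=; congr (gg _)%:E.
by rewrite /affine scale1r addrC.
Qed.

(** Instead of integrating the t-derivative and using Minkowski, the increment chi is paired with
    m(s, .). The mean value theorem for this scalar function of s gives a single s at which the
    integral of chi^2 equals that of chi times the derivative, and Young's inequality absorbs
    chi. *)
Lemma dilavg_increment_L2_le v g (r : R) : Ck 4 U2 v -> Ck 1 U2 g ->
  (forall x, U2 x -> laplacian v x = g x) -> r <= 1 / 2 ->
  \int[mu]_(y in eball 0 r) ((dilavg 3 v y 1 - dilavg 3 v y 0) ^+ 2) <=
  volB1 ^+ 2 * \int[mu]_(y in eball 0 (3 / 2)) (g y * g y).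
Proof.
move=> Cv Cg Lv r1.
have Cv0 : Ck 0 U2 v by exact: Ck_le Cv.
have Cg0 : Ck 0 U2 g by exact: Ck_le Cg.
have V0 : 0 < volB1 by exact: fine_eball_gt0.
pose D := eball (0 : 'rV[R]_n) r.
have mD : measurable D by exact: measurable_eball.
have [M M0 HM] := Ck_bounded Cv0 cball17_sub.
have [N N0 HN] := Ck_bounded Cg0 cball17_sub.
have y12 y : D y -> enorm y < 1 / 2 by rewrite /D eball0E => /lt_le_trans; exact.
have t0 : `|0 : R| < 6 / 5 by rewrite normr0; lra.
have t1 : `|1 : R| < 6 / 5 by rewrite normr1; lra.
pose chi y := dilavg 3 v y 1 - dilavg 3 v y 0.
have bint (f : 'rV[R]_n -> R) (K : R) : measurable_fun D f -> (forall y, D y -> `|f y| <= K) ->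
    mu.-integrable D (EFin \o f).
  move=> mf fK; apply: measurable_bounded_integrable => //; first exact: lebesgue_eball_lty.
  exists K; split; first exact: num_real.
  by move=> s Ks y Dy; apply: le_trans (ltW Ks); exact: fK.
have mchi : measurable_fun D chi by apply: measurable_funB; exact: measurable_dilavg.
have chiM y : D y -> `|chi y| <= 2 * (M * volB1).
  move=> /y12 y1; apply: le_trans (ler_normB _ _) _.
  by rewrite mulr2n mulrDl mul1r lerD//; exact: le_dilavg.
have K0 : 0 <= 2 * (M * volB1) by rewrite !mulr_ge0// ltW.
pose Phi (s : R) := \int[mu]_(y in D) (chi y * dilavg 3 v y s).
have dPhi (s : R) : `|s| < 6 / 5 ->
    is_derive s 1 Phi (\int[mu]_(y in D) (chi y * (s / 8 * dilavg 4 g y s))).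
  move=> s1; apply: (@is_derive_under_integral _ _ _ _ D (fun s y => chi y * dilavg 3 v y s)
    (fun s y => chi y * (s / 8 * dilavg 4 g y s))
    (fun=> 2 * (M * volB1) * (N * volB1)) s (- (6 / 5)) (6 / 5)) => //.
  - by rewrite in_itv/= -ltr_norml.
  - move=> x; rewrite in_itv/= -ltr_norml => x1.
    apply: (bint _ (2 * (M * volB1) * (M * volB1))).
      by apply: measurable_funM => //; exact: measurable_dilavg.
    move=> y Dy; rewrite normrM ler_pM//; first exact: chiM.
    by apply: le_dilavg => //; exact: y12.
  - move=> x y; rewrite in_itv/= -ltr_norml => x1 Dy.
    have d := is_derive_dilavg Cv Cg Lv (y12 y Dy) x1.
    exact: (@is_deriveZ _ _ _ (dilavg 3 v y) (chi y)).
  - by move=> _; rewrite !mulr_ge0// ltW.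
  - apply: (bint _ `|2 * (M * volB1) * (N * volB1)|) => //; exact: measurable_cst.
  - move=> x y; rewrite in_itv/= -ltr_norml => x1 Dy.
    rewrite normrM ler_pM//; first exact: chiM.
    rewrite normrM -[leRHS]mul1r ler_pM//; last by apply: le_dilavg => //; exact: y12.
    by rewrite normrM (ger0_norm (_ : 0 <= 8^-1)) ?invr_ge0//; move: x1; clear; lra.
have cPhi : {within `[0, 1], continuous Phi}.
  apply: derivable_within_continuous => s; rewrite in_itv/= => /andP[s0 s1].
  have s65 : `|s| < 6 / 5 by rewrite ger0_norm//; lra.
  by have [] := dPhi s s65.
have dPhi01 (s : R) : s \in `]0, 1[ ->
    is_derive s 1 Phi (\int[mu]_(y in D) (chi y * (s / 8 * dilavg 4 g y s))).
  by rewrite in_itv/= => /andP[s0 s1]; apply: dPhi; rewrite ger0_norm ?ltW//; lra.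
have [s s01 HPhi] := @MVT R Phi (fun s => \int[mu]_(y in D) (chi y * (s / 8 * dilavg 4 g y s)))
   0 1 ltr01 dPhi01 cPhi.
have /andP[s0 s1] : 0 < s < 1 by move: s01; rewrite in_itv.
have sn : `|s| < 6 / 5 by apply: norm_lt65; rewrite !ltW.
have ichi : mu.-integrable D (EFin \o (fun y => chi y ^+ 2)).
  apply: (bint _ ((2 * (M * volB1)) ^+ 2)); first exact: measurable_funX.
  by move=> y Dy; rewrite normrX lerXn2r ?nnegrE//; exact: chiM.
have iG : mu.-integrable D (EFin \o (fun y => dilavg 4 g y s ^+ 2)).
  apply: (bint _ ((N * volB1) ^+ 2)); first by apply: measurable_funX; exact: measurable_dilavg.
  move=> y Dy; rewrite normrX lerXn2r ?nnegrE ?mulr_ge0 ?(ltW V0)//.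
  by apply: le_dilavg => //; exact: y12.
have iM (x : R) : `|x| < 6 / 5 -> mu.-integrable D (EFin \o (fun y => chi y * dilavg 3 v y x)).
  move=> x1; apply: (bint _ (2 * (M * volB1) * (M * volB1))).
    by apply: measurable_funM => //; exact: measurable_dilavg.
  move=> y Dy; rewrite normrM ler_pM//; first exact: chiM.
  by apply: le_dilavg => //; exact: y12.
have iMG : mu.-integrable D (EFin \o (fun y => chi y * (s / 8 * dilavg 4 g y s))).
  apply: (bint _ (2 * (M * volB1) * (`|s / 8| * (N * volB1)))).
    by apply: measurable_funM => //; apply: measurable_funM => //; exact: measurable_dilavg.
  move=> y Dy; rewrite normrM ler_pM//; first exact: chiM.
  by rewrite normrM ler_wpM2l//; apply: le_dilavg => //; exact: y12.
(* Phi(1) - Phi(0) is the integral of chi times chi. *)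
have E : \int[mu]_(y in D) (chi y ^+ 2) = \int[mu]_(y in D) (chi y * (s / 8 * dilavg 4 g y s)).
  have := HPhi; rewrite subr0 mulr1 => <-.
  rewrite /Phi -RintegralB//; [|exact: iM..].
  by apply: eq_Rintegral => y _; rewrite -mulrBr expr2.
have B : \int[mu]_(y in D) (chi y ^+ 2) <=
    2^-1 * \int[mu]_(y in D) (chi y ^+ 2) + 2^-1 * \int[mu]_(y in D) (dilavg 4 g y s ^+ 2).
  rewrite {1}E -!RintegralZl// -RintegralD//; first last.
  - by have := integrableZl mD 2^-1 iG.
  - by have := integrableZl mD 2^-1 ichi.
  apply: le_Rintegral => //.
    have := integrableD mD (integrableZl mD 2^-1 ichi) (integrableZl mD 2^-1 iG).
    by congr integrable.
  move=> y _; set a := chi y; set b := dilavg 4 g y s.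
  have h1 : 0 <= (a - s / 8 * b) ^+ 2 by rewrite sqr_ge0.
  have h2 : (s / 8 * b) ^+ 2 <= b ^+ 2.
    rewrite exprMn ler_piMl ?sqr_ge0// expr_le1//; last by rewrite divr_ge0// ltW.
    by rewrite ler_pdivrMr// mul1r (le_trans (ltW s1))// ler1n.
  by move: h1 h2; clear; nra.
have L2 := dilavg_L2_le Cg0 (_ : 0 <= s <= 1) r1.
apply: le_trans (L2 _); last by rewrite !ltW.
by move: B; rewrite /chi /D; clear; lra.
Qed.

End dilated_averages.

(** * Approximation by harmonic quadratic polynomials *)

Section quadratic_approximation.
Variables (R : realType) (n : nat).
Implicit Types (f v w g h : 'rV[R]_n -> R) (U V : set 'rV[R]_n) (x y z : 'rV[R]_n).

Local Notation e i := (delta_mx 0 i : 'rV[R]_n).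
Local Notation mu := (lebesgue_rV R n).
Local Notation B1 := (eball (0 : 'rV[R]_n) 1).
Local Notation B32 := (eball (0 : 'rV[R]_n) (3 / 2)).
Local Notation U2 := (eball (0 : 'rV[R]_n) 2).
Local Notation volB1 := (fine (mu (eball (0 : 'rV[R]_n) 1))).

(** [A] need not be symmetric: the Hessian entries are A i j + A j i, and the Laplacian is twice the
    trace. *)
Definition quad (c : R) (b : 'I_n -> R) (A : 'I_n -> 'I_n -> R) y : R :=
  c + \sum_(i < n) b i * y 0 i + \sum_(i < n) \sum_(j < n) A i j * (y 0 i * y 0 j).

Lemma Ck_quad k U c b A : open U -> Ck k U (quad c b A).
Proof.
move=> oU; have Cc (a : R) : Ck k U (fun=> a) by exact: Ck_cst.
have Cx i : Ck k U (fun y => y 0 i) by exact: Ck_coord.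
apply: CkD => //; first by apply: CkD => //; apply: Ck_sum => // i; apply: CkM.
by apply: Ck_sum => // i; apply: Ck_sum => // j; apply: CkM => //; apply: CkM.
Qed.

Lemma partial_quad i c b A :
  partial i (quad c b A) = quad (b i) (fun j => A i j + A j i) (fun _ _ => 0).
Proof.
have oT : open [set: 'rV[R]_n] by exact: openT.
have Cc (a : R) : Ck 1 [set: 'rV[R]_n] (fun=> a) by exact: Ck_cst.
have Cx j : Ck 1 [set: 'rV[R]_n] (fun y => y 0 j) by exact: Ck_coord.
have Cl j (a : R) : Ck 1 setT (fun y : 'rV[R]_n => a * y 0 j) by apply: CkM.
have Cxx j k : Ck 1 setT (fun y : 'rV[R]_n => y 0 j * y 0 k) by apply: CkM.
have Cq j k (a : R) : Ck 1 setT (fun y : 'rV[R]_n => a * (y 0 j * y 0 k)) by apply: CkM.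
have Cql j : Ck 1 setT (fun y : 'rV[R]_n => \sum_(k < n) A j k * (y 0 j * y 0 k)).
  by apply: Ck_sum => // k.
have dk f : Ck 1 setT f -> forall y, derivable f y (e i).
  by move=> Cf y; exact: (Ck_derivable Cf).
have pc j y : partial i (fun y : 'rV[R]_n => y 0 j) y = (i == j)%:R by rewrite partial_coord.
have sd (F : 'I_n -> R) : \sum_(j < n) F j * (i == j)%:R = F i.
  rewrite (bigD1 i)//= big1 ?addr0 => [|j ji]; first by rewrite eqxx mulr1.
  by rewrite eq_sym (negbTE ji) mulr0.
apply/funext => y; rewrite /quad.
rewrite partialD; [|by apply: dk; apply: CkD => //; apply: Ck_sum|by apply: dk; apply: Ck_sum].
rewrite partialD; [|by apply: dk|by apply: dk; apply: Ck_sum].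
rewrite [partial i (fun=> c)]partial_cst add0r.
rewrite (@partial_sum _ _ 0 setT y i _ _ (fun j y => b j * y 0 j) oT)//.
rewrite (@partial_sum _ _ 0 setT y i _ _ (fun j y => \sum_(k < n) A j k * (y 0 j * y 0 k)) oT)//.
rewrite [X in _ = _ + X]big1 ?addr0; last by move=> j _; rewrite big1// => k _; rewrite mul0r.
congr (_ + _).
  by rewrite -[RHS]sd; apply: eq_bigr => j _; rewrite partialZ ?pc//; apply: dk.
transitivity (\sum_(j < n) \sum_(k < n) A j k * (y 0 j * (i == k)%:R + y 0 k * (i == j)%:R)).
  apply: eq_bigr => j _.
  rewrite (@partial_sum _ _ 0 setT y i _ _ (fun k y => A j k * (y 0 j * y 0 k)) oT)//.
  apply: eq_bigr => k _; rewrite partialZ; last by apply: dk.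
  by rewrite partialM ?pc//; apply: dk.
under eq_bigr do under eq_bigr do rewrite mulrDr mulrA [A _ _ * (_ * _)]mulrA.
under eq_bigr do rewrite big_split/= sd.
rewrite big_split /= [X in _ + X]exchange_big /=.
under [X in _ + X]eq_bigr do rewrite sd.
rewrite -big_split; apply: eq_bigr => j _ /=.
by rewrite addrC -mulrDl.
Qed.

Lemma partial2_quad i j c b A : partial j (partial i (quad c b A)) = cst (A i j + A j i).
Proof.
rewrite !partial_quad /quad; apply/funext => y /=.
rewrite [X in _ + X + _]big1; last by move=> k _; rewrite addr0 mul0r.
by rewrite addr0 big1 ?addr0// => k _; rewrite big1// => l _; rewrite mul0r.
Qed.

Lemma laplacian_quad c b A y : laplacian (quad c b A) y = 2 * \sum_(i < n) A i i.
Proof.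
rewrite /laplacian mulr_sumr; apply: eq_bigr => i _.
by rewrite partial2_quad /cst mulr_natl.
Qed.

(** The third derivative of s_+^3 lies between 0 and 6, so the Taylor remainder has constant 6/3! =
    1. The proof distinguishes the signs of a and a + b. *)
Lemma max0_cube_taylor (a b : R) :
  `|Num.max (a + b) 0 ^+ 3 -
    (Num.max a 0 ^+ 3 + 3 * Num.max a 0 ^+ 2 * b + 3 * Num.max a 0 * b ^+ 2)| <= `|b| ^+ 3.
Proof.
have [a0|a0] := leP a 0; have [ab|ab] := leP (a + b) 0.
- by rewrite !expr0n/= !(mul0r, mulr0, addr0, subr0) normr0 exprn_ge0.
- have b0 : 0 <= b by lra.
  rewrite !expr0n/= !(mul0r, mulr0, addr0, subr0) !ger0_norm ?exprn_ge0 ?(ltW ab)//.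
  by rewrite lerXn2r ?nnegrE ?(ltW ab)//; lra.
- have b0 : b <= 0 by lra.
  rewrite expr0n/= sub0r normrN (ler0_norm b0) ler_norml.
  have h3 : 0 <= (- (a + b)) ^+ 3 by rewrite exprn_ge0//; lra.
  have h4 : (- (a + b)) ^+ 3 <= (- b) ^+ 3 by rewrite lerXn2r ?nnegrE; lra.
  have E : a ^+ 3 + 3 * a ^+ 2 * b + 3 * a * b ^+ 2 = (- b) ^+ 3 - (- (a + b)) ^+ 3 by ring.
  rewrite E; apply/andP; split; last by lra.
  by apply: (@le_trans _ _ 0); [rewrite oppr_le0 exprn_ge0//; lra|lra].
- rewrite [X in `|X|](_ : _ = b ^+ 3); last by ring.
  by rewrite normrX.
Qed.

(* With q^3 = s_+^3, s = 1 - |z|^2, moving z to z - y adds 2 z.y - |y|^2 to s;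
   the terms of order at least 3 in y are dropped from the expansion. *)
Definition bump3_taylor z y : R :=
  bump 3 z + 3 * bump 2 z * (2 * dot z y - dot y y) + 12 * bump 1 z * dot z y ^+ 2.

Lemma bump3_taylorP z y (r : R) : enorm z <= 3 / 2 -> enorm y <= r -> r <= 1 / 2 ->
  `|bump 3 (z - y) - bump3_taylor z y| <= 100 * r ^+ 3.
Proof.
move=> z32 yr r1; have y0 := enorm_ge0 y; have z0 := enorm_ge0 z.
have r0 : 0 <= r by exact: le_trans yr.
pose a := 1 - dot z z; pose b := 2 * dot z y - dot y y.
have abE : 1 - dot (z - y) (z - y) = a + b.
  rewrite -[- y]scaleN1r !(dotDl, dotDr, dotZl, dotZr) (dotC y z) /a /b; ring.
have zy : `|dot z y| <= 3 / 2 * r.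
  by apply: le_trans (dot_le z y) _; rewrite ler_pM.
have yy : dot y y <= r ^+ 2 by rewrite -sqr_enorm lerXn2r// nnegrE.
have yy0 := dotxx_ge0 y.
have r2 : r ^+ 2 <= r / 2 by rewrite expr2; nra.
have b4 : `|b| <= 4 * r.
  move: zy; rewrite /b !ler_norml => /andP[h1 h2]; apply/andP; split; lra.
have a1 : 0 <= Num.max a 0 <= 1.
  rewrite le_max lexx orbT/= ge_max ler01 andbT /a.
  by have := dotxx_ge0 z; lra.
have T := max0_cube_taylor a b.
(* Expanding b^2 leaves 4 (z.y)^2, which [bump3_taylor] keeps, and two terms of order at least 3 in
   y. The final count is 64 from |b| <= 4 r plus 3 * 7 from these, rounded up to 100. *)
have E : bump 3 (z - y) - bump3_taylor z y =
  (Num.max (a + b) 0 ^+ 3 -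
    (Num.max a 0 ^+ 3 + 3 * Num.max a 0 ^+ 2 * b + 3 * Num.max a 0 * b ^+ 2)) +
  3 * Num.max a 0 * (dot y y ^+ 2 - 4 * dot z y * dot y y).
  rewrite /bump /bump3_taylor /bump abE -/a /b expr1; ring.
rewrite E; apply: le_trans (ler_normD _ _) _.
have B : `|b| ^+ 3 <= 64 * r ^+ 3.
  have -> : 64 * r ^+ 3 = (4 * r) ^+ 3 by rewrite exprMn; congr (_ * _); ring.
  by rewrite lerXn2r ?nnegrE// mulr_ge0.
have r3 : 0 <= r ^+ 3 by rewrite exprn_ge0.
have C : `|dot y y ^+ 2 - 4 * dot z y * dot y y| <= 7 * r ^+ 3.
  apply: le_trans (ler_normB _ _) _; rewrite normrX !normrM (ger0_norm yy0) (ger0_norm (ler0n R 4)).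
  have h1 : dot y y ^+ 2 <= r ^+ 3.
    apply: (@le_trans _ _ ((r ^+ 2) ^+ 2)); first by rewrite lerXn2r ?nnegrE// exprn_ge0.
    by rewrite -exprM [leLHS]exprS ler_piMl//; lra.
  have h2 : `|dot z y| * dot y y <= 3 / 2 * r ^+ 3.
    by rewrite [r ^+ 3]exprS mulrA ler_pM.
  rewrite -mulrA.
  by move: h1 h2; set u := _ ^+ 2; set w := `|_| * _; clear -r3; lra.
have D : `|3 * Num.max a 0 * (dot y y ^+ 2 - 4 * dot z y * dot y y)| <= 21 * r ^+ 3.
  move: a1 => /andP[a10 a11].
  rewrite normrM normrM (ger0_norm a10) (ger0_norm (ler0n R 3)).
  apply: (@le_trans _ _ (3 * 1 * (7 * r ^+ 3))); last by clear -r3; lra.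
  by rewrite ler_pM// ?mulr_ge0// ler_pM2l.
by apply: (@le_trans _ _ (64 * r ^+ 3 + 21 * r ^+ 3)); [rewrite lerD// (le_trans T)|clear -r3; lra].
Qed.

Lemma Rintegral_subsupport (D E : set 'rV[R]_n) f : D `<=` E ->
  (forall y, ~ D y -> f y = 0) -> \int[mu]_(y in E) f y = \int[mu]_(y in D) f y.
Proof.
move=> DE f0; rewrite Rintegral_mkcond [RHS]Rintegral_mkcond; apply: eq_Rintegral => y _.
rewrite !patchE; case: ifPn => [Ey|/negP Ey]; case: ifPn => [Dy|/negP Dy] //.
  by rewrite f0// => Dy'; apply: Dy; rewrite inE.
by exfalso; apply: Ey; rewrite inE; apply: DE; exact/set_mem.
Qed.

Lemma fine_eballE x (r : R) : 0 < r ->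
  fine (mu (eball x r)) = r ^+ n * volB1.
Proof.
move=> r0; rewrite (lebesgue_rV_affine x r0 (@measurable_eball _ _ _ _)).
have -> : affine x r @^-1` eball x r = B1.
  have := @affine_eball R n x 0 r 1 r0.
  by rewrite /affine scaler0 addr0 mulr1.
by rewrite -EFin_eball -EFinM.
Qed.

Lemma bump3_mass_gt0 : 0 < \int[mu]_(z in B1) @bump R n 3 z.
Proof.
have oT : open [set: 'rV[R]_n] by exact: openT.
have Cb : Ck 0 setT (@bump R n 3) by exact: Ck0_bump.
apply: (@lt_le_trans _ _ (\int[mu]_(z in eball 0 (1 / 2)) @bump R n 3 z)).
  apply: (@lt_le_trans _ _ (\int[mu]_(z in eball (0 : 'rV[R]_n) (1 / 2)) (1 / 2) ^+ 3)).
    rewrite Rintegral_cst; last exact: measurable_eball.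
    by rewrite mulr_gt0 ?exprn_gt0// fine_eball_gt0.
  apply: (@le_Rintegral_Ck R n setT 0 (1 / 2) (cst ((1 / 2) ^+ 3)) _ (@subsetT _ _)).
  - exact: Ck_cst.
  - exact: Cb.
  - move=> y; rewrite eball0E => y1; rewrite lerXn2r ?nnegrE//.
      by rewrite le_max lexx orbT.
    rewrite le_max -sqr_enorm; apply/orP; left.
    have := enorm_ge0 y; nra.
apply: (@Rintegral_subset_Ck R n setT 0 0 (1 / 2) 1 _ (@subsetT _ _) Cb).
  by move=> y; rewrite !eball0E; lra.
by move=> y _; exact: bump_ge0.
Qed.

(** Moving y onto the kernel means that the expansion in y differentiates q^3 only, and the error
    involves no derivative of v. B_(3/2) contains every unit ball centred within 1/2 of the
    origin. *)
Lemma dilavg1_translate v y : Ck 0 U2 v -> enorm y < 1 / 2 ->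
  dilavg 3 v y 1 = \int[mu]_(z in B32) (bump 3 (z - y) * v z).
Proof.
move=> Cv y1.
have mf : measurable_fun B32 (fun z => bump 3 (z - y) * v z).
  apply: measurable_funM.
    rewrite (_ : (fun z => _) = bump 3 \o affine (- y) 1); last first.
      by apply/funext => z; rewrite /affine /= scale1r addrC.
    apply: measurable_funTS; apply: measurableT_comp; last exact: measurable_affine.
    by apply: (Ck_measurable (Ck0_bump 3 setT)) => //; exact: openT.
  apply: (Ck_measurable Cv); first exact: open_eball.
  by move=> z; rewrite !eball0E; lra.
rewrite (integral_translate y (@measurable_eball _ _ _ _) mf) /dilavg.
rewrite -(@Rintegral_subsupport B1 (affine y 1 @^-1` B32)).
- by apply: eq_Rintegral => z _; rewrite {2}/affine scale1r addrC addKr.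
- move=> z; rewrite /= !eball0E /affine scale1r => z1.
  by apply: le_lt_trans (enormD _ _) _; lra.
- by move=> z z1; rewrite bump_out// mul0r.
Qed.

(** The coefficients are moments of v against the kernel's expansion. The diagonal of A is recorded
    because its trace must be compared with g. *)
Lemma quadratic_moments v : Ck 0 U2 v -> exists c b A,
  (forall y, quad c b A y = \int[mu]_(z in B32) (bump3_taylor z y * v z)) /\
  forall i, A i i = 12 * \int[mu]_(z in B1) (z 0 i * (bump 1 z * (z 0 i * v z)))
     - 3 * \int[mu]_(z in B1) (bump 2 z * v z).
Proof.
move=> Cv.
have oU : open U2 by exact: open_eball.
have BU : cball (0 : 'rV[R]_n) (3 / 2) `<=` U2 by apply: sub_U2; lra.
have BU1 : cball (0 : 'rV[R]_n) 1 `<=` U2 by apply: sub_U2; lra.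
have B132 : B1 `<=` B32 by move=> z; rewrite !eball0E; lra.
pose bi i z : R := 6 * (bump 2 z * (z 0 i * v z)).
(* The Kronecker term carries the contribution -3 q^2 |y|^2 of the expansion. *)
pose Aij i j z : R := 12 * (z 0 i * (bump 1 z * (z 0 j * v z))) - (i == j)%:R * (3 * (bump 2 z * v z)).
have Cb i : Ck 0 U2 (bi i) by rewrite /bi; solve_Ck oU.
have CA i j : Ck 0 U2 (Aij i j) by rewrite /Aij; solve_Ck oU.
exists (\int[mu]_(z in B32) (bump 3 z * v z)), (fun i => \int[mu]_(z in B32) bi i z),
  (fun i j => \int[mu]_(z in B32) Aij i j z); split.
- move=> y; rewrite /quad.
  transitivity (\int[mu]_(z in B32) (bump 3 z * v z + \sum_(i < n) y 0 i * bi i z +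
      \sum_(i < n) \sum_(j < n) (y 0 i * y 0 j) * Aij i j z)).
    have C1 : Ck 0 U2 (fun z => bump 3 z * v z) by solve_Ck oU.
    have C2 : Ck 0 U2 (fun z => \sum_(i < n) y 0 i * bi i z).
      by apply: Ck_sum => // i; apply: CkZ.
    have C3i i : Ck 0 U2 (fun z => \sum_(j < n) (y 0 i * y 0 j) * Aij i j z).
      by apply: Ck_sum => // j; apply: CkZ.
    have C3 : Ck 0 U2 (fun z => \sum_(i < n) \sum_(j < n) (y 0 i * y 0 j) * Aij i j z).
      by apply: Ck_sum.
    rewrite (RintegralD_Ck BU _ C3); last by apply: CkD.
    rewrite (RintegralD_Ck BU C1 C2); congr (_ + _ + _).
      rewrite (Rintegral_sum_Ck _ oU BU); last by move=> i; apply: CkZ.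
      by apply: eq_bigr => i _; rewrite (RintegralZ_Ck _ BU)// mulrC.
    rewrite (Rintegral_sum_Ck _ oU BU)//; apply: eq_bigr => i _.
    rewrite (Rintegral_sum_Ck _ oU BU); last by move=> j; apply: CkZ.
    by apply: eq_bigr => j _; rewrite (RintegralZ_Ck _ BU)// mulrC.
  apply: eq_Rintegral => z _; rewrite /bump3_taylor.
  have -> : \sum_(i < n) y 0 i * bi i z = 6 * bump 2 z * dot z y * v z.
    rewrite /dot mulr_sumr mulr_suml; apply: eq_bigr => i _; rewrite /bi; ring.
  have -> : \sum_(i < n) \sum_(j < n) y 0 i * y 0 j * Aij i j z =
      12 * bump 1 z * dot z y ^+ 2 * v z - 3 * bump 2 z * dot y y * v z.
    transitivity (\sum_(i < n) (12 * bump 1 z * v z * (z 0 i * y 0 i) * dot z y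
        - 3 * bump 2 z * v z * (y 0 i * y 0 i))).
      apply: eq_bigr => i _; rewrite /Aij.
      transitivity (\sum_(j < n) (12 * bump 1 z * v z * (z 0 i * y 0 i) * (z 0 j * y 0 j)
        - 3 * bump 2 z * v z * (y 0 i * y 0 j) * (i == j)%:R)).
        by apply: eq_bigr => j _; ring.
      rewrite sumrB -mulr_sumr; congr (_ - _).
      rewrite (bigD1 i)//= big1 ?addr0 => [|j ji]; first by rewrite eqxx mulr1.
      by rewrite eq_sym (negbTE ji) mulr0.
    rewrite sumrB -mulr_suml -!mulr_sumr /dot; ring.
  by ring.
- move=> i; rewrite -(RintegralZ_Ck _ BU1); last by solve_Ck oU.
  rewrite -(RintegralZ_Ck _ BU1); last by solve_Ck oU.
  rewrite -(RintegralB_Ck BU1); [|by solve_Ck oU..].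
  rewrite (Rintegral_subsupport B132); last first.
    by move=> z z1; rewrite /Aij !bump_out// !(mul0r, mulr0) subr0.
  by apply: eq_Rintegral => z _; rewrite /Aij eqxx mul1r.
Qed.

(** Two integrations by parts move the Laplacian onto q^3, whose Laplacian is 24 q |z|^2 - 6 n q^2.
    With [quadratic_moments], the Laplacian of the moment polynomial is thus controlled by g
    alone. *)
Lemma laplacian_moment v g : Ck 4 U2 v -> (forall y, U2 y -> laplacian v y = g y) ->
  \int[mu]_(z in B1) (bump 3 z * g z) =
  2 * \sum_(i < n) (12 * \int[mu]_(z in B1) (z 0 i * (bump 1 z * (z 0 i * v z)))
     - 3 * \int[mu]_(z in B1) (bump 2 z * v z)).
Proof.
move=> Cv Lv.
have oU : open U2 by exact: open_eball.
have BU1 : cball (0 : 'rV[R]_n) 1 `<=` U2 by apply: sub_U2; lra.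
have Cv0 : Ck 0 U2 v by exact: Ck_le Cv.
have Cv1 i : Ck 0 U2 (partial i v) by exact: Ck_le (Ck_partial i Cv).
have Cv2 i : Ck 0 U2 (partial i (partial i v)) by exact: Ck_le (Ck_partial i (Ck_partial i Cv)).
transitivity (\int[mu]_(z in B1) \sum_(i < n) bump 3 z * partial i (partial i v) z).
  apply: eq_Rintegral => z /set_mem z1; rewrite -mulr_sumr -Lv//.
  by apply: BU1; exact: eball_cball z1.
rewrite (Rintegral_sum_Ck _ oU BU1); last by solve_Ck oU.
rewrite mulr_sumr; apply: eq_bigr => i _.
have -> := @integral_bump_partial R n 1 i _ _ oU BU1 (Ck_le (_ : (1 <= 3)%N) (Ck_partial i Cv)).
  have Cx : Ck 1 U2 (fun z => z 0 i * v z).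
    by apply: CkM => //; [exact: Ck_coord|exact: Ck_le Cv].
  have := @integral_bump_partial R n 0 i _ _ oU BU1 Cx.
  rewrite -!natrM => E.
  have {E} : \int[mu]_(z in B1) (z 0 i * (bump 2 z * partial i v z)) +
      \int[mu]_(z in B1) (bump 2 z * v z) =
      4 * \int[mu]_(z in B1) (z 0 i * (bump 1 z * (z 0 i * v z))).
    rewrite -E -(RintegralD_Ck BU1); [|by solve_Ck oU..].
    apply: eq_Rintegral => z /set_mem /(eball_cball (lexx 1)) /BU1 z1.
    rewrite partialM; [|exact: (Ck_derivable (Ck_coord 1 U2 i)) z1|exact: (Ck_derivable Cv) z1].
    have -> : partial i (fun y : 'rV[R]_n => y 0 i) z = 1 by rewrite partial_coord eqxx.
    by ring.
  by lra.
by [].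
Qed.

Lemma add_error_terms (x m s d p q a b : R) :
  x <= p * a -> s * d <= p * a -> m * d = q * b -> 0 <= p * b -> 0 <= q * a ->
  x + (m + s) * d <= (2 * p + q) * (a + b).
Proof. by move=> h1 h2 h3 h4 h5; rewrite mulrDl h3; lra. Qed.

(** Trace zero matters as much as closeness: subtracting a harmonic polynomial leaves the equation
    for v unchanged, so the step can be repeated. *)
Lemma quadratic_approximation : (0 < n)%N -> exists2 C0 : R, 0 < C0 &
  forall v g, Ck 4 U2 v -> Ck 1 U2 g -> (forall y, U2 y -> laplacian v y = g y) ->
  forall r : R, 0 < r <= 1 / 2 -> exists c b A, \sum_(i < n) A i i = 0 /\
    \int[mu]_(y in eball 0 r) ((v y - quad c b A y) ^+ 2) <=
    C0 * (\int[mu]_(y in B32) (g y * g y) + r ^+ (n + 6) * \int[mu]_(y in B32) (v y * v y)).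
Proof.
move=> n0; set c3 := \int[mu]_(z in B1) @bump R n 3 z.
have c30 : 0 < c3 by exact: bump3_mass_gt0.
have V0 : 0 < volB1 by exact: fine_eball_gt0.
have W0 : 0 < fine (mu B32) by exact: fine_eball_gt0.
(* The 3 comes from squaring a sum of three errors. |B_1|^2 occurs twice, for the increment in t and
   for the trace correction; the last summand is the Taylor error. *)
exists (3 / c3 ^+ 2 * (2 * volB1 ^+ 2 + volB1 * fine (mu B32) * 100 ^+ 2)).
  by rewrite mulr_gt0 ?divr_gt0 ?exprn_gt0// addr_gt0// !mulr_gt0// exprn_gt0.
move=> v g Cv Cg Lv r /andP[r0 r1].
have oU : open U2 by exact: open_eball.
have BU : cball (0 : 'rV[R]_n) (3 / 2) `<=` U2 by apply: sub_U2; lra.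
have BU1 : cball (0 : 'rV[R]_n) 1 `<=` U2 by apply: sub_U2; lra.
have rU : cball (0 : 'rV[R]_n) r `<=` U2 by apply: sub_U2; lra.
have Cv0 : Ck 0 U2 v by exact: Ck_le Cv.
have Cg0 : Ck 0 U2 g by exact: Ck_le Cg.
have B132 : B1 `<=` B32 by move=> z; rewrite !eball0E; lra.
have [c [b [A [PE AE]]]] := quadratic_moments Cv0.
pose S := \int[mu]_(z in B1) (bump 3 z * g z).
have SE : S = 2 * \sum_(i < n) A i i.
  by rewrite /S (laplacian_moment Cv Lv); congr (_ * _); apply: eq_bigr => i _; rewrite AE.
pose G := \int[mu]_(y in B32) (g y * g y).
pose W := \int[mu]_(y in B32) (v y * v y).
have G0 : 0 <= G by apply: Rintegral_ge0 => y _; rewrite -expr2 sqr_ge0.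
have W0' : 0 <= W by apply: Rintegral_ge0 => y _; rewrite -expr2 sqr_ge0.
have S2 : S ^+ 2 <= volB1 * G.
  have Cb : Ck 0 U2 (fun z => bump 3 z * g z) by apply: CkM => //; exact: Ck0_bump.
  apply: le_trans (sqr_Rintegral_eball_le ltr01 BU1 oU Cb) _.
  rewrite ler_pM2l//; apply: (@le_trans _ _ (\int[mu]_(y in B1) (g y * g y))).
    apply: (le_Rintegral_Ck BU1) => [||y _]; [by apply: CkM|by apply: CkM|].
    rewrite mulrACA ler_piMl -?expr2 ?sqr_ge0//.
    by rewrite expr_le1 ?bump_ge0 ?bump_le1.
  apply: (Rintegral_subset_Ck BU) => //; first by apply: CkM.
  by move=> y _; rewrite -expr2 sqr_ge0.
pose nn : R := n%:R.
have nn1 : 1 <= nn by rewrite ler1n.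
have nn0 : 0 < nn by lra.
(* By [SE] the trace of A / c3 is S / (2 c3); removing an n-th of it from each diagonal entry makes
   the polynomial harmonic, at a cost proportional to S. *)
pose A' i j := A i j / c3 - (i == j)%:R * (S / (2 * nn * c3)).
have QE y : quad (c / c3) (fun i => b i / c3) A' y =
    quad c b A y / c3 - S / (2 * nn * c3) * dot y y.
  have E1 : \sum_(i < n) b i / c3 * y 0 i = (\sum_(i < n) b i * y 0 i) / c3.
    by rewrite mulr_suml; apply: eq_bigr => i _; rewrite mulrAC.
  have E2 : \sum_(i < n) \sum_(j < n) A' i j * (y 0 i * y 0 j) =
      (\sum_(i < n) \sum_(j < n) A i j * (y 0 i * y 0 j)) / c3 - S / (2 * nn * c3) * dot y y.
    rewrite /dot mulr_sumr mulr_suml -sumrB; apply: eq_bigr => i _; rewrite mulr_suml.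
    transitivity (\sum_(j < n) (A i j * (y 0 i * y 0 j) / c3
       - S / (2 * nn * c3) * (y 0 i * y 0 j) * (i == j)%:R)).
      by apply: eq_bigr => j _; rewrite /A'; ring.
    rewrite sumrB; congr (_ - _).
    rewrite (bigD1 i)//= big1 ?addr0 => [|j ji]; first by rewrite eqxx mulr1.
    by rewrite eq_sym (negbTE ji) mulr0.
  by rewrite /quad E1 E2; ring.
exists (c / c3), (fun i => b i / c3), A'; split.
  rewrite /A' sumrB -mulr_suml -mulr_suml.
  have -> : \sum_(i < n) (i == i)%:R = nn :> R.
    by rewrite (eq_bigr (fun=> 1)) => [|i _]; rewrite ?eqxx// sumr_const card_ord.
  rewrite SE; field.
  by rewrite !gt_eqF.
pose D := eball (0 : 'rV[R]_n) r.
have mD : measurable D by exact: measurable_eball.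
pose chi y := dilavg 3 v y 1 - dilavg 3 v y 0.
have y12 y : D y -> enorm y < 1 / 2 by rewrite /D eball0E => /lt_le_trans; exact.
have t0 : `|0 : R| < 6 / 5 by apply: norm_lt65; rewrite lexx ler01.
have t1 : `|1 : R| < 6 / 5 by apply: norm_lt65; rewrite lexx ler01.
have [M M0 HM] := Ck_bounded Cv0 (@cball17_sub R n).
have mchi : measurable_fun D chi by apply: measurable_funB; exact: measurable_dilavg.
have ichi : mu.-integrable D (EFin \o (fun y => chi y ^+ 2)).
  apply: measurable_bounded_integrable => //; first exact: lebesgue_eball_lty.
    exact: measurable_funX.
  exists ((M * volB1 + M * volB1) ^+ 2); split; first exact: num_real.
  move=> s Ks y /y12 y1; apply: le_trans (ltW Ks).
  rewrite /= normrX lerXn2r ?nnegrE ?addr_ge0 ?mulr_ge0 ?(ltW V0)//.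
  by apply: le_trans (ler_normB _ _) _; apply: lerD; exact: le_dilavg.
(* Pointwise Taylor error by Cauchy-Schwarz in z. Its r^6 meets the volume r^n of D to give
   r^(n+6). *)
pose Km := fine (mu B32) * ((100 * r ^+ 3) ^+ 2 * W).
have HKm y : D y -> (dilavg 3 v y 1 - quad c b A y) ^+ 2 <= Km.
  move=> Dy; have y1 := y12 y Dy.
  have Cby : Ck 0 U2 (fun z => bump 3 (z - y)).
    apply: (@eq_Ck _ _ 0 U2 (bump 3 \o affine (- y) 1)) => // [z _|].
      by rewrite /= /affine scale1r addrC.
    by apply: (@Ck_affine _ _ 0 setT U2) => //; exact: Ck0_bump.
  have Cty : Ck 0 U2 (fun z => bump3_taylor z y).
    have Cd : Ck 0 U2 (fun z => dot z y).
      by rewrite /dot; apply: Ck_sum => // i; apply: CkM; [exact: oU|exact: Ck_coord|exact: Ck_cst].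
    have Cc (a : R) : Ck 0 U2 (fun=> a) by exact: Ck_cst.
    have Cb k : Ck 0 U2 (@bump R n k) by exact: Ck0_bump.
    apply: CkD => //; first apply: CkD => //.
      by apply: CkM => //; [apply: CkM|apply: CkB => //; apply: CkM].
    by apply: CkM => //; [apply: CkM|apply: CkM].
  have Cw : Ck 0 U2 (fun z => (bump 3 (z - y) - bump3_taylor z y) * v z).
    by apply: CkM => //; apply: CkB.
  rewrite dilavg1_translate// PE -(RintegralB_Ck BU); [|by apply: CkM..].
  rewrite (_ : \int[mu]_(z in B32) _ = \int[mu]_(z in B32) ((bump 3 (z - y) - bump3_taylor z y) * v z)).
    apply: le_trans (sqr_Rintegral_eball_le _ BU oU Cw) _; first by lra.
    rewrite /Km ler_pM2l// /W -(RintegralZ_Ck _ BU); last by apply: CkM.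
    apply: (le_Rintegral_Ck BU) => [||z]; [by apply: CkM|by apply: CkZ => //; apply: CkM|].
    rewrite eball0E => z1; rewrite mulrACA -[v z * v z]expr2 ler_wpM2r ?sqr_ge0//.
    rewrite -expr2 -real_normK ?num_real// lerXn2r ?nnegrE ?mulr_ge0 ?exprn_ge0 ?(ltW r0)//.
    apply: bump3_taylorP => //; first exact: ltW.
    by move: Dy; rewrite /D eball0E => /ltW.
  by apply: eq_Rintegral => z _; rewrite mulrBl.
have m0 y : dilavg 3 v y 0 = c3 * v y.
  rewrite /dilavg /c3 mulrC -(RintegralZ_Ck _ BU1); last exact: Ck0_bump.
  by apply: eq_Rintegral => z _; rewrite /affine scale0r addr0 mulrC.
have ptw y : D y -> (v y - quad (c / c3) (fun i => b i / c3) A' y) ^+ 2 <=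
    3 / c3 ^+ 2 * chi y ^+ 2 + 3 / c3 ^+ 2 * (Km + S ^+ 2).
  move=> Dy; rewrite QE -mulrDr.
  have dy0 := dotxx_ge0 y.
  have dy1 : dot y y <= 1.
    have := y12 y Dy; have := enorm_ge0 y; rewrite -sqr_enorm; clear; nra.
  have := HKm y Dy; set a := dilavg 3 v y 1 - quad c b A y => ha.
  (* With tt <= 1 the difference becomes (a - chi + S tt) / c3: Taylor error, increment in t, and
     trace correction. *)
  pose tt := dot y y / (2 * nn).
  have tt0 : 0 <= tt by rewrite divr_ge0// mulr_ge0// ltW.
  have tt1 : tt <= 1 by rewrite ler_pdivrMr ?mulr_gt0// mul1r; lra.
  have -> : v y - (quad c b A y / c3 - S / (2 * nn * c3) * dot y y) = (a - chi y + S * tt) / c3.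
    by rewrite /a /chi m0 /tt; field; rewrite !gt_eqF.
  rewrite expr_div_n -[leRHS]mulrAC ler_pM2r ?invr_gt0 ?exprn_gt0//.
  have hS : (S * tt) ^+ 2 <= S ^+ 2.
    by rewrite exprMn ler_piMr ?sqr_ge0// expr_le1.
  have h1 : 0 <= (a + chi y) ^+ 2 by rewrite sqr_ge0.
  have h2 : 0 <= (a - S * tt) ^+ 2 by rewrite sqr_ge0.
  have h3 : 0 <= (chi y + S * tt) ^+ 2 by rewrite sqr_ge0.
  by move: h1 h2 h3 hS ha; set k := S * tt; set X := chi y; clear; nra.
have CQ : Ck 0 U2 (fun y => v y - quad (c / c3) (fun i => b i / c3) A' y).
  by apply: CkB => //; exact: Ck_quad.
apply: (@le_trans _ _ (\int[mu]_(y in D) (3 / c3 ^+ 2 * chi y ^+ 2 + 3 / c3 ^+ 2 * (Km + S ^+ 2)))).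
  apply: le_Rintegral => //.
  - by apply: (Ck_integrable _ rU); apply: CkM.
  - have i1 := integrableZl mD (3 / c3 ^+ 2) ichi.
    have i2 := Ck_integrable (Ck_cst 0 U2 (3 / c3 ^+ 2 * (Km + S ^+ 2))) rU.
    by have := integrableD mD i1 i2; congr integrable.
have i1 : mu.-integrable D (EFin \o (fun y => 3 / c3 ^+ 2 * chi y ^+ 2)).
  by have := integrableZl mD (3 / c3 ^+ 2) ichi.
rewrite RintegralD//; last exact: (Ck_integrable (Ck_cst 0 U2 _) rU).
rewrite RintegralZl// Rintegral_cst//.
have H := dilavg_increment_L2_le Cv Cg Lv r1.
rewrite -/D -/G -/chi in H.
have VD : fine (mu D) = r ^+ n * volB1 by exact: fine_eballE.
have VD1 : fine (mu D) <= volB1.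
  by rewrite VD ler_piMl ?(ltW V0)// exprn_ile1 ?(ltW r0)//; lra.
have VDg : 0 < fine (mu D) by exact: fine_eball_gt0.
have H2 : S ^+ 2 * fine (mu D) <= volB1 ^+ 2 * G.
  rewrite [volB1 ^+ 2]expr2 -mulrA [leRHS]mulrC.
  by apply: ler_pM => //; [exact: sqr_ge0|exact: ltW].
have H3 : Km * fine (mu D) = volB1 * fine (mu B32) * 100 ^+ 2 * (r ^+ (n + 6) * W).
  by rewrite VD /Km exprMn -exprM exprD; ring.
have rW : 0 <= r ^+ (n + 6) * W by rewrite mulr_ge0// exprn_ge0// ltW.
have X0 : 0 <= volB1 ^+ 2 * (r ^+ (n + 6) * W) by rewrite mulr_ge0// exprn_ge0// ltW.
have Y0 : 0 <= volB1 * fine (mu B32) * 100 ^+ 2 * G by rewrite !mulr_ge0// ltW.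
have F : \int[mu]_(y in D) chi y ^+ 2 + (Km + S ^+ 2) * fine (mu D) <=
   (2 * volB1 ^+ 2 + volB1 * fine (mu B32) * 100 ^+ 2) * (G + r ^+ (n + 6) * W).
  exact: add_error_terms H H2 H3 X0 Y0.
have K3 : 0 <= 3 / c3 ^+ 2 by rewrite divr_ge0// exprn_ge0// ltW.
by have := ler_wpM2l K3 F; rewrite mulrDr !mulrA.
Qed.

End quadratic_approximation.

(** * Rescaling of integrals, averages and derivatives *)

Section scaling.
Variables (R : realType) (n : nat).
Implicit Types (f u v w g h : 'rV[R]_n -> R) (U V : set 'rV[R]_n) (x y z : 'rV[R]_n).

Local Notation mu := (lebesgue_rV R n).
Local Notation vol r := (fine (mu (eball (0 : 'rV[R]_n) r))).

Lemma affine_cball_sub U x (s r r' : R) : 0 < s -> r' <= r -> cball x (s * r) `<=` U ->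
  cball 0 r' `<=` affine x s @^-1` U.
Proof.
move=> s0 rr sU z; rewrite cball0E => zr; apply: sU.
rewrite /cball /= /affine addrC addKr enormZ gtr0_norm// ler_pM2l//.
exact: le_trans rr.
Qed.

Lemma affine_eball0 x (s r : R) : 0 < s -> affine x s @^-1` eball x (s * r) = eball 0 r.
Proof.
by move=> s0; have := @affine_eball R n x 0 s r s0; rewrite /affine scaler0 addr0.
Qed.

Lemma open_preimage_affine U x (s : R) : open U -> open (affine x s @^-1` U).
Proof.
move=> oU; apply: open_comp => // y _.
by apply: continuousD; [exact: cst_continuous|exact: scaler_continuous].
Qed.

Lemma Ck_preimage_affine k U f x (s : R) : open U -> Ck k U f ->
  Ck k (affine x s @^-1` U) (f \o affine x s).
Proof. by move=> oU; apply: Ck_affine; [exact: open_preimage_affine|exact: subset_refl]. Qed.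

(** Proved for nonnegative functions first; the general case follows by adding a bound M of |f| and
    cancelling the integrals of M. *)
Lemma Rintegral_scale U f x (s r : R) : 0 < s -> open U -> cball x (s * r) `<=` U -> Ck 0 U f ->
  \int[mu]_(y in eball x (s * r)) f y = s ^+ n * \int[mu]_(z in eball 0 r) f (affine x s z).
Proof.
move=> s0 oU sU Cf.
have oV : open (affine x s @^-1` U) by exact: open_preimage_affine.
have rV : cball 0 r `<=` affine x s @^-1` U by exact: affine_cball_sub sU.
have ge0 h : Ck 0 U h -> (forall y, eball x (s * r) y -> 0 <= h y) ->
    \int[mu]_(y in eball x (s * r)) h y = s ^+ n * \int[mu]_(z in eball 0 r) h (affine x s z).
  move=> Ch h0; rewrite /Rintegral (ge0_integral_affine x s0); first last.
  - by move=> y /h0; rewrite lee_fin.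
  - apply/measurable_EFinP; apply: Ck_measurable Ch _ _; first exact: open_eball.
    by move=> y /(eball_cball (lexx _)) /sU.
  - exact: measurable_eball.
  have Cha := Ck_preimage_affine x s oU Ch.
  rewrite affine_eball0// fineM//.
  by apply: integrable_fin_num; [exact: measurable_eball|exact: Ck_integrable Cha rV].
have [M M0 HM] := Ck_bounded Cf sU.
have CM : Ck 0 U (fun=> M) by exact: Ck_cst.
have CfM : Ck 0 U (fun y => f y + M) by exact: CkD.
have := ge0 _ CfM; rewrite (RintegralD_Ck sU Cf CM) => H.
have := H; rewrite (RintegralD_Ck rV (Ck_preimage_affine x s oU Cf) (Ck_cst 0 _ M)).
rewrite (ge0 _ CM) => [|y _ //]; rewrite mulrDr => /(_ _)/addIr; apply.
by move=> y /(eball_cball (lexx _)) /HM; rewrite ler_norml => /andP[+ _]; lra.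
Qed.

Lemma fine_eball_scale x (s r : R) : 0 < s -> fine (mu (eball x (s * r))) = s ^+ n * vol r.
Proof.
move=> s0; rewrite (lebesgue_rV_affine x s0 (@measurable_eball _ _ _ _)) affine_eball0//.
by rewrite -EFin_eball -EFinM.
Qed.

Lemma inve_eball x (r : R) : 0 < r ->
  ((mu (eball x r))^-1 = (fine (mu (eball x r)))^-1%:E)%E.
Proof. by move=> r0; rewrite -EFin_eball inver gt_eqF// fine_eball_gt0. Qed.

Lemma eaverage_EFin U x (r : R) f : 0 < r -> cball x r `<=` U -> Ck 0 U f ->
  eaverage (eball x r) (EFin \o f) =
  ((fine (mu (eball x r)))^-1 * \int[mu]_(y in eball x r) f y)%:E.
Proof.
move=> r0 rU Cf; rewrite /eaverage inve_eball// EFinM; congr (_ * _)%E.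
by rewrite fineK//; apply: integrable_fin_num; [exact: measurable_eball|exact: Ck_integrable Cf rU].
Qed.

Lemma averageE U x (r : R) f : 0 < r -> cball x r `<=` U -> Ck 0 U f ->
  average (eball x r) f = (fine (mu (eball x r)))^-1 * \int[mu]_(y in eball x r) f y.
Proof. by move=> r0 rU Cf; rewrite /average (eaverage_EFin r0 rU Cf). Qed.

Lemma average_scale U x (s r : R) f : 0 < s -> 0 < r -> open U -> cball x (s * r) `<=` U ->
  Ck 0 U f -> average (eball x (s * r)) f = average (eball 0 r) (f \o affine x s).
Proof.
move=> s0 r0 oU sU Cf; have sr0 : 0 < s * r by exact: mulr_gt0.
have Ca := Ck_preimage_affine x s oU Cf.
rewrite (averageE sr0 sU Cf) (averageE r0 (affine_cball_sub s0 (lexx r) sU) Ca).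
rewrite (Rintegral_scale s0 oU sU Cf) fine_eball_scale// invfM.
by rewrite mulrACA mulVf ?mul1r// gt_eqF// exprn_gt0.
Qed.

(** The mean minimizes the quadratic deviation: the two sides differ by V (c - a)^2. This is what
    lets any constant matrix replace the average Hessian. *)
Lemma variance_le U x (r c : R) f : 0 < r -> open U -> cball x r `<=` U -> Ck 0 U f ->
  \int[mu]_(y in eball x r) ((f y - average (eball x r) f) * (f y - average (eball x r) f)) <=
  \int[mu]_(y in eball x r) ((f y - c) * (f y - c)).
Proof.
move=> r0 oU rU Cf; rewrite (averageE r0 rU Cf).
set V := fine _; set A := \int[mu]_(y in _) f y; set a := V^-1 * A.
have V0 : 0 < V by exact: fine_eball_gt0.
have Cc (k : R) : Ck 0 U (fun=> k) by exact: Ck_cst.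
have E (k : R) : \int[mu]_(y in eball x r) ((f y - k) * (f y - k)) =
    \int[mu]_(y in eball x r) (f y * f y) - 2 * k * A + k ^+ 2 * V.
  rewrite -Rintegral_cst; last exact: measurable_eball.
  rewrite -(RintegralZ_Ck _ rU Cf) -(RintegralB_Ck rU); [|by solve_Ck oU..].
  rewrite -(RintegralD_Ck rU); [|by solve_Ck oU..].
  by apply: eq_Rintegral => y _; ring.
rewrite !E -subr_ge0 [X in 0 <= X](_ : _ = V * (c - a) ^+ 2).
  by rewrite mulr_ge0 ?sqr_ge0// ltW.
by rewrite /a; field; rewrite gt_eqF.
Qed.

(** Cauchy-Schwarz for f - c; it prices the change from one reference constant to the average at
    another scale. *)
Lemma sqr_average_le U x (r c : R) f : 0 < r -> open U -> cball x r `<=` U -> Ck 0 U f ->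
  fine (mu (eball x r)) * (average (eball x r) f - c) ^+ 2 <=
  \int[mu]_(y in eball x r) ((f y - c) * (f y - c)).
Proof.
move=> r0 oU rU Cf; rewrite (averageE r0 rU Cf).
set V := fine _; set A := \int[mu]_(y in _) f y.
have V0 : 0 < V by exact: fine_eball_gt0.
have Cc (k : R) : Ck 0 U (fun=> k) by exact: Ck_cst.
have Cfc : Ck 0 U (fun y => f y - c) by exact: CkB.
have := sqr_Rintegral_eball_le r0 rU oU Cfc.
rewrite (RintegralB_Ck rU Cf (Cc c)) Rintegral_cst; last exact: measurable_eball.
rewrite -/V -/A => H; rewrite -(ler_pM2l V0); apply: le_trans H.
by rewrite [X in X <= _](_ : _ = (A - c * V) ^+ 2)//; field; rewrite gt_eqF.
Qed.

Lemma partial_affine U u x (s : R) z i : Ck 1 U u -> U (affine x s z) ->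
  partial i (u \o affine x s) z = s * partial i u (affine x s z).
Proof.
move=> Cu Uz; by have [_ ] := is_derive_affine (Ck_derivable (i:=i) Cu Uz).
Qed.

Lemma partial2_affine U u x (s : R) z i j : open U -> Ck 2 U u -> U (affine x s z) ->
  partial j (partial i (u \o affine x s)) z = s ^+ 2 * partial j (partial i u) (affine x s z).
Proof.
move=> oU Cu Uz.
have oV : open (affine x s @^-1` U) by exact: open_preimage_affine.
rewrite (@eq_partial _ _ _ z _ (fun z => s * (partial i u \o affine x s) z) j oV Uz); last first.
  by move=> y Uy; rewrite (partial_affine _ (CkS Cu) Uy).
have Cp : Ck 1 U (partial i u) by exact: Ck_partial.
rewrite partialZ; last first.
  by have [] := is_derive_affine (Ck_derivable (i:=j) Cp Uz).
by rewrite (partial_affine _ Cp Uz) mulrA expr2.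
Qed.

Lemma partial2Z U v (c : R) z i j : open U -> Ck 2 U v -> U z ->
  partial j (partial i (fun y => c * v y)) z = c * partial j (partial i v) z.
Proof.
move=> oU Cv Uz.
rewrite (@eq_partial _ _ U z _ (fun z => c * partial i v z) j oU Uz); last first.
  by move=> y Uy; rewrite partialZ//; exact: (Ck_derivable Cv).
by rewrite partialZ//; exact: (Ck_derivable (Ck_partial i Cv)).
Qed.

Lemma partial2B U v w z i j : open U -> Ck 2 U v -> Ck 2 U w -> U z ->
  partial j (partial i (fun y => v y - w y)) z =
  partial j (partial i v) z - partial j (partial i w) z.
Proof.
move=> oU Cv Cw Uz.
rewrite (@eq_partial _ _ U z _ (fun z => partial i v z - partial i w z) j oU Uz); last first.
  by move=> y Uy; rewrite partialB//; [exact: (Ck_derivable Cv)|exact: (Ck_derivable Cw)].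
by rewrite partialB//; [exact: (Ck_derivable (Ck_partial i Cv))|exact: (Ck_derivable (Ck_partial i Cw))].
Qed.

Lemma Rintegral_sqr_ge0 x (r : R) f : 0 <= \int[mu]_(y in eball x r) (f y * f y).
Proof. by apply: Rintegral_ge0 => y _; rewrite -expr2 sqr_ge0. Qed.

End scaling.

(** * One step of the Campanato iteration *)

Section campanato.
Variables (R : realType) (n : nat).
Implicit Types (f u v w g h : 'rV[R]_n -> R) (U V : set 'rV[R]_n) (x y z : 'rV[R]_n).

Local Notation mu := (lebesgue_rV R n).
Local Notation B32 := (eball (0 : 'rV[R]_n) (3 / 2)).
Local Notation U1 := (eball (0 : 'rV[R]_n) 1).
Local Notation U2 := (eball (0 : 'rV[R]_n) 2).
Local Notation vol r := (fine (mu (eball (0 : 'rV[R]_n) r))).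

(* At scale s around x, u differs from s^2 v((y - x) / s) by a quadratic
   polynomial whose Laplacian is the average of f. *)
Definition quad_approx u f x (s K : R) : Prop :=
  exists v (H : 'I_n -> 'I_n -> R), [/\ Ck 4 U2 v,
    forall i j z, U2 z ->
      partial j (partial i v) z = partial j (partial i u) (affine x s z) - H i j,
    forall z, U2 z -> laplacian v z = f (affine x s z) - average (eball x (s * (3 / 2))) f &
    \int[mu]_(z in B32) (v z * v z) <= K].

Lemma quad_approxW u f x (s K K' : R) : K <= K' -> quad_approx u f x s K -> quad_approx u f x s K'.
Proof. by move=> KK [v [H [Cv Hv Lv vK]]]; exists v, H; split => //; exact: le_trans KK. Qed.

Lemma cball32_U2 : cball (0 : 'rV[R]_n) (3 / 2) `<=` U2.
Proof. by apply: sub_U2; lra. Qed.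

(** The constant c in the equation, 0 at the first scale and the previous average later, is replaced
    by the current average by subtracting (a - c) |z|^2 / (2n) from w. *)
Lemma quad_approx_normalize u f x (s c : R) w (H : 'I_n -> 'I_n -> R) :
  (0 < n)%N -> 0 < s -> U2 `<=` affine x s @^-1` U1 -> cball x (s * (3 / 2)) `<=` U1 ->
  Ck 1 U1 f -> Ck 4 U2 w ->
  (forall i j z, U2 z ->
     partial j (partial i w) z = partial j (partial i u) (affine x s z) - H i j) ->
  (forall z, U2 z -> laplacian w z = f (affine x s z) - c) ->
  quad_approx u f x s (2 * \int[mu]_(z in B32) (w z * w z)
    + 3 * \int[mu]_(z in B32) ((f (affine x s z) - c) * (f (affine x s z) - c))).
Proof.
move=> n0 s0 sU sx Cf Cw Hw Lw.
have oU : open U2 by exact: open_eball.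
have oU1 : open U1 by exact: open_eball.
have Cf0 : Ck 0 U1 f by exact: CkS.
have Cw0 : Ck 0 U2 w by exact: Ck_le Cw.
have BU := cball32_U2.
have Cfa : Ck 0 U2 (f \o affine x s) by exact: Ck_affine sU Cf0.
set a := average (eball x (s * (3 / 2))) f.
have aE : a = average B32 (f \o affine x s) by apply: average_scale sx Cf0 => //; lra.
pose nn : R := n%:R.
have nn1 : 1 <= nn by rewrite ler1n.
have nn0 : 0 < nn by lra.
pose d := (a - c) / (2 * nn).
pose A (i j : 'I_n) : R := (i == j)%:R * d.
pose q := quad 0 (fun=> 0) A.
have Cq k : Ck k U2 q by exact: Ck_quad.
exists (fun z => w z - q z), (fun i j => H i j + (A i j + A j i)); split.
- by apply: CkB; [exact: oU|exact: Cw|exact: Cq].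
- move=> i j z Uz; rewrite (partial2B _ _ oU _ _ Uz); [|exact: Ck_le Cw|exact: Cq].
  by rewrite partial2_quad Hw// /cst [in RHS]opprD addrA.
- move=> z Uz; rewrite /laplacian.
  transitivity (laplacian w z - laplacian q z).
    rewrite /laplacian -sumrB; apply: eq_bigr => i _.
    by rewrite (partial2B _ _ oU _ _ Uz); [|exact: Ck_le Cw|exact: Cq].
  rewrite Lw// laplacian_quad /A -mulr_suml.
  have -> : \sum_(i < n) (i == i)%:R = nn :> R.
    by rewrite (eq_bigr (fun=> 1)) => [|i _]; rewrite ?eqxx// sumr_const card_ord.
  rewrite -/a (_ : 2 * (nn * d) = a - c); first by ring.
  by rewrite mulrA /d mulrC divfK// mulf_neq0// gt_eqF.
- have qE z : q z = d * dot z z.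
    rewrite /q /quad add0r big1 ?add0r => [|i _]; last by rewrite mul0r.
    rewrite /dot mulr_sumr; apply: eq_bigr => i _.
    rewrite (bigD1 i)//= big1 ?addr0 => [|j ji]; first by rewrite /A eqxx mul1r.
    by rewrite /A eq_sym (negbTE ji) !mul0r.
  (* On B_(3/2), |z|^4 <= 6, so the square of the correction is at most 6 (a - c)^2 / 4; doubling it
     in (w - q)^2 <= 2 w^2 + 2 q^2 gives the factor 3. *)
  have dd : d ^+ 2 <= (a - c) ^+ 2 / 4.
    rewrite /d expr_div_n ler_wpM2l ?sqr_ge0// lef_pV2 ?posrE ?exprn_gt0 ?mulr_gt0//.
    by rewrite exprMn; have : 1 <= nn ^+ 2 by [rewrite exprn_ege1]; lra.
  have h : vol (3 / 2) * (a - c) ^+ 2 <=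
      \int[mu]_(z in B32) ((f (affine x s z) - c) * (f (affine x s z) - c)).
    by rewrite aE; apply: (@sqr_average_le R n U2) => //; lra.
  apply: (@le_trans _ _ (\int[mu]_(z in B32) (2 * (w z * w z) + 3 * (a - c) ^+ 2))).
    have Cc : Ck 0 U2 (fun=> 3 * (a - c) ^+ 2) by exact: Ck_cst.
    have Cwq : Ck 0 U2 (fun z => w z - q z) by apply: CkB; [exact: oU|exact: Cw0|exact: Cq].
    apply: (le_Rintegral_Ck BU) => [||z]; [by apply: CkM; [exact: oU|exact: Cwq|exact: Cwq]|by solve_Ck oU|].
    rewrite eball0E => z32; rewrite qE.
    have t0 := dotxx_ge0 z.
    have t1 : dot z z <= 9 / 4.
      by rewrite -sqr_enorm; have := enorm_ge0 z; move: z32; clear; nra.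
    have t2 : dot z z ^+ 2 <= 6.
      by move: t0 t1; clear; nra.
    have t3 : (d * dot z z) ^+ 2 <= (a - c) ^+ 2 / 4 * 6.
      by rewrite exprMn ler_pM ?sqr_ge0.
    have : 0 <= (w z + d * dot z z) ^+ 2 by rewrite sqr_ge0.
    by move: t3; set X := d * _; set W := w z; clear; nra.
  have Cc : Ck 0 U2 (fun=> 3 * (a - c) ^+ 2) by exact: Ck_cst.
  rewrite (RintegralD_Ck BU); [|by solve_Ck oU|by []].
  rewrite (RintegralZ_Ck _ BU); last by apply: CkM.
  rewrite Rintegral_cst; last exact: measurable_eball.
  by rewrite lerD2l mulrAC -mulrA ler_pM2l.
Qed.

Lemma affine_affine x (s t : R) z : affine x s (affine 0 t z) = affine x (s * t) z.
Proof. by rewrite /affine add0r scalerA. Qed.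

(** Subtract the harmonic polynomial and rescale by th. The normalization th^-2 contributes th^-4 to
    the squared norm and the change of variables th^-n. The constant [C0] is a parameter since th
    must be chosen from it before iterating. *)
Lemma quad_approx_step u f x (s th C0 K M : R) :
  (0 < n)%N -> 0 < s -> 0 < th -> th <= 1 / 3 -> 0 < C0 ->
  (forall v g, Ck 4 U2 v -> Ck 1 U2 g -> (forall y, U2 y -> laplacian v y = g y) ->
  forall r : R, 0 < r <= 1 / 2 -> exists c b A, \sum_(i < n) A i i = 0 /\
    \int[mu]_(y in eball 0 r) ((v y - quad c b A y) ^+ 2) <=
    C0 * (\int[mu]_(y in B32) (g y * g y) + r ^+ (n + 6) * \int[mu]_(y in B32) (v y * v y))) ->
  U2 `<=` affine x s @^-1` U1 -> cball x (s * (3 / 2)) `<=` U1 ->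
  Ck 4 U1 u -> Ck 1 U1 f ->
  \int[mu]_(z in B32) ((f (affine x s z) - average (eball x (s * (3 / 2))) f) ^+ 2) <= M ->
  quad_approx u f x s K ->
  quad_approx u f x (s * th)
    (2 * (th ^- 4 * th ^- n * (C0 * (M + (th * (3 / 2)) ^+ (n + 6) * K))) + 3 * (th ^- n * M)).
Proof.
move=> n0 s0 th0 th3 C00 approx sU sx Cu Cf; set a := average _ f => fM [v [H [Cv Hv Lv vK]]].
have oU : open U2 by exact: open_eball.
have oU1 : open U1 by exact: open_eball.
have th1 : th != 0 by rewrite gt_eqF.
have Cf0 : Ck 0 U1 f by exact: CkS.
pose g z := f (affine x s z) - a.
have Cg : Ck 1 U2 g.
  apply: CkB => //; [exact: (Ck_affine oU sU Cf)|exact: Ck_cst].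
have Cg0 : Ck 0 U2 g by exact: CkS.
have rho : 0 < th * (3 / 2) <= 1 / 2 by apply/andP; split; [rewrite mulr_gt0|lra].
have [c [b [A [A0 vQ]]]] := approx v g Cv Cg Lv _ rho.
pose Q := quad c b A.
have CQ k : Ck k U2 Q by exact: Ck_quad.
have Cd : Ck 4 U2 (fun y => v y - Q y) by apply: CkB; [exact: oU|exact: Cv|exact: CQ].
have U22 : U2 `<=` affine 0 th @^-1` U2.
  move=> z; rewrite /= !eball0E /affine add0r enormZ gtr0_norm// => z2.
  by have := enorm_ge0 z; nra.
pose w z := th ^- 2 * ((fun y => v y - Q y) \o affine 0 th) z.
have Cda : Ck 4 U2 ((fun y => v y - Q y) \o affine 0 th) by exact: Ck_affine Cd.
have Cw : Ck 4 U2 w by exact: CkZ.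
have hw i j z : U2 z -> partial j (partial i w) z =
    partial j (partial i u) (affine x (s * th) z) - (H i j + (A i j + A j i)).
  move=> Uz; rewrite /w (partial2Z _ _ _ oU _ Uz); last exact: Ck_le Cda.
  rewrite (partial2_affine _ _ oU _ (U22 _ Uz)); last exact: Ck_le Cd.
  rewrite mulrA mulVf ?expf_neq0// mul1r.
  rewrite (partial2B _ _ oU _ _ (U22 _ Uz)); [|exact: Ck_le Cv|exact: CQ].
  by rewrite partial2_quad Hv ?affine_affine /cst; [rewrite [in RHS]opprD addrA|exact: U22].
have lw z : U2 z -> laplacian w z = f (affine x (s * th) z) - a.
  move=> Uz; transitivity (laplacian v (affine 0 th z)); last first.
    by rewrite Lv ?affine_affine//; exact: U22.
  rewrite /laplacian.
  transitivity (\sum_(i < n) (partial i (partial i v) (affine 0 th z) - (A i i + A i i))).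
    apply: eq_bigr => i _; rewrite hw// Hv ?affine_affine ?opprD ?addrA//; exact: U22.
  by rewrite sumrB big_split /= A0 addr0 subr0.
have sU' : U2 `<=` affine x (s * th) @^-1` U1.
  by move=> z Uz; rewrite /= -affine_affine; apply: sU; exact: U22.
have sx' : cball x (s * th * (3 / 2)) `<=` U1.
  apply: subset_trans sx => y /le_trans; apply.
  by rewrite ler_pM2r//; apply: ler_piMr; [exact: ltW|lra].
apply: quad_approxW (quad_approx_normalize n0 (mulr_gt0 s0 th0) sU' sx' Cf Cw hw lw).
have thn : 0 < th ^- n by rewrite invr_gt0 exprn_gt0.
have cU : cball (0 : 'rV[R]_n) (th * (3 / 2)) `<=` U2 by apply: sub_U2; lra.
have E1 : \int[mu]_(z in B32) (w z * w z) =
    th ^- 4 * th ^- n * \int[mu]_(y in eball 0 (th * (3 / 2))) ((v y - Q y) ^+ 2).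
  have CQQ : Ck 0 U2 (fun y => (v y - Q y) ^+ 2).
    have C0' : Ck 0 U2 (fun y => v y - Q y) by exact: Ck_le Cd.
    by apply: eq_Ck (CkM oU C0' C0').
  have CQa : Ck 0 U2 ((fun y => (v y - Q y) ^+ 2) \o affine 0 th) by exact: Ck_affine CQQ.
  rewrite (Rintegral_scale th0 oU cU CQQ).
  rewrite -mulrA [th ^- n * _]mulrA mulVf ?expf_neq0// mul1r.
  rewrite -(RintegralZ_Ck _ cball32_U2 CQa); apply: eq_Rintegral => z _.
  by rewrite /w /=; field.
have E2 : \int[mu]_(z in B32) ((f (affine x (s * th) z) - a) * (f (affine x (s * th) z) - a)) <= th ^- n * M.
  have Cgg : Ck 0 U2 (fun z => g z * g z) by exact: CkM.
  rewrite -ler_pdivrMl// invrK.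
  (* The centring constant stays the average at the larger scale; shrinking the ball then only costs
     the factor th^-n. *)
  apply: le_trans fM; apply: (@le_trans _ _ (\int[mu]_(z in eball 0 (th * (3 / 2))) (g z * g z))).
    rewrite (Rintegral_scale th0 oU cU Cgg) le_eqVlt; apply/orP; left; apply/eqP.
    congr (_ * _); apply: eq_Rintegral => z _.
    by rewrite /g affine_affine.
  apply: (@le_trans _ _ (\int[mu]_(z in B32) (g z * g z))).
    apply: (Rintegral_subset_Ck cball32_U2 Cgg).
      by move=> z; rewrite !eball0E; lra.
    by move=> z _; rewrite -expr2 sqr_ge0.
  by rewrite le_eqVlt; apply/orP; left; apply/eqP; apply: eq_Rintegral => z _; rewrite -expr2.
rewrite E1; apply: lerD; last by rewrite ler_pM2l.
rewrite ler_pM2l// ler_pM2l; last by rewrite mulr_gt0// invr_gt0 exprn_gt0.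
apply: le_trans vQ _; rewrite ler_pM2l//; apply: lerD.
  apply: le_trans fM; rewrite le_eqVlt; apply/orP; left; apply/eqP; apply: eq_Rintegral => z _.
  by rewrite expr2.
by rewrite ler_wpM2l// exprn_ge0// mulr_ge0// ltW.
Qed.

(** Replace the mean Hessian by H, enlarge the ball to radius 2s/3, and rescale. The ratio of
    volumes leaves (s/r)^n, harmless when r is comparable to s. *)
Lemma hessian_oscillation_le U u x (s r : R) (H : 'I_n -> 'I_n -> R) :
  0 < s -> 0 < r -> r <= s * (2 / 3) -> open U -> cball x (s * (2 / 3)) `<=` U -> Ck 4 U u ->
  (eaverage (eball x r)
    (fun y => (frobenius_norm (hessian u y - average_mx (eball x r) (hessian u)) ^+ 2)%:E) <=
  ((s / r) ^+ n / vol 1 * \int[mu]_(z in eball 0 (2 / 3)) (\sum_(i < n) \sum_(j < n)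
     ((partial j (partial i u) (affine x s z) - H i j) *
      (partial j (partial i u) (affine x s z) - H i j))))%:E)%E.
Proof.
move=> s0 r0 rs oU sU Cu.
have rU : cball x r `<=` U by apply: subset_trans sU => y /le_trans; exact.
pose h i j := partial j (partial i u).
have Ch i j : Ck 0 U (h i j) by exact: Ck_le (Ck_partial j (Ck_partial i Cu)).
pose a i j := average (eball x r) (h i j).
pose F (A : 'I_n -> 'I_n -> R) y := \sum_(i < n) \sum_(j < n) ((h i j y - A i j) * (h i j y - A i j)).
have CFij (A : 'I_n -> 'I_n -> R) i j : Ck 0 U (fun y => (h i j y - A i j) * (h i j y - A i j)).
  have Cc : Ck 0 U (fun=> A i j) by exact: Ck_cst.
  by apply: CkM => //; apply: CkB.
have CFi (A : 'I_n -> 'I_n -> R) i : Ck 0 U (fun y => \sum_(j < n) (h i j y - A i j) * (h i j y - A i j)).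
  exact: Ck_sum.
have CF A : Ck 0 U (F A) by exact: Ck_sum.
rewrite (_ : (fun y => _) = EFin \o F a); last first.
  apply/funext => y /=; congr EFin; rewrite /frobenius_norm sqr_sqrtr.
    by apply: eq_bigr => i _; apply: eq_bigr => j _; rewrite !mxE expr2 (_ : (fun y => _) = h i j)//; apply/funext => z; rewrite mxE.
  by apply: sumr_ge0 => i _; apply: sumr_ge0 => j _; rewrite sqr_ge0.
rewrite (eaverage_EFin r0 rU (CF a)) lee_fin (fine_eballE x r0).
have V1 : 0 < vol 1 by exact: fine_eball_gt0.
have s0n : 0 < s ^+ n by rewrite exprn_gt0.
have r0n : 0 < r ^- n by rewrite invr_gt0 exprn_gt0.
have step : \int[mu]_(y in eball x r) F a y <= s ^+ n *
    \int[mu]_(z in eball 0 (2 / 3)) F H (affine x s z).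
  rewrite -(Rintegral_scale s0 oU sU (CF H)).
  apply: (@le_trans _ _ (\int[mu]_(y in eball x r) F H y)); last first.
    apply: (Rintegral_subset_Ck sU (CF H)).
      by move=> y /= /lt_le_trans; apply.
    by move=> y _; apply: sumr_ge0 => i _; apply: sumr_ge0 => j _; rewrite -expr2 sqr_ge0.
  rewrite /F !(Rintegral_sum_Ck _ oU rU (CFi _)); apply: ler_sum => i _.
  rewrite !(Rintegral_sum_Ck _ oU rU (CFij _ i)); apply: ler_sum => j _.
  exact: (variance_le _ r0 oU rU (Ch i j)).
rewrite invfM expr_div_n.
apply: (@le_trans _ _ (r ^- n / vol 1 * (s ^+ n *
    \int[mu]_(z in eball 0 (2 / 3)) F H (affine x s z)))).
  by rewrite ler_pM2l// mulr_gt0// invr_gt0.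
by rewrite le_eqVlt; apply/orP; left; apply/eqP; rewrite /F; ring.
Qed.

End campanato.

(** * Iteration over scales and the resulting Hessian bound *)

Section campanato_iteration.
Variables (R : realType) (n : nat).
Implicit Types (f u v w g h : 'rV[R]_n -> R) (U V : set 'rV[R]_n) (x y z : 'rV[R]_n).

Local Notation mu := (lebesgue_rV R n).
Local Notation B1 := (eball (0 : 'rV[R]_n) 1).
Local Notation B32 := (eball (0 : 'rV[R]_n) (3 / 2)).
Local Notation U1 := (eball (0 : 'rV[R]_n) 1).
Local Notation U2 := (eball (0 : 'rV[R]_n) 2).
Local Notation vol r := (fine (mu (eball (0 : 'rV[R]_n) r))).
Local Notation osc f x s :=
  (\int[mu]_(z in B32) ((f (affine x s z) - average (eball x (s * (3 / 2))) f) ^+ 2)).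
Local Notation sqint x u := (\int[mu]_(y in eball x (1 / 4)) (u y * u y)).

Lemma cball_sub_U1 x (r : R) : eball 0 (3 / 4) x -> r <= 1 / 4 -> cball x r `<=` U1.
Proof.
rewrite eball0E => x34 r4 y; rewrite /cball /= => yr.
rewrite eball0E (_ : y = (y - x) + x); last by rewrite subrK.
by have := enormD (y - x) x; lra.
Qed.

Lemma U2_affine_U1 x (s : R) : eball 0 (3 / 4) x -> 0 < s <= 1 / 16 ->
  U2 `<=` affine x s @^-1` U1.
Proof.
move=> x34 /andP[s0 s16] z /(eball_cball (lexx 2)).
by apply: affine_cball_sub (lexx _) _ _ => //; apply: cball_sub_U1 => //; lra.
Qed.

(** Starts from s^-2 u(x + s z) with H = 0 and c = 0. The normalization costs 16^4 and the change of
    variables 16^n; the remaining factor 16 covers the 2 and the 3. *)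
Lemma quad_approx_base u f x : (0 < n)%N -> eball 0 (3 / 4) x ->
  Ck 4 U1 u -> Ck 1 U1 f -> (forall y, U1 y -> laplacian u y = f y) ->
  quad_approx u f x (1 / 16) (16 ^+ (n + 5) * (sqint x u + sqint x f)).
Proof.
move=> n0 x34 Cu Cf Lu; set s : R := 1 / 16.
have s0 : 0 < s by rewrite /s; lra.
have ss : 0 < s <= 1 / 16 by rewrite s0 lexx.
have oU : open U2 by exact: open_eball.
have oU1 : open U1 by exact: open_eball.
have sU := U2_affine_U1 x34 ss.
have sx : cball x (s * (3 / 2)) `<=` U1 by apply: cball_sub_U1 => //; rewrite /s; lra.
have x4 : cball x (1 / 4) `<=` U1 by exact: cball_sub_U1.
have Cu0 : Ck 0 U1 u by exact: Ck_le Cu.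
have Cf0 : Ck 0 U1 f by exact: CkS.
have Cua : Ck 4 U2 (u \o affine x s) by exact: Ck_affine sU Cu.
have Cw : Ck 4 U2 (fun z => s ^- 2 * (u \o affine x s) z) by exact: CkZ.
have hw i j z : U2 z -> partial j (partial i (fun z => s ^- 2 * (u \o affine x s) z)) z =
    partial j (partial i u) (affine x s z) - 0.
  move=> Uz; rewrite (partial2Z _ _ _ oU _ Uz); last exact: Ck_le Cua.
  rewrite (partial2_affine _ _ oU1 _ (sU _ Uz)); last exact: Ck_le Cu.
  by rewrite mulrA mulVf ?mul1r ?subr0// expf_neq0// gt_eqF.
have lw z : U2 z -> laplacian (fun z => s ^- 2 * (u \o affine x s) z) z = f (affine x s z) - 0.
  move=> Uz; rewrite subr0 -Lu; last exact: sU.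
  by apply: eq_bigr => i _; rewrite hw// subr0.
apply: quad_approxW (quad_approx_normalize n0 s0 sU sx Cf Cw hw lw).
have sq h : Ck 0 U1 h -> \int[mu]_(z in B32) (h (affine x s z) * h (affine x s z)) <=
    16 ^+ n * sqint x h.
  move=> Ch; have Chh : Ck 0 U1 (fun y => h y * h y) by exact: CkM.
  have -> : \int[mu]_(z in B32) (h (affine x s z) * h (affine x s z)) =
      16 ^+ n * \int[mu]_(y in eball x (s * (3 / 2))) (h y * h y).
    rewrite (Rintegral_scale s0 oU1 sx Chh) mulrA -exprMn (_ : 16 * s = 1) ?expr1n ?mul1r//.
    by rewrite /s; lra.
  rewrite ler_pM2l ?exprn_gt0//; apply: (Rintegral_subset_Ck x4 Chh).
    by move=> y /= /lt_le_trans; apply; rewrite /s; lra.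
  by move=> y _; rewrite -expr2 sqr_ge0.
have -> : \int[mu]_(z in B32) (s ^- 2 * (u \o affine x s) z * (s ^- 2 * (u \o affine x s) z)) =
    16 ^+ 4 * \int[mu]_(z in B32) (u (affine x s z) * u (affine x s z)).
  have Cuu : Ck 0 U2 ((fun y => u y * u y) \o affine x s).
    by apply: Ck_affine sU _ => //; exact: CkM.
  rewrite -(RintegralZ_Ck _ (@cball32_U2 R n) Cuu); apply: eq_Rintegral => z _ /=.
  by rewrite (_ : s ^- 2 = 16 ^+ 2); [ring|rewrite /s; field].
have -> : \int[mu]_(z in B32) ((f (affine x s z) - 0) * (f (affine x s z) - 0)) =
    \int[mu]_(z in B32) (f (affine x s z) * f (affine x s z)).
  by apply: eq_Rintegral => z _; rewrite subr0.
have := sq _ Cu0; have := sq _ Cf0.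
have fu0 : 0 <= 16 ^+ n * sqint x u by rewrite mulr_ge0 ?exprn_ge0 ?Rintegral_sqr_ge0.
have ff0 : 0 <= 16 ^+ n * sqint x f by rewrite mulr_ge0 ?exprn_ge0 ?Rintegral_sqr_ge0.
have -> : 16 ^+ (n + 5) * (sqint x u + sqint x f) =
    16 ^+ 5 * (16 ^+ n * sqint x u + 16 ^+ n * sqint x f).
  by rewrite (exprD 16 n 5); ring.
move: fu0 ff0; set a := 16 ^+ n * _; set b := 16 ^+ n * _.
have : (1 : R) <= 16 ^+ 4 by rewrite exprn_ege1//; lra.
rewrite (exprS 16 4); set X := \int[mu]_(z in _) _; set Y := \int[mu]_(z in _) _; set p := 16 ^+ 4.
clear => p1 a0 b0 Xb Ya; have h1 : p * Y <= p * a by rewrite ler_wpM2l//; lra.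
have h2 : b <= p * b by rewrite ler_peMl.
have h3 : 0 <= p * a by rewrite mulr_ge0//; lra.
by move: h1 h2 h3; clear -Xb a0 b0; lra.
Qed.

Lemma quad_approx_iter : (0 < n)%N -> exists th D : R, [/\ 0 < th, th <= 1 / 3, 0 < D &
  forall u f x (M K : R), eball 0 (3 / 4) x -> Ck 4 U1 u -> Ck 1 U1 f ->
  (forall s : R, 0 < s <= 1 / 16 -> osc f x s <= M) -> 0 <= M -> D * M <= K ->
  quad_approx u f x (1 / 16) K ->
  forall k, quad_approx u f x (1 / 16 * th ^+ k) K].
Proof.
move=> n0; have [C0 C00 approx] := @quadratic_approximation R n n0.
(* [E] is set so that the coefficient of the old K in [quad_approx_step] is E th^2 / 2. The choice
   th = 1 / (3 + E) makes E th^2 <= 1 and th <= 1/3, so at most K/2 is retained. *)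
pose E := 4 * C0 * (3 / 2) ^+ (n + 6).
have E0 : 0 < E by rewrite !mulr_gt0// exprn_gt0.
pose th := (3 + E)^-1.
have th0 : 0 < th by rewrite invr_gt0; lra.
have thE : th * (3 + E) = 1 by rewrite mulVf// gt_eqF//; lra.
have th3 : th <= 1 / 3 by move: thE th0 E0; clear; nra.
have Eth : E * th ^+ 2 <= 1 by move: thE th0 E0 th3; clear; nra.
(* Twice the coefficient of M in the step, so that D M <= K bounds the source contribution by K/2
   and K is reproduced exactly. *)
pose D := 2 * (2 * (th ^- 4 * th ^- n * C0) + 3 * th ^- n).
have thk k : 0 < th ^- k by rewrite invr_gt0 exprn_gt0.
have D0 : 0 < D by rewrite mulr_gt0// addr_gt0// !mulr_gt0.
exists th, D; split => // u f x M K x34 Cu Cf fM M0 DK base.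
have K0 : 0 <= K by apply: le_trans DK; rewrite mulr_ge0// ltW.
elim=> [|k ih]; first by rewrite expr0 mulr1.
have thk0 : 0 < th ^+ k by rewrite exprn_gt0.
have thk1 : th ^+ k <= 1 by rewrite exprn_ile1 ?ltW//; lra.
have sk : 0 < 1 / 16 * th ^+ k <= 1 / 16.
  by apply/andP; split; [rewrite mulr_gt0|rewrite ler_piMr].
have [sk0 sk1] := andP sk.
have sx : cball x (1 / 16 * th ^+ k * (3 / 2)) `<=` U1.
  by apply: cball_sub_U1 => //; move: sk1; set s := _ * _; clear; lra.
have := quad_approx_step n0 sk0 th0 th3 C00 approx (U2_affine_U1 x34 sk) sx Cu Cf (fM _ sk) ih.
rewrite -[1 / 16 * th ^+ k * th]mulrA -exprSr; apply: quad_approxW.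
have -> : th ^- 4 * th ^- n * (C0 * (M + (th * (3 / 2)) ^+ (n + 6) * K)) =
    th ^- 4 * th ^- n * C0 * M + E / 4 * th ^+ 2 * K.
  rewrite exprMn [th ^+ (n + 6)]exprD [th ^+ 6](exprD _ 2 4) /E.
  by field; rewrite gt_eqF//= ?exprn_gt0// gt_eqF.
move: DK (ler_wpM2r K0 Eth); rewrite /D; set X := th ^- 4 * _ * C0; set Y := th ^- n.
by clear; lra.
Qed.

(** The Hessian of v is the rescaled Hessian of u minus H, so Caccioppoli for v bounds the deviation
    of D^2 u from a constant. *)
Lemma hessian_oscillation_small u f x (s r K M : R) :
  eball 0 (3 / 4) x -> Ck 4 U1 u -> Ck 1 U1 f ->
  0 < s <= 1 / 16 -> 0 < r <= s * (2 / 3) -> osc f x s <= M -> quad_approx u f x s K ->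
  (eaverage (eball x r)
    (fun y => (frobenius_norm (hessian u y - average_mx (eball x r) (hessian u)) ^+ 2)%:E) <=
  ((s / r) ^+ n / vol 1 * (35 * (156 * (65 * K + M) + 14 * M)))%:E)%E.
Proof.
move=> x34 Cu Cf ss /andP[r0 rs] fM [v [H [Cv Hv Lv vK]]].
have [s0 s16] := andP ss.
have oU : open U2 by exact: open_eball.
have oU1 : open U1 by exact: open_eball.
have sU := U2_affine_U1 x34 ss.
have sx : cball x (s * (2 / 3)) `<=` U1.
  by apply: cball_sub_U1 => //; move: s16; clear; lra.
apply: le_trans (hessian_oscillation_le H s0 r0 rs oU1 sx Cu) _.
have V1 : 0 < vol 1 by exact: fine_eball_gt0.
rewrite lee_fin ler_pM2l; last by rewrite divr_gt0// exprn_gt0// divr_gt0.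
pose g z := f (affine x s z) - average (eball x (s * (3 / 2))) f.
have Cg : Ck 1 U2 g.
  by apply: CkB => //; [exact: (Ck_affine oU sU Cf)|exact: Ck_cst].
have cU : cball (0 : 'rV[R]_n) 1 `<=` U2 by apply: sub_U2; lra.
have sub h : Ck 0 U2 h -> \int[mu]_(z in B1) (h z * h z) <= \int[mu]_(z in B32) (h z * h z).
  move=> Ch; have Chh : Ck 0 U2 (fun y => h y * h y) by exact: CkM.
  apply: (Rintegral_subset_Ck (@cball32_U2 R n) Chh).
    by move=> z; rewrite !eball0E; lra.
  by move=> z _; rewrite -expr2 sqr_ge0.
have vB : \int[mu]_(z in B1) (v z * v z) <= K by apply: le_trans vK; apply: sub; exact: Ck_le Cv.
have gB : \int[mu]_(z in B1) (g z * g z) <= M.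
  apply: le_trans fM; apply: le_trans (sub _ (CkS Cg)) _.
  by rewrite le_eqVlt; apply/orP; left; apply/eqP; apply: eq_Rintegral => z _; rewrite -expr2.
have -> : \int[mu]_(z in eball 0 (2 / 3)) (\sum_(i < n) \sum_(j < n)
     ((partial j (partial i u) (affine x s z) - H i j) *
      (partial j (partial i u) (affine x s z) - H i j))) =
   \int[mu]_(z in eball 0 (2 / 3)) (\sum_(i < n) \sum_(j < n)
     (partial j (partial i v) z * partial j (partial i v) z)).
  apply: eq_Rintegral => z; rewrite inE eball0E => z23.
  apply: eq_bigr => i _; apply: eq_bigr => j _; rewrite Hv// eball0E; lra.
apply: le_trans (caccioppoli oU cU Cv Cg Lv) _.
by move: vB gB; clear; lra.
Qed.

Lemma hessian_oscillation_large u f x (r : R) :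
  eball 0 (3 / 4) x -> Ck 4 U1 u -> Ck 1 U1 f -> (forall y, U1 y -> laplacian u y = f y) ->
  1 / 24 <= r <= 1 / 8 ->
  (eaverage (eball x r)
    (fun y => (frobenius_norm (hessian u y - average_mx (eball x r) (hessian u)) ^+ 2)%:E) <=
  ((9 / 2) ^+ n / vol 1 * (35 * (156 * (65 * (16 ^+ (n + 4) * sqint x u)
     + 16 ^+ n * sqint x f) + 14 * (16 ^+ n * sqint x f))))%:E)%E.
Proof.
(* With s = 3/16 the inner ball has radius 2s/3 = 1/8, the outer one lies in B_(1/4)(x), and r >=
   1/24 gives s/r <= 9/2. *)
move=> x34 Cu Cf Lu /andP[r24 r8]; set s : R := 3 / 16.
have s0 : 0 < s by rewrite /s; lra.
have r0 : 0 < r by lra.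
have rs : r <= s * (2 / 3) by rewrite /s; lra.
have oU1 : open U1 by exact: open_eball.
pose V := affine x s @^-1` U1.
have oV : open V by exact: open_preimage_affine.
have sx1 : cball x (s * 1) `<=` U1 by apply: cball_sub_U1 => //; rewrite /s; lra.
have x4 : cball x (1 / 4) `<=` U1 by exact: cball_sub_U1.
have BV : cball 0 1 `<=` V by exact: affine_cball_sub sx1.
have sx : cball x (s * (2 / 3)) `<=` U1 by apply: cball_sub_U1 => //; rewrite /s; lra.
apply: le_trans (hessian_oscillation_le (fun _ _ => 0) s0 r0 rs oU1 sx Cu) _.
have V1 : 0 < vol 1 by exact: fine_eball_gt0.
have Cu0 : Ck 0 U1 u by exact: Ck_le Cu.
have Cf0 : Ck 0 U1 f by exact: CkS.
have Cua : Ck 4 V (u \o affine x s) by exact: Ck_preimage_affine.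
have Cfa : Ck 1 V (f \o affine x s) by exact: Ck_preimage_affine.
pose v z := s ^- 2 * (u \o affine x s) z.
have Cv : Ck 4 V v by exact: CkZ.
have hv i j z : V z -> partial j (partial i v) z = partial j (partial i u) (affine x s z).
  move=> Vz; rewrite (partial2Z _ _ _ oV _ Vz); last exact: Ck_le Cua.
  rewrite (partial2_affine _ _ oU1 _ Vz); last exact: Ck_le Cu.
  by rewrite mulrA mulVf ?mul1r// expf_neq0// gt_eqF.
have lv z : V z -> laplacian v z = (f \o affine x s) z.
  by move=> Vz; rewrite /= -(Lu _ Vz); apply: eq_bigr => i _; exact: hv.
have s1 : 1 <= 16 * s by rewrite /s; lra.
have sq h : Ck 0 U1 h -> \int[mu]_(z in B1) ((h \o affine x s) z * (h \o affine x s) z) <=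
    16 ^+ n * sqint x h.
  move=> Ch; have Chh : Ck 0 U1 (fun y => h y * h y) by exact: CkM.
  apply: (@le_trans _ _ (16 ^+ n * \int[mu]_(y in eball x (s * 1)) (h y * h y))).
    rewrite (Rintegral_scale s0 oU1 sx1 Chh) mulrA -exprMn ler_peMl ?exprn_ege1//.
    by apply: Rintegral_ge0 => z _; rewrite -expr2 sqr_ge0.
  rewrite ler_pM2l ?exprn_gt0//; apply: (Rintegral_subset_Ck x4 Chh).
    by move=> y /= /lt_le_trans; apply; rewrite /s; lra.
  by move=> y _; rewrite -expr2 sqr_ge0.
have vE : \int[mu]_(z in B1) (v z * v z) =
    s ^- 4 * \int[mu]_(z in B1) ((u \o affine x s) z * (u \o affine x s) z).
  have Cuu : Ck 0 V (fun z => (u \o affine x s) z * (u \o affine x s) z).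
    by apply: CkM => //; exact: Ck_le Cua.
  rewrite -(RintegralZ_Ck _ BV Cuu); apply: eq_Rintegral => z _.
  by rewrite /v; field; rewrite gt_eqF.
have := caccioppoli oV BV Cv Cfa lv; rewrite vE.
set I := \int[mu]_(z in eball 0 (2 / 3)) _.
have <- : \int[mu]_(z in eball 0 (2 / 3)) (\sum_(i < n) \sum_(j < n)
     ((partial j (partial i u) (affine x s z) - 0) *
      (partial j (partial i u) (affine x s z) - 0))) = I.
  apply: eq_Rintegral => z; rewrite inE eball0E => z23.
  apply: eq_bigr => i _; apply: eq_bigr => j _; rewrite subr0 hv//.
  by apply: BV; rewrite cball0E; lra.
have := sq _ Cu0; have := sq _ Cf0.
set A := \int[mu]_(z in B1) _; set B := \int[mu]_(z in B1) _; set J := \int[mu]_(z in eball 0 _) _.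
move=> Af Bu HJ.
have B0 : 0 <= B by exact: Rintegral_sqr_ge0.
have s4 : s ^- 4 * B <= 16 ^+ (n + 4) * sqint x u.
  rewrite exprD mulrAC mulrC ler_pM ?invr_ge0 ?exprn_ge0 ?(ltW s0)//.
  by rewrite -exprVn ler_pXn2r ?nnegrE ?invr_ge0 ?(ltW s0)// /s; lra.
have J0 : 0 <= J.
  apply: Rintegral_ge0 => z _; apply: sumr_ge0 => i _; apply: sumr_ge0 => j _.
  by rewrite -expr2 sqr_ge0.
rewrite lee_fin; apply: ler_pM => //.
- by rewrite mulr_ge0 ?invr_ge0 ?(ltW V1)// exprn_ge0// divr_ge0// ltW.
- rewrite ler_pM2r ?invr_gt0//; apply: lerXn2r.
  + by rewrite nnegrE divr_ge0// ltW.
  + by rewrite nnegrE.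
  + by rewrite ler_pdivrMr// /s; lra.
by apply: le_trans HJ _; move: s4 Af; clear; lra.
Qed.

(** Takes the least k with t th^(k+1) <= r; minimality, or r <= t when k = 0, gives the upper
    bound. *)
Lemma pow_bracket (th t r : R) : 0 < th -> th <= 1 / 2 -> 0 < r -> r <= t -> t <= 1 ->
  exists k, t * th ^+ k.+1 <= r <= t * th ^+ k.
Proof.
move=> th0 th2 r0 rt t1.
have ex : exists k, t * th ^+ k.+1 <= r.
  have [k] := ltr_add_invr r0; rewrite add0r => kr; exists k.
  apply: le_trans (ltW kr).
  apply: (@le_trans _ _ (th ^+ k.+1)).
    by rewrite ler_piMl// exprn_ge0// ltW.
  apply: (@le_trans _ _ ((1 / 2) ^+ k.+1)).
    by apply: lerXn2r => //; rewrite nnegrE ltW.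
  rewrite div1r exprVn lef_pV2 ?posrE ?exprn_gt0//.
  by rewrite -natrX ler_nat ltnW// ltn_expl.
case: (ex_minnP ex) => k kr kmin; exists k; rewrite kr /=.
case: k kr kmin => [|k] kr kmin; first by rewrite expr0 mulr1.
rewrite leNgt; apply/negP => /ltW /kmin; by rewrite ltnn.
Qed.

Lemma hessian_oscillation_bound : (0 < n)%N -> exists2 C : R, 0 < C &
  forall u f x (M : R), eball 0 (3 / 4) x -> Ck 4 U1 u -> Ck 1 U1 f ->
  (forall y, U1 y -> laplacian u y = f y) ->
  (forall s : R, 0 < s <= 1 / 16 -> osc f x s <= M) -> 0 <= M ->
  forall r : R, 0 < r < 1 / 8 ->
  (eaverage (eball x r)
    (fun y => (frobenius_norm (hessian u y - average_mx (eball x r) (hessian u)) ^+ 2)%:E) <=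
  (C * (sqint x u + sqint x f + M))%:E)%E.
Proof.
move=> n0; have [th [D [th0 th3 D0 iter]]] := quad_approx_iter n0.
have V1 : 0 < vol 1 by exact: fine_eball_gt0.
(* In the small case s = th^k / 16 and r >= th^(k+1) / 24, so s/r <= 3 / (2 th). [a] and [b] are the
   volume factors for small and large radii. *)
pose a := (3 / 2 / th) ^+ n / vol 1; pose b := (9 / 2) ^+ n / vol 1.
have a0 : 0 < a by rewrite divr_gt0// exprn_gt0// divr_gt0.
have b0 : 0 < b by rewrite divr_gt0// exprn_gt0.
pose p : R := 16 ^+ (n + 5); pose q : R := 16 ^+ (n + 4); pose t : R := 16 ^+ n.
have p0 : 0 < p by rewrite exprn_gt0.
have q0 : 0 < q by rewrite exprn_gt0.
have t0 : 0 < t by rewrite exprn_gt0.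
pose C1 := 35 * (156 * (65 * (p + D) + 1) + 14).
pose C2 := 35 * (156 * (65 * q + t) + 14 * t).
have C10 : 0 < C1 by rewrite /C1; lra.
have C20 : 0 < C2 by rewrite /C2; lra.
exists (a * C1 + b * C2); first by rewrite addr_gt0// mulr_gt0.
move=> u f x M x34 Cu Cf Lu fM M0 r /andP[r0 r8].
have Iu : 0 <= sqint x u by exact: Rintegral_sqr_ge0.
have If : 0 <= sqint x f by exact: Rintegral_sqr_ge0.
have [r24|r24] := leP (1 / 24) r.
  have rr : 1 / 24 <= r <= 1 / 8 by rewrite r24 ltW.
  apply: le_trans (hessian_oscillation_large x34 Cu Cf Lu rr) _.
  rewrite lee_fin -/b -/q -/t; apply: (@le_trans _ _ (b * C2 * (sqint x u + sqint x f + M))).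
    rewrite -mulrA ler_pM2l// /C2; move: Iu If; set X := sqint x u; set Y := sqint x f => Iu If.
    have qM : 0 <= q * M by rewrite mulr_ge0// ltW.
    have qY : 0 <= q * Y by rewrite mulr_ge0// ltW.
    have tM : 0 <= t * M by rewrite mulr_ge0// ltW.
    have tX : 0 <= t * X by rewrite mulr_ge0// ltW.
    by move: qM qY tM tX; clear; lra.
  by rewrite ler_wpM2r ?addr_ge0// lerDr mulr_ge0// ltW.
(* The least K meeting both demands at once: the starting bound and D M <= K. *)
pose K := p * (sqint x u + sqint x f) + D * M.
have pI : 0 <= p * (sqint x u + sqint x f) by rewrite mulr_ge0 ?addr_ge0// ltW.
have DM : 0 <= D * M by rewrite mulr_ge0// ltW.
have base : quad_approx u f x (1 / 16) K.
  by apply: quad_approxW (quad_approx_base n0 x34 Cu Cf Lu); rewrite /K lerDl.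
have DK : D * M <= K by rewrite /K lerDr.
have th2 : th <= 1 / 2 by lra.
have t1 : (1 / 24 : R) <= 1 by lra.
(* Here 1/24 = (1/16) (2/3) is the radius at which Caccioppoli delivers at the first scale. *)
have [k /andP[kr rk]] := pow_bracket th0 th2 r0 (ltW r24) t1.
have approx := iter u f x M K x34 Cu Cf fM M0 DK base k.
have thk0 : 0 < th ^+ k by rewrite exprn_gt0.
have thk1 : th ^+ k <= 1 by rewrite exprn_ile1 ?ltW//; lra.
have ss : 0 < 1 / 16 * th ^+ k <= 1 / 16.
  by apply/andP; split; [rewrite mulr_gt0|rewrite ler_piMr].
have rs : 0 < r <= 1 / 16 * th ^+ k * (2 / 3) by rewrite r0 /=; move: rk; clear; lra.
apply: le_trans (hessian_oscillation_small x34 Cu Cf ss rs (fM _ ss) approx) _.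
rewrite lee_fin; apply: (@le_trans _ _ (a * C1 * (sqint x u + sqint x f + M))); last first.
  by rewrite ler_wpM2r ?addr_ge0// lerDl mulr_ge0// ltW.
rewrite -[a * C1 * _]mulrA; apply: ler_pM.
- by rewrite mulr_ge0 ?invr_ge0 ?(ltW V1)// exprn_ge0// divr_ge0 ?(ltW r0)// ltW//; case/andP: ss.
- by move: pI DM M0; rewrite /K; clear; lra.
- rewrite /a ler_pM2r ?invr_gt0//; apply: lerXn2r.
  + by rewrite nnegrE divr_ge0 ?(ltW r0)// ltW//; case/andP: ss.
  + by rewrite nnegrE divr_ge0// ltW.
  rewrite ler_pdivrMr// [leRHS]mulrAC ler_pdivlMr//.
  by move: kr; rewrite exprSr; clear; lra.
rewrite /C1 /K; move: Iu If; set X := sqint x u; set Y := sqint x f => Iu If.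
have pM : 0 <= p * M by rewrite mulr_ge0// ltW.
have DX : 0 <= D * X by rewrite mulr_ge0// ltW.
have DY : 0 <= D * Y by rewrite mulr_ge0// ltW.
by move: pM DX DY Iu If; clear; lra.
Qed.

End campanato_iteration.

(** * Sharp maximal functions, L^2 norms and the conclusion *)

Section sharp_maximal.
Variables (R : realType) (n : nat).
Implicit Types (f u : 'rV[R]_n -> R) (U : set 'rV[R]_n) (x y z : 'rV[R]_n).

Local Notation mu := (lebesgue_rV R n).
Local Notation U1 := (eball (0 : 'rV[R]_n) 1).
Local Notation vol r := (fine (mu (eball (0 : 'rV[R]_n) r))).

Lemma L2norm_ge0 (E : set 'rV[R]_n) u : (0 <= L2norm E u)%E.
Proof. exact: Lnorm_ge0. Qed.

(** Stated in the extended reals, since the norm may be infinite; the finite and infinite cases of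
    the square are treated apart. *)
Lemma sqr_L2norm (E : set 'rV[R]_n) u : measurable E ->
  (L2norm E u ^+ 2 = \int[mu]_(y in E) (u y * u y)%:E)%E.
Proof.
move=> mE; transitivity (poweR (L2norm E u) 2).
  have := L2norm_ge0 E u; case: (L2norm E u) => [a|_|//].
    by rewrite lee_fin => a0; rewrite poweR_EFin -EFin_expe (powR_mulrn 2 a0).
  by rewrite poweRyr// expe2 mulyy.
rewrite /L2norm poweR_Lnorm// [RHS]integral_mkcond; apply: eq_integral => y _.
rewrite abse_EFin poweR_EFin powR_mulrn// real_normK ?num_real// patchE /patch.
by case: ifP => _; [rewrite expr2|exact: (congr1 EFin (mulr0 (0 : R)))].
Qed.

Lemma sqr_integral_le_L2norm u x (r : R) : cball x r `<=` U1 -> Ck 0 U1 u ->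
  ((\int[mu]_(y in eball x r) (u y * u y))%:E <= L2norm U1 u ^+ 2)%E.
Proof.
move=> xU Cu; have oU1 : open U1 by exact: open_eball.
have Cuu : Ck 0 U1 (fun y => u y * u y) by exact: CkM.
rewrite sqr_L2norm; last exact: measurable_eball.
rewrite fineK; last first.
  by apply: integrable_fin_num; [exact: measurable_eball|exact: Ck_integrable Cuu xU].
apply: ge0_subset_integral.
- exact: measurable_eball.
- exact: measurable_eball.
- apply/measurable_EFinP; apply: Ck_measurable Cuu _ _; [exact: open_eball|exact: subset_refl].
- by move=> y _; rewrite lee_fin -expr2 sqr_ge0.
- by apply: subset_trans xU; exact: eball_cball.
Qed.

(** The radius r0/2 witnesses that the supremum is over a nonempty set; this excludes the value
    -oo. *)
Lemma sharp_maximal_ge0 (r0 : R) f x : 0 < r0 -> (0 <= sharp_maximal r0 f x)%E.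
Proof.
move=> r00; have r02 : 0 < r0 / 2 by rewrite divr_gt0.
apply: (@le_trans _ _ (eaverage (eball x (r0 / 2))
    (fun y => (`|f y - average (eball x (r0 / 2)) f| ^+ 2)%:E))).
  rewrite /eaverage inve_eball// mule_ge0//.
    by rewrite lee_fin invr_ge0 ltW// fine_eball_gt0.
  by apply: integral_ge0 => y _; rewrite lee_fin sqr_ge0.
apply: ereal_sup_ubound; exists (r0 / 2) => //=.
by rewrite in_itv/= r02 gtr_pMr// invf_lt1// ltr1n.
Qed.

(** A single admissible radius s r is used; rescaling turns the average into an integral over B_r,
    whence the factor [vol r]. *)
Lemma sharp_maximal_osc (r0 s r M : R) f x : 0 < s -> 0 < r -> s * r < r0 ->
  cball x (s * r) `<=` U1 -> Ck 0 U1 f -> (sharp_maximal r0 f x <= M%:E)%E ->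
  \int[mu]_(z in eball 0 r) ((f (affine x s z) - average (eball x (s * r)) f) ^+ 2) <=
  vol r * M.
Proof.
move=> s0 r10 sr sU Cf; have sr0 : 0 < s * r by exact: mulr_gt0.
have oU1 : open U1 by exact: open_eball.
set a := average _ _.
have Cc : Ck 0 U1 (fun=> a) by exact: Ck_cst.
have Cg : Ck 0 U1 (fun y => (f y - a) * (f y - a)) by apply: CkM => //; apply: CkB.
have V0 : 0 < vol r by exact: fine_eball_gt0.
have sn : s ^+ n != 0 by rewrite expf_neq0// gt_eqF.
move=> fM; have : (eaverage (eball x (s * r))
    (fun y => (`|f y - average (eball x (s * r)) f| ^+ 2)%:E) <= M%:E)%E.
  apply: le_trans fM; apply: ereal_sup_ubound; exists (s * r) => //=.
  by rewrite in_itv/= sr0.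
rewrite (_ : (fun y => _) = EFin \o (fun y => (f y - a) * (f y - a))); last first.
  by apply/funext => y /=; rewrite real_normK ?num_real// expr2.
rewrite (eaverage_EFin sr0 sU Cg) lee_fin (Rintegral_scale s0 oU1 sU Cg) fine_eball_scale//.
rewrite invfM mulrACA mulVf// mul1r ler_pdivrMl//.
Qed.

End sharp_maximal.

Theorem proposition2p1 (R : realType) (n : nat) (hn : (1 <= n)%N) :
  exists2 C : R, 0 < C &
    forall u f : 'rV[R]_n -> R,
      smooth_on (eball 0 1) u ->
      smooth_on (eball 0 1) f ->
      (forall y, eball 0 1 y -> laplacian u y = f y) ->
      forall x, eball 0 (3 / 4) x ->
        (sharp_maximal_mx (1 / 8) (hessian u) x <=
         C%:E * (L2norm (eball 0 1) u ^+ 2 + L2norm (eball 0 1) f ^+ 2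
                 + sharp_maximal (1 / 8) f x))%E.
Proof.
have [C C0 bound] := @hessian_oscillation_bound R n hn.
pose V := fine (lebesgue_rV R n (eball 0 (3 / 2))).
have V0 : 0 < V by apply: fine_eball_gt0; lra.
(* The rescaled oscillation is an integral over B_(3/2), hence bounded by V M; the factor 1 + V
   absorbs V. *)
exists (C * (1 + V)); first by rewrite mulr_gt0// addr_gt0.
move=> u f su sf Lu x x34.
have Cu := smooth_on_Ck 4 su; have Cf := smooth_on_Ck 1 sf.
have Cu0 : Ck 0 (eball 0 1) u by exact: Ck_le Cu.
have Cf0 : Ck 0 (eball 0 1) f by exact: CkS.
have x4 : cball x (1 / 4) `<=` eball 0 1 by exact: cball_sub_U1.
have uL := sqr_integral_le_L2norm x4 Cu0.
have fL := sqr_integral_le_L2norm x4 Cf0.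
have uL0 : (0 <= L2norm (eball 0 1) u ^+ 2)%E by rewrite expe_ge0 ?L2norm_ge0.
have fL0 : (0 <= L2norm (eball 0 1) f ^+ 2)%E by rewrite expe_ge0 ?L2norm_ge0.
have M0 : (0 <= sharp_maximal (1 / 8) f x)%E by apply: sharp_maximal_ge0; lra.
have CV0 : 0 < C * (1 + V) by rewrite mulr_gt0// addr_gt0.
have : (sharp_maximal (1 / 8) f x <= sharp_maximal (1 / 8) f x)%E by [].
(* If the sharp maximal function of f is infinite, so is the right-hand side, its other terms being
   nonnegative; otherwise it is a real M. *)
move: M0; case: {-2}(sharp_maximal (1 / 8) f x) => [M|_|//]; last first.
  move=> _; rewrite addey; last first.
    by rewrite gt_eqF// (lt_le_trans ltNy0)// adde_ge0.
  by rewrite mulry gtr0_sg// mul1e leey.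
rewrite lee_fin => M0 Mf.
apply: (@le_trans _ _ ((C * (1 + V)) *
  (\int[lebesgue_rV R n]_(y in eball x (1 / 4)) (u y * u y) +
   \int[lebesgue_rV R n]_(y in eball x (1 / 4)) (f y * f y) + M))%:E); last first.
  by rewrite EFinM lee_pmul2l// !EFinD !leeD.
have fM (s : R) : 0 < s <= 1 / 16 -> \int[lebesgue_rV R n]_(z in eball 0 (3 / 2))
    ((f (affine x s z) - average (eball x (s * (3 / 2))) f) ^+ 2) <= V * M.
  (* The radius 3s/2 is at most 3/32, below the limit 1/8. *)
  move=> /andP[s0 s16]; apply: sharp_maximal_osc Mf => //; first by lra.
  by apply: cball_sub_U1 => //; lra.
have VM0 : 0 <= V * M by rewrite mulr_ge0// ltW.
apply: ge_ereal_sup => y [r /=]; rewrite in_itv /= => r18 <-.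
apply: le_trans (bound u f x _ x34 Cu Cf Lu fM VM0 r r18) _.
rewrite lee_fin -mulrA ler_pM2l//.
have := @Rintegral_sqr_ge0 R n x (1 / 4) u; have := @Rintegral_sqr_ge0 R n x (1 / 4) f.
set X := \int[_]_(y in _) (f y * f y); set Y := \int[_]_(y in _) (u y * u y).
move=> X0 Y0; have VX : 0 <= V * X by rewrite mulr_ge0// ltW.
have VY : 0 <= V * Y by rewrite mulr_ge0// ltW.
by move: VX VY M0; clear; lra.
Qed.
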